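(* Fix $\theta,t>0$. Let $\vec\ell$ be distributed according to the measure $\mathbb{P}^{\theta,tN}_{\mathfrak{r},N}$ defined in the context. The sequence of empirical measures $\mu_N:=\frac1N\sum_{i=1}^N\delta(\ell_i/N)$ converges weakly in probability, as $N\to\infty$, to the measure with density $\phi^{\theta,t}_{\mathfrak{r}}$ defined in the context.
   Context: $\mathbb{W}^{\theta,\infty}_N$ is the set of $(\ell_1,\dots,\ell_N)$ with $\ell_i=\lambda_i+(N-i)\theta$, where $\lambda_1\ge\cdots\ge\lambda_N\ge0$ are integers. The probability measure $\mathbb{P}^{\theta,tN}_{\mathfrak{r},N}$ on $\mathbb{W}^{\theta,\infty}_N$ is $$\mathbb{P}^{\theta,tN}_{\mathfrak{r},N}(\vec\ell)=\frac1Z\prod_{1\le i<j\le N}\frac{\Gamma(\ell_i-\ell_j+\theta)\Gamma(\ell_i-\ell_j+1)}{\Gamma(\ell_i-\ell_j)\Gamma(\ell_i-\ell_j+1-\theta)}\prod_{i=1}^N\frac{(t\theta N)^{\ell_i}}{\Gamma(\ell_i+1)},$$ with $Z$ the normalization constant. The density on $[0,\infty)$: put $a=\theta(\sqrt t-1)^2$, $b=\theta(\sqrt t+1)^2$. For $x\in(a,b)$, $$\phi^{\theta,t}_{\mathfrak{r}}(x)=(\theta\pi)^{-1}\operatorname{arccot}\left(\frac{x+\theta(t-1)}{\sqrt{4\theta tx-[x+\theta(t-1)]^2}}\right),$$ where $\operatorname{arccot}$ takes values in $(0,\pi)$. If $t\ge1$, $\phi^{\theta,t}_{\mathfrak{r}}(x)=0$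 for all other $x \geq 0$. If $t\in(0,1)$, $\phi^{\theta,t}_{\mathfrak{r}}(x)=\theta^{-1}$ for $0\le x<a$ and $\phi^{\theta,t}_{\mathfrak{r}}(x)=0$ for $x>b$. Convergence weakly in probability of $\mu_N$ to a measure with density $\phi$ means that for every bounded continuous real $f$ on $[0,\infty)$, $\int f\,d\mu_N-\int f(x)\phi(x)\,dx\to0$ in probability. *)

(* Defs.v *)
From HB Require Import structures.
From mathcomp Require Import all_boot all_order all_algebra.
From mathcomp Require Import all_classical all_reals all_analysis.

Set Implicit Arguments.
Unset Strict Implicit.
Unset Printing Implicit Defensive.

Import Order.TTheory GRing.Theory Num.Theory.
Import numFieldNormedType.Exports.

Local Open Scope classical_set_scope.
Local Open Scope ring_scope.

(* Euler's integral; it is the Gamma function for [z > 0], and the arguments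
   that occur below are all positive when [l] is in [weyl_chamber theta N]. *)
Definition Gamma (R : realType) (z : R) : R :=
  \int[lebesgue_measure]_(x in `]0, +oo[) (x `^ (z - 1) * expR (- x)).

(* Indices run over 0, ..., N-1, so that [(N - i.+1)%N] is the N - i of the
   1-based convention. *)
Definition weyl_chamber (R : realType) (theta : R) (N : nat) :
    set (N.-tuple R) :=
  [set l | exists2 lambda : N.-tuple nat, sorted geq lambda &
    forall i : 'I_N,
      tnth l i = (tnth lambda i)%:R + (N - i.+1)%:R * theta].
Arguments weyl_chamber {R} theta N.

(* Unnormalized weight with parameter [s]; the measure of interest has
   [s = t N], so that the base of the power is t theta N. *)
Definition charlier_weight (R : realType) (theta s : R) (N : nat)
    (l : N.-tuple R) : R :=
  (\prod_(i < N) \prod_(j < N | (i < j)%N)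
     let u := tnth l i - tnth l j in
     (Gamma (u + theta) * Gamma (u + 1)) /
     (Gamma u * Gamma (u + 1 - theta))) *
  \prod_(i < N) ((s * theta) `^ tnth l i / Gamma (tnth l i + 1)).

Definition charlier_mass (R : realType) (theta s : R) (N : nat)
    (A : set (N.-tuple R)) : \bar R :=
  \esum_(l in A `&` weyl_chamber theta N) (charlier_weight theta s l)%:E.

Lemma Gamma_ge0 (R : realType) (z : R) : 0 <= Gamma z.
Proof.
by apply: Rintegral_ge0 => x _; rewrite mulr_ge0 ?powR_ge0 ?expR_ge0.
Qed.

Lemma charlier_weight_ge0 (R : realType) (theta s : R) (N : nat)
  (l : N.-tuple R) : 0 <= charlier_weight theta s l.
Proof.
rewrite /charlier_weight mulr_ge0// prodr_ge0// => i _.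
  by rewrite prodr_ge0// => j _; rewrite divr_ge0// mulr_ge0// Gamma_ge0.
by rewrite divr_ge0 ?powR_ge0 ?Gamma_ge0.
Qed.

Section charlier_mass_measure.
Local Open Scope ereal_scope.
Context (R : realType) (theta s : R) (N : nat).

Let mass0 : @charlier_mass R theta s N set0 = 0.
Proof. by rewrite /charlier_mass set0I esum_set0. Qed.

Let mass_ge0 (A : set (N.-tuple R)) : 0 <= charlier_mass theta s A.
Proof.
by apply: esum_ge0 => l _; rewrite lee_fin charlier_weight_ge0.
Qed.

Let mass_sigma_additive : semi_sigma_additive (@charlier_mass R theta s N).
Proof.
move=> F mF tF mUF; apply: cvg_toP.
  apply: ereal_nondecreasing_is_cvgn => a b ab.
  by apply: lee_sum_nneg_natr => // n _ _; exact: mass_ge0.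
rewrite nneseries_esumT//.
rewrite /charlier_mass setI_bigcupl esum_bigcupT//.
- apply/trivIsetP => i j _ _ ij; rewrite setIACA setIid.
  by move/trivIsetP : tF => -> //; rewrite set0I.
- by move=> l; rewrite lee_fin charlier_weight_ge0.
Qed.

HB.instance Definition _ := isMeasure.Build _ _ _
  (@charlier_mass R theta s N) mass0 mass_ge0 mass_sigma_additive.

End charlier_mass_measure.

(* The last argument of [mnormalize] is only a default for a total mass equal
   to 0 or +oo, which does not happen for [theta, s > 0] (nor for [N = 0]). *)
Definition charlier_law (R : realType) (theta s : R) (N : nat) :
    probability (N.-tuple R) R :=
  mnormalize (@charlier_mass R theta s N) (dirac (nseq_tuple N 0 : N.-tuple R)).

Definition empirical_measure (R : realType) (N : nat) (l : N.-tuple R) :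
    {measure set R -> \bar R} :=
  mscale (N%:R^-1)%:nng (msum (fun i => dirac (l`_i / N%:R)) N).

Definition arccot (R : realType) (x : R) : R := pi / 2 - atan x.

(* For [t < 1] the density is only specified off the endpoints of
   [theta (sqrt t - 1)^2, theta (sqrt t + 1)^2]; there it is set to 0. *)
Definition limit_density (R : realType) (theta t x : R) : R :=
  let a := theta * (Num.sqrt t - 1) ^+ 2 in
  let b := theta * (Num.sqrt t + 1) ^+ 2 in
  if a < x < b then
    (theta * pi)^-1 *
    arccot ((x + theta * (t - 1)) /
      Num.sqrt (4 * theta * t * x - (x + theta * (t - 1)) ^+ 2))
  else if (t < 1) && (0 <= x < a) then theta^-1
  else 0.

(* Random measures [mu N] on [0, +oo), the N-th of which lives on the
   probability space [(T N, P N)], and a limit with density [phi]. *)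
Definition cvg_weakly_in_probability (R : realType) (d : nat -> measure_display)
    (T : forall N, measurableType (d N)) (P : forall N, probability (T N) R)
    (mu : forall N, T N -> {measure set R -> \bar R}) (phi : R -> R) : Prop :=
  forall f : R -> R,
    {within `[0, +oo[%classic, continuous f} ->
    [bounded f x | x in `[0, +oo[%classic] ->
    forall eps : R, 0 < eps ->
      P N [set w | eps <= `|\int[mu N w]_(x in `[0, +oo[) f x -
                    \int[lebesgue_measure]_(x in `[0, +oo[) (f x * phi x)|]
        @[N --> \oo] --> 0%E.

(* Main.v *)
Require Import Defs.
From mathcomp Require Import all_boot all_order all_algebra finmap.
From mathcomp Require Import all_classical all_reals all_analysis measurable_realfun.
From mathcomp Require Import ring lra zify.

Set Implicit Arguments.
Unset Strict Implicit.
Unset Printing Implicit Defensive.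

Import Order.TTheory GRing.Theory Num.Theory.
Import numFieldNormedType.Exports.

Local Open Scope classical_set_scope.
Local Open Scope ring_scope.

(** The proof determines the limit of the Stieltjes transform
    [g = 1/N \sum_i 1 / (y + l_i / N)] of the empirical measure at every [y > 0],
    and then passes to all bounded continuous functions.

    Concentration of [g].  When one part of the partition grows by 1, the Gamma
    factors of the weight change by a rational function of the positions.  The
    result is a detailed balance between a partition and its neighbours
    ([detailed_balance]), whose sum against a test function is an integration by
    parts formula ([wsum_down]).  The coefficients that occur in it are residues of
    [\prod_i (1 -+ theta / (z - l_i))], so partial fractions
    ([partial_fraction_expansion]) turn sums over the parts into products.  With
    [q = N y] one finds that
      [deficit q = theta N - q (\prod_i (1 + theta / (q + l_i)) - 1)] and
      [surplus q = t N theta (1 - \prod_i (1 - theta / (q + 1 + l_i)))]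
    have the same mean.  Both are of order [N], but their difference, the
    [imbalance], rises by at most [O (1 / N)] when a part grows; used as its own
    test function in the integration by parts, it is seen to have a bounded second
    moment ([wsum_imbalance_sq]).  So the imbalance divided by [N] tends to 0 in
    probability.  As the two products are close to [expR (theta g)] and its inverse,
    [e = expR (theta g)] almost solves [y e^2 = (y - theta (t - 1)) e + t theta].
    This equation has one positive root, and a stable one, so [g] concentrates at
    [theta^-1] times its logarithm ([mean_stieltjes_concentration]).

    The Stieltjes transform of the density.  On the part of the support where the
    density is not constant, put [x = theta |1 + sqrt t e^{i psi}|^2] with
    [0 < psi < pi]; the arccot becomes the argument of [sqrt t + e^{i psi}], whose
    derivative is rational in [cos psi].  After an integration by parts, the total
    mass and the integral of [(x + y)^-2] against the density are elementary
    ([density_integral], [integral_stieltjes_sq]).  The latter is minus the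
    derivative in [y] of the Stieltjes transform, and also of the limit of [g]; both
    are at most [1 / y], hence they are equal ([stieltjes_densityE]).

    All test functions.  The functions whose empirical mean concentrates at the
    integral against the density form a vector space, closed under approximation up
    to one of its members of small mean ([concentrates_approx]).  It contains [1 / (x + y)], its
    powers by difference quotients in [y], and therefore the polynomials in
    [1 / (1 + x)].  By the theorem of Weierstrass these approximate
    [f x * (y / (x + y))] uniformly, and the remainder, at most
    [M (1 - y / (x + y))], has a small mean for large [y] because the density has
    bounded support ([self_averaging_continuous]). *)

(** * Partial fractions *)

Section partial_fractions.
Context {F : fieldType}.
Implicit Types (theta z : F).

(** Up to a factor [- theta], the residue at [x k] of
    [\prod_j (1 - theta / (z - x j))]. *)
Definition residue_coef theta n (x : 'I_n -> F) (k : 'I_n) : F :=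
  \prod_(j < n | j != k) ((x k - x j - theta) / (x k - x j)).

Lemma residue_coef_widen theta n (x : 'I_n.+1 -> F) (k : 'I_n) :
  residue_coef theta x (widen_ord (leqnSn n) k) =
  residue_coef theta (x \o widen_ord (leqnSn n)) k *
  (1 - theta / (x (widen_ord (leqnSn n) k) - x ord_max)) \/
  x (widen_ord (leqnSn n) k) = x ord_max.
Proof.
have [->|xk] := eqVneq (x (widen_ord (leqnSn n) k)) (x ord_max); first by right.
left; rewrite /residue_coef big_mkcond big_ord_recr/=.
have -> : ord_max != widen_ord (leqnSn n) k.
  by rewrite -val_eqE/= neq_ltn ltn_ord orbT.
congr (_ * _); first by rewrite [RHS]big_mkcond.
by rewrite mulrBl divff// subr_eq0.
Qed.

Lemma residue_coef_max theta n (x : 'I_n.+1 -> F) :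
  (forall i : 'I_n, x ord_max != x (widen_ord (leqnSn n) i)) ->
  residue_coef theta x ord_max =
  \prod_(j < n) (1 - theta / (x ord_max - x (widen_ord (leqnSn n) j))).
Proof.
move=> xn; rewrite /residue_coef big_mkcond big_ord_recr/= eqxx mulr1.
apply: eq_bigr => j _.
have -> : widen_ord (leqnSn n) j != ord_max.
  by rewrite -val_eqE/= neq_ltn ltn_ord.
by rewrite mulrBl divff// subr_eq0.
Qed.

(** By induction: each old pole is split against that of the new point [y], and the
    new residue is the expansion for the old points evaluated at [y].  The two sums
    of residues are the coefficients of [1 / z] and [1 / z^2] at infinity; carrying
    them through the induction avoids taking a limit in [z]. *)
Lemma partial_fraction_expansion theta n (x : 'I_n -> F) : injective x ->
  [/\ forall z, (forall i, z != x i) ->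
        \prod_(j < n) (1 - theta / (z - x j)) =
        1 - theta * \sum_(k < n) residue_coef theta x k / (z - x k),
      \sum_(k < n) residue_coef theta x k = n%:R &
      \sum_(k < n) x k * residue_coef theta x k =
        \sum_(k < n) x k - theta * 'C(n, 2)%:R].
Proof.
elim: n x => [|n IH] x injx.
  by split=> [z _||]; rewrite ?big_ord0 ?mulr0 ?subr0// bin0n mulr0 subr0.
pose w := widen_ord (leqnSn n).
have injx' : injective (x \o w).
  by move=> i j /injx /(congr1 val) /= ij; apply/val_inj.
have [IH1 IH2 IH3] := IH _ injx'.
have neq_max i : x ord_max != x (w i).
  by apply/eqP => /injx /(congr1 val)/= ni; have := ltn_ord i; rewrite -ni ltnn.
set y := x ord_max in neq_max *.
set c := residue_coef theta (x \o w) in IH1 IH2 IH3.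
have cw k : residue_coef theta x (w k) = c k * (1 - theta / (x (w k) - y)).
  case: (residue_coef_widen theta x k) => // /esym e.
  by have := neq_max k; rewrite /y e eqxx.
have cm : residue_coef theta x ord_max = \prod_(j < n) (1 - theta / (y - x (w j))).
  exact: residue_coef_max.
have By := IH1 _ neq_max; rewrite /= in By.
set s := \sum_(k < n) c k / (y - x (w k)) in By.
have sN : \sum_(k < n) c k / (x (w k) - y) = - s.
  rewrite -sumrN; apply: eq_bigr => k _.
  by rewrite -opprB invrN mulrN.
split=> [z zx||].
- have zxw i : z != x (w i) by [].
  rewrite big_ord_recr/= [X in _ = 1 - theta * X]big_ord_recr/= cm By.
  rewrite [X in X * _ = _](IH1 _ zxw)/=.
  set u := \sum_(k < n) c k / (z - x (w k)).
  have zy0 : z - y != 0 by rewrite subr_eq0; exact: zx.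
  suff -> : \sum_(k < n) residue_coef theta x (w k) / (z - x (w k)) =
       u - theta / (z - y) * (- s + u).
    by rewrite -/y; field.
  transitivity (\sum_(k < n) (c k / (z - x (w k)) - theta / (z - y) *
      (c k / (x (w k) - y) + c k / (z - x (w k))))).
    apply: eq_bigr => k _; rewrite cw.
    have : x (w k) - y != 0 by rewrite subr_eq0 eq_sym; exact: neq_max.
    have : z - x (w k) != 0 by rewrite subr_eq0; exact: zxw.
    move=> h1 h2; field.
    by rewrite h1 h2.
  by rewrite sumrB -mulr_sumr big_split/= sN.
- rewrite big_ord_recr/= cm By.
  transitivity (\sum_(k < n) (c k - theta * (c k / (x (w k) - y))) + (1 - theta * s)).
    by congr (_ + _); apply: eq_bigr => k _; rewrite cw; ring.
  by rewrite sumrB -mulr_sumr sN IH2 -natr1; ring.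
- rewrite big_ord_recr [X in _ = X - _]big_ord_recr/= cm By -/y.
  transitivity (\sum_(k < n) (x (w k) * c k - theta * c k - theta * y * (c k / (x (w k) - y)))
     + y * (1 - theta * s)).
    congr (_ + _); apply: eq_bigr => k _; rewrite cw.
    have : x (w k) - y != 0 by rewrite subr_eq0 eq_sym; exact: neq_max.
    by move=> h; field.
  rewrite !sumrB -!mulr_sumr sN.
  rewrite [X in X - _ - _]IH3 IH2 /= binS bin1 natrD; ring.
Qed.

End partial_fractions.

(** * The Gamma function *)

Section gamma.
Context {R : realType}.
Notation mu := (@lebesgue_measure R).
Implicit Types x z : R.

Definition gamma_integrand z x : R := x `^ (z - 1) * expR (- x).

(** With values in the extended reals, the functional equation makes sense before
    finiteness is known, and serves to prove it. *)
Definition eGamma z : \bar R :=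
  (\int[mu]_(x in `]0%R, +oo[) (gamma_integrand z x)%:E)%E.

Lemma gamma_integrand_ge0 z x : 0 <= gamma_integrand z x.
Proof. by rewrite mulr_ge0 ?powR_ge0 ?expR_ge0. Qed.

Lemma GammaE z : Gamma z = fine (eGamma z).
Proof. by []. Qed.

Lemma is_derive_gamma_primitive z x : 0 < x ->
  is_derive x 1 (fun x => x `^ z * expR (- x))
    (z * gamma_integrand z x - gamma_integrand (z + 1) x).
Proof.
move=> x0; have := is_derive1_powR z x0 => d1.
apply: is_derive_eq; rewrite /gamma_integrand addrK /GRing.scale/=.
by ring.
Qed.

Lemma continuous_gamma_integrand z x : 0 < x ->
  {for x, continuous (gamma_integrand z)}.
Proof.
move=> x0; apply: differentiable_continuous; apply/derivable1_diffP.
have := is_derive1_powR (z - 1) x0 => d1.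
by rewrite /gamma_integrand; apply: ex_derive.
Qed.

Lemma measurable_gamma_integrand z : measurable_fun setT (gamma_integrand z).
Proof.
apply: measurable_funM; first exact: measurable_powR.
by apply: measurableT_comp => //; exact: measurable_funN.
Qed.

(** Integration by parts away from 0 and infinity, written without subtractions. *)
Lemma gamma_segment z (a b : R) : 0 < a -> a < b ->
  (\int[mu]_(x in `[a, b]) (gamma_integrand (z + 1) x)%:E +
     (b `^ z * expR (- b))%:E =
   z%:E * \int[mu]_(x in `[a, b]) (gamma_integrand z x)%:E +
     (a `^ z * expR (- a))%:E)%E.
Proof.
move=> a0 ab.
have cg w : {within `[a, b], continuous (gamma_integrand w)}.
  apply: continuous_in_subspaceT => x; rewrite inE/= in_itv/= => /andP[ax _].
  by apply: continuous_gamma_integrand; exact: lt_le_trans ax.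
have ig w : mu.-integrable `[a, b] (EFin \o gamma_integrand w).
  by apply: continuous_compact_integrable; [exact: segment_compact|exact: cg].
pose P x : R := x `^ z * expR (- x).
have dP x : 0 < x -> {for x, continuous P}.
  move=> x0; apply: differentiable_continuous; apply/derivable1_diffP.
  by have [] := is_derive_gamma_primitive z x0.
have := @continuous_FTC2 R
   (fun x => z * gamma_integrand z x - gamma_integrand (z + 1) x) P a b ab.
move=> /(_ _ _ _)/wrap[].
- apply: continuous_in_subspaceT => x; rewrite inE/= in_itv/= => /andP[ax _].
  have x0 : 0 < x by exact: lt_le_trans ax.
  by apply: cvgB; [apply: cvgMl_tmp|]; exact: continuous_gamma_integrand.
- split.
  + move=> x; rewrite in_itv/= => /andP[ax _].
    by have [] := is_derive_gamma_primitive z (lt_trans a0 ax).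
  + by apply: cvg_at_right_filter; exact: dP.
  + by apply: cvg_at_left_filter; apply: dP; exact: lt_trans ab.
- move=> x; rewrite in_itv/= => /andP[ax _]; rewrite derive1E.
  by have [_ ->] := is_derive_gamma_primitive z (lt_trans a0 ax).
under eq_integral do rewrite EFinB.
rewrite integralB; [|by []| |exact: ig]; last first.
  under [X in _.-integrable _ X]eq_fun do rewrite EFinM.
  by apply: integrableZl => //; exact: ig.
under eq_integral do rewrite EFinM.
rewrite integralZl//; last exact: ig.
have f1 : (\int[mu]_(x in `[a, b]) (gamma_integrand z x)%:E)%E \is a fin_num.
  by apply: integrable_fin_num => //; exact: ig.
have f2 : (\int[mu]_(x in `[a, b]) (gamma_integrand (z+1) x)%:E)%E \is a fin_num.
  by apply: integrable_fin_num => //; exact: ig.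
rewrite -(fineK f1) -(fineK f2) -!EFinM -!EFinB -!EFinD => -[e]; congr EFin.
by rewrite -/(P b) -/(P a); lra.
Qed.

Lemma gamma_segments_cvg z :
  (\int[mu]_(x in `[(n.+2%:R^-1)%R, n.+2%:R%R]) (gamma_integrand z x)%:E)%E
    @[n --> \oo] --> eGamma z.
Proof.
have -> : eGamma z = (\int[mu]_(x in \bigcup_n [set` `[n.+2%:R^-1%R, n.+2%:R%R]])
    (gamma_integrand z x)%:E)%E.
  rewrite /eGamma; congr (integral _ _ _); apply/seteqP; split => x /=.
    rewrite in_itv/= andbT => x0.
    have [n nx] := ubnP (Num.truncn (Num.max x x^-1)).
    exists n => //=; rewrite in_itv/=.
    have : Num.max x x^-1 <= n.+2%:R.
      apply/ltW/(lt_le_trans (truncnS_gt _)).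
      by rewrite ler_nat (leq_trans nx)// 2?leqW.
    rewrite ge_max => /andP[-> h]; rewrite andbT.
    by rewrite invf_ple// posrE.
  move=> [n _] /=; rewrite !in_itv/= andbT => /andP[+ _].
  by apply: lt_le_trans; rewrite invr_gt0.
pose F (n : nat) : set R := `[n.+2%:R^-1%R, n.+2%:R%R]%classic.
have := @ge0_nondecreasing_set_cvg_integral _ (measurableTypeR R) R
  F (fun x => (gamma_integrand z x)%:E) mu.
apply.
- move=> m n mn; apply/subsetPset => x; rewrite /F /= !in_itv/= => /andP[mx xm].
  rewrite (le_trans _ mx)/=; last by rewrite lef_pV2 ?posrE// ler_nat !ltnS.
  by rewrite (le_trans xm)// ler_nat !ltnS.
- by move=> n; exact: measurable_itv.
- move=> n; apply: measurable_funTS; apply/measurable_EFinP.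
  exact: measurable_gamma_integrand.
- by move=> n x _; rewrite lee_fin gamma_integrand_ge0.
Qed.

Lemma powR_le_expR z : exists C : R, forall x, 1 <= x -> x `^ z <= C * expR x.
Proof.
exists (Num.truncn z).+1`!%:R => x x1.
have x0 : 0 < x by lra.
apply: (@le_trans _ _ (x ^+ (Num.truncn z).+1)).
  by rewrite -powR_mulrn ?(ltW x0)//; apply: (ler_powR x1); apply/ltW/truncnS_gt.
have := expR_ge1Dxn (Num.truncn z) (ltW x0).
move=> h; rewrite mulrC -ler_pdivrMr ?ltr0n ?fact_gt0//.
by apply: le_trans h; rewrite lerDr.
Qed.

Lemma cvg_inv_succ_succ : (n.+2%:R^-1 : R) @[n --> \oo] --> (0 : R).
Proof. by rewrite (cvg_shiftS (@harmonic R)); exact: cvg_harmonic. Qed.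

(** The boundary terms of [gamma_segment] on [1 / (n + 2), n + 2] vanish in the limit. *)
Lemma eGammaD1 z : 0 < z -> eGamma (z + 1) = (z%:E * eGamma z)%E.
Proof.
move=> z0.
pose h x : R := x `^ z * expR (- x).
have hy : (h n.+2%:R)%:E @[n --> \oo] --> 0%E.
  apply: cvg_EFin; first by apply: nearW => n.
  have [C HC] := powR_le_expR (z + 1).
  have hC (x : R) : 1 <= x -> h x <= C * x^-1.
    move=> x1; have x0 : 0 < x by lra.
    rewrite /h ler_pdivlMr// mulrAC expRN ler_pdivrMr ?expR_gt0//.
    rewrite mulrC -{1}(powRr1 (ltW x0)) -powRD; last by rewrite (gt_eqF x0) implybT.
    by rewrite addrC HC.
  have C0 : C * 0 = 0 by rewrite mulr0.
  apply: (@squeeze_cvgr _ _ _ _ (cst 0) (fun n => C * n.+2%:R^-1)).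
  - apply: nearW => n /=; rewrite mulr_ge0 ?powR_ge0 ?expR_ge0//=.
    by rewrite hC// ler1n.
  - exact: cvg_cst.
  - rewrite -[X in _ --> X]C0; apply: cvgMl_tmp.
    exact: cvg_inv_succ_succ.
have h0 : (h n.+2%:R^-1)%:E @[n --> \oo] --> 0%E.
  apply: cvg_EFin; first by apply: nearW => n.
  apply: (@squeeze_cvgr _ _ _ _ (cst 0) (fun n => (n.+2%:R^-1) `^ z)).
  - apply: nearW => n /=; rewrite mulr_ge0 ?powR_ge0 ?expR_ge0//=.
    by rewrite ler_piMr ?powR_ge0// -expR0 ler_expR oppr_le0 invr_ge0.
  - exact: cvg_cst.
  - have /cvg_at_rightP := powR_cvg0 z0.
    move=> /(_ (fun n => n.+2%:R^-1)); apply; split => [n|]; first by rewrite invr_gt0.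
    exact: cvg_inv_succ_succ.
have seg (n : nat) := @gamma_segment z n.+2%:R^-1 n.+2%:R
  ltac:(by rewrite invr_gt0)
  ltac:(by rewrite invf_plt ?posrE// (@lt_trans _ _ 1)// ?invf_lt1// ltr1n).
have l1 : ((\int[mu]_(x in `[(n.+2%:R^-1)%R, n.+2%:R%R]) (gamma_integrand (z + 1) x)%:E) +
    (h n.+2%:R)%:E)%E @[n --> \oo] --> (eGamma (z + 1) + 0)%E.
  by apply: cvgeD => //; [rewrite fin_num_adde_defl|exact: gamma_segments_cvg].
have l2 : (z%:E * (\int[mu]_(x in `[(n.+2%:R^-1)%R, n.+2%:R%R]) (gamma_integrand z x)%:E) +
    (h n.+2%:R^-1)%:E)%E @[n --> \oo] --> (z%:E * eGamma z + 0)%E.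
  apply: cvgeD => //; first by rewrite fin_num_adde_defl.
  by apply: cvgeZl => //; exact: gamma_segments_cvg.
rewrite adde0 in l1; rewrite adde0 in l2.
apply: (cvg_unique _ _ l2) => //; apply: cvg_trans l1.
by apply: near_eq_cvg; apply: nearW => n; exact: seg.
Qed.

Lemma eGamma1_lty : (eGamma 1 < +oo)%E.
Proof.
apply: (@le_lt_trans _ _ 1%E); last exact: ltry.
rewrite -(@integral_exponential_pdf R 1)// /eGamma.
under eq_integral => x.
  rewrite inE/= in_itv/= andbT => x0.
  rewrite (_ : gamma_integrand 1 x = exponential_pdf 1 x); last first.
    rewrite exponential_pdfE ?ltW// /gamma_integrand subrr powRr0.
    by rewrite mulN1r.
  over.
apply: ge0_subset_integral => //.
  by apply/measurable_EFinP; exact: measurable_exponential_pdf.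
by move=> x _; rewrite lee_fin exponential_pdf_ge0.
Qed.

Lemma eGammaS_lty n : (eGamma n.+1%:R < +oo)%E.
Proof.
elim: n => [|n IH]; first exact: eGamma1_lty.
by rewrite -natr1 eGammaD1// lte_mul_pinfty// lee_fin.
Qed.

(** For [z >= 1] the integrand is at most the sum of those at 1 and at an integer
    above [z], where the functional equation gives finiteness; smaller [z] are
    reached through [z + 1]. *)
Lemma eGamma_lty z : 0 < z -> (eGamma z < +oo)%E.
Proof.
move=> z0.
suff H w : 1 <= w -> (eGamma w < +oo)%E.
  have := H (z + 1); rewrite eGammaD1// lerDr (ltW z0) => /(_ isT).
  move=> h; rewrite ltey; apply/eqP => e; move: h.
  by rewrite e gt0_muley ?lte_fin.
move=> w1; pose n := Num.truncn w.
have h : (eGamma w <= eGamma 1 + eGamma n.+1%:R)%E.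
  rewrite /eGamma -ge0_integralD//; last 4 first.
  - by move=> x _; rewrite lee_fin gamma_integrand_ge0.
  - by apply: measurable_funTS; apply/measurable_EFinP; exact: measurable_gamma_integrand.
  - by move=> x _; rewrite lee_fin gamma_integrand_ge0.
  - by apply: measurable_funTS; apply/measurable_EFinP; exact: measurable_gamma_integrand.
  apply: ge0_le_integral => //.
  - by move=> x _; rewrite lee_fin gamma_integrand_ge0.
  - by apply: measurable_funTS; apply/measurable_EFinP; exact: measurable_gamma_integrand.
  - by apply: emeasurable_funD; apply: measurable_funTS;
      apply/measurable_EFinP; exact: measurable_gamma_integrand.
  move=> x /=; rewrite in_itv/= andbT => x0.
  rewrite -EFinD lee_fin /gamma_integrand -mulrDl ler_wpM2r ?expR_ge0//.
  rewrite subrr powRr0; have [x1|x1] := leP x 1.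
    rewrite (@le_trans _ _ 1) ?lerDl ?powR_ge0//.
    rewrite -(powRr0 x); apply: ger_powR; first by rewrite x0 x1.
    by rewrite powRr0 subr_ge0.
  rewrite -[leLHS]add0r lerD ?ler01//; apply: (ler_powR (ltW x1)).
  by rewrite lerB// ltW// truncnS_gt.
apply: (le_lt_trans h); apply: lte_add_pinfty; first exact: eGamma1_lty.
exact: eGammaS_lty.
Qed.

Lemma eGamma_gt0 z : 0 < z -> (0 < eGamma z)%E.
Proof.
move=> z0; apply: (@lt_le_trans _ _ (2^-1 * expR (- 2))%:E).
  by rewrite lte_fin mulr_gt0 ?expR_gt0.
have mg A : measurable_fun A (fun x => (gamma_integrand z x)%:E).
  by apply: measurable_funTS; apply/measurable_EFinP; exact: measurable_gamma_integrand.
apply: (@le_trans _ _ (\int[mu]_(x in `[1%R, 2%R]) (gamma_integrand z x)%:E)%E); last first.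
  apply: ge0_subset_integral => //.
  - exact: mg.
  - by move=> x _; rewrite lee_fin gamma_integrand_ge0.
  - by move=> x /=; rewrite !in_itv/= andbT => /andP[+ _]; apply: lt_le_trans.
have <- : (\int[mu]_(x in `[1%R, 2%R]) (2^-1 * expR (- 2))%:E = (2^-1 * expR (- 2))%:E)%E.
  rewrite integral_cst//= lebesgue_measure_itv/= lte_fin ltr1n -EFinB -EFinM.
  by congr EFin; rewrite (_ : 2 - 1 = 1) ?mulr1//; lra.
apply: ge0_le_integral => //.
- exact: mg.
move=> x /=; rewrite in_itv/= => /andP[x1 x2]; rewrite lee_fin.
apply: ler_pM; rewrite ?expR_ge0// ?ler_expR ?lerN2//.
apply: (@le_trans _ _ (x `^ (-1))); last by apply: (ler_powR x1); lra.
by rewrite powR_inv1 ?lef_pV2 ?posrE//; lra.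
Qed.

Lemma Gamma_gt0 z : 0 < z -> 0 < Gamma z.
Proof. by move=> z0; rewrite GammaE fine_gt0// eGamma_gt0// eGamma_lty. Qed.

Lemma GammaD1 z : 0 < z -> Gamma (z + 1) = z * Gamma z.
Proof.
move=> z0; rewrite !GammaE eGammaD1// fineM// fin_numElt eGamma_lty// andbT.
exact: lt_trans (eGamma_gt0 z0).
Qed.

End gamma.

(** * Weights of neighbouring partitions *)

(** The pairs containing [k], whichever place [k] occupies in them, are collected in
    the second factor: only these change when the part [k] grows. *)
Lemma prod_pairs_isolate (R : comPzSemiRingType) N (k : 'I_N) (G : 'I_N -> 'I_N -> R) :
  \prod_(i < N) \prod_(j < N | (i < j)%N) G i j =
  (\prod_(i < N | i != k) \prod_(j < N | (i < j)%N && (j != k)) G i j) *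
  \prod_(j < N | j != k) (if (k < j)%N then G k j else G j k).
Proof.
rewrite (bigD1 k)//=.
transitivity ((\prod_(j < N | (k < j)%N) G k j) *
  \prod_(i < N | i != k) ((if (i < k)%N then G i k else 1) *
     \prod_(j < N | (i < j)%N && (j != k)) G i j)).
  congr (_ * _); apply: eq_bigr => i ik.
  case: ifPn => [ltik|geik].
    by rewrite (bigD1 k).
  rewrite mul1r; apply: eq_bigl => j.
  by have [->|] := eqVneq j k; rewrite ?andbT// (negbTE geik).
rewrite big_split/= mulrA mulrC; congr (_ * _).
rewrite big_mkcond [X in _ * X]big_mkcond -big_split/= [RHS]big_mkcond/=.
apply: eq_bigr => j _.
have [->|jk] := eqVneq j k; first by rewrite ltnn mulr1.
case: ltngtP => [_|_|/val_inj/eqP] /=; rewrite ?mul1r ?mulr1//.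
by rewrite eq_sym (negbTE jk).
Qed.

#[local] Opaque Gamma.

Section states.
Context {R : realType} (theta : R) (N : nat).
Hypothesis theta_gt0 : 0 < theta.
Implicit Types (l : {ffun 'I_N -> nat}) (i j k : 'I_N).

(** Partitions are finite functions subject to this condition rather than a subtype,
    so that [up k] is a total injective map. *)
Definition decreasing l := [forall i : 'I_N, forall j : 'I_N, (i <= j)%N ==> (l j <= l i)%N].

Lemma decreasingP l :
  reflect (forall i j, (i <= j)%N -> (l j <= l i)%N) (decreasing l).
Proof.
apply: (iffP forallP) => [h i j ij|h i]; last by apply/forallP => j; apply/implyP/h.
by have /forallP/(_ j)/implyP/(_ ij) := h i.
Qed.

Definition position l i : R := (l i)%:R + (N - i.+1)%:R * theta.

Definition up k l : {ffun 'I_N -> nat} := [ffun i => l i + (i == k)]%N.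

Lemma position_up k l i : position (up k l) i = position l i + (i == k)%:R.
Proof. by rewrite /position ffunE natrD addrAC. Qed.

Lemma position_ge0 l i : 0 <= position l i.
Proof. by rewrite addr_ge0// mulr_ge0// ltW. Qed.

Lemma positionB l i j : (i < j)%N ->
  position l i - position l j = (l i)%:R - (l j)%:R + (j - i)%:R * theta.
Proof.
move=> ij; have jN := ltn_ord j.
rewrite /position (_ : (N - i.+1 = (N - j.+1) + (j - i))%N); last by lia.
by rewrite natrD; ring.
Qed.

(** Two particles are at distance at least [theta], hence all arguments of [Gamma]
    in the weight are positive. *)
Lemma position_gap l i j : decreasing l -> (i < j)%N ->
  theta <= position l i - position l j.
Proof.
move=> /decreasingP dl ij; rewrite positionB//.
have : (l j)%:R <= (l i)%:R :> R by rewrite ler_nat dl// ltnW.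
have : theta <= (j - i)%:R * theta by rewrite ler_peMl ?(ltW theta_gt0)// ler1n subn_gt0.
by lra.
Qed.

Lemma position_inj l : decreasing l -> injective (position l).
Proof.
move=> dl i j e; apply: val_inj; apply/eqP; rewrite eqn_leq leqNgt [X in _ && X]leqNgt.
by apply/andP; split; apply/negP => /(position_gap dl); rewrite e subrr leNgt theta_gt0.
Qed.

Definition pair_weight (u : R) :=
  (Gamma (u + theta) * Gamma (u + 1)) / (Gamma u * Gamma (u + 1 - theta)).

(** The four Gamma factors change by rational functions of [u]; written as an
    identity between products, it matches the factors of [up_coef] and [down_coef]. *)
Lemma pair_weightS u : theta <= u ->
  pair_weight (u + 1) * ((u + 1 - theta) / (u + 1)) =
  pair_weight u * ((u + theta) / u).
Proof.
move=> tu; have th := theta_gt0; rewrite /pair_weight.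
have -> : u + 1 + theta = u + theta + 1 by ring.
have -> : u + 1 + 1 - theta = (u + 1 - theta) + 1 by ring.
rewrite !GammaD1; [|lra..].
have G1 : 0 < Gamma u by apply: Gamma_gt0; lra.
have G2 : 0 < Gamma (u + 1 - theta) by apply: Gamma_gt0; lra.
move: (Gamma u) (Gamma (u + 1 - theta)) G1 G2 => g1 g2 G1 G2.
by field; rewrite !gt_eqF//=; lra.
Qed.

Definition state_tuple l : N.-tuple R := [tuple position l i | i < N].

Definition pair_product (p : 'I_N -> R) :=
  \prod_(i < N) \prod_(j < N | (i < j)%N) pair_weight (p i - p j).

Definition site_product s (p : 'I_N -> R) :=
  \prod_(i < N) ((s * theta) `^ p i / Gamma (p i + 1)).

Lemma charlier_weight_state s l : charlier_weight theta s (state_tuple l) =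
  pair_product (position l) * site_product s (position l).
Proof.
apply: (congr2 *%R).
  by apply: eq_bigr => i _; apply: eq_bigr => j _; rewrite !tnth_mktuple.
by apply: eq_bigr => i _; rewrite !tnth_mktuple.
Qed.

(** Extended by 0, the weight satisfies [detailed_balance] at all finite functions:
    where [up k] leaves or enters the set of partitions, the coefficient on the
    other side vanishes. *)
Definition state_weight s l : R :=
  if decreasing l then charlier_weight theta s (state_tuple l) else 0.

Lemma state_weight_ge0 s l : 0 <= state_weight s l.
Proof. by rewrite /state_weight; case: ifP => // _; exact: charlier_weight_ge0. Qed.

Lemma state_weightE s l : decreasing l ->
  state_weight s l = charlier_weight theta s (state_tuple l).
Proof. by rewrite /state_weight => ->. Qed.

Lemma state_weight_eq0 s l : ~~ decreasing l -> state_weight s l = 0.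
Proof. by rewrite /state_weight => /negbTE ->. Qed.

Definition up_coef l k := residue_coef (- theta) (position l) k.
Definition down_coef l k := residue_coef theta (position l) k.

(** The part [k] cannot grow only if it equals the previous part; the particles are
    then at distance exactly [theta], which is a zero of the coefficient. *)
Lemma up_coef_eq0 l k : decreasing l -> ~~ decreasing (up k l) -> up_coef l k = 0.
Proof.
move=> /decreasingP dl /decreasingP ndl.
have [j [jk ljk]] : exists j : 'I_N, k = j.+1 :> nat /\ l j = l k.
  have : exists i, (i < k)%N /\ l i = l k.
    apply: contrapT => h; apply: ndl => i j ij; rewrite !ffunE.
    have lij := dl _ _ ij.
    have [jk|jk] := eqVneq j k; last by lia.
    have [ik|ik] := eqVneq i k; first by rewrite /=; lia.
    rewrite /= addn1 addn0 ltn_neqAle lij andbT; apply/negP => /eqP e.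
    apply: h; exists i; split; last by rewrite -e jk.
    by move: ij; rewrite jk ltn_neqAle => ->; rewrite andbT.
  move=> [i [ik e]].
  have kN : (k.-1 < N)%N by have := ltn_ord k; lia.
  exists (Ordinal kN); split; first by rewrite /=; lia.
  apply/eqP; rewrite eqn_leq; apply/andP; split; last by apply: dl => /=; lia.
  by rewrite -e; apply: dl => /=; lia.
rewrite /up_coef /residue_coef (bigD1 j)/=; last by rewrite -val_eqE/= jk ltn_eqF.
have -> : position l k - position l j = - theta.
  by rewrite -opprB positionB ?jk// ljk subrr add0r subSnn mul1r.
by rewrite subrr !mul0r.
Qed.

Lemma down_coef_eq0 l j k : decreasing l -> k = j.+1 :> nat -> l k = l j ->
  down_coef l j = 0.
Proof.
move=> dl jk ljk.
rewrite /down_coef /residue_coef (bigD1 k)/=; last by rewrite -val_eqE/= jk gtn_eqF.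
have -> : position l j - position l k = theta.
  by rewrite positionB ?jk// ljk subrr add0r subSnn mul1r.
by rewrite subrr !mul0r.
Qed.

Lemma down_coef_up_eq0 l k : ~~ decreasing l -> decreasing (up k l) ->
  down_coef (up k l) k = 0.
Proof.
move=> /decreasingP ndl du; have /decreasingP dl := du.
suff [j [jk ljk]] : exists j : 'I_N, j = k.+1 :> nat /\ l j = (l k).+1.
  apply: (down_coef_eq0 du jk); rewrite !ffunE eqxx ljk.
  by rewrite -val_eqE/= jk gtn_eqF// addn0 addn1.
have [j [jk ljk]] : exists j, (k < j)%N /\ l j = (l k).+1.
  apply: contrapT => h; apply: ndl => i j ij.
  have := dl _ _ ij; rewrite !ffunE => lij.
  have [ik|ik] := eqVneq i k; last by move: lij; rewrite (negbTE ik); lia.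
  have [jk|jk] := eqVneq j k; first by rewrite ik jk.
  move: lij; rewrite ik eqxx (negbTE jk) addn0 addn1 leq_eqVlt => /orP[/eqP e|//].
  exfalso; apply: h; exists j; split=> //.
  by move: ij; rewrite ik leq_eqVlt => /orP[/eqP/val_inj e'|//]; rewrite e' eqxx in jk.
have kN : (k.+1 < N)%N by have := ltn_ord j; lia.
exists (Ordinal kN); split => //.
have := dl (Ordinal kN) j jk; have := dl k (Ordinal kN) (leqnSn k).
rewrite !ffunE eqxx -!val_eqE/=.
have -> : (k.+1 == k) = false by lia.
have -> : (j == k :> nat) = false by lia.
by rewrite !addn0 ljk; lia.
Qed.

Lemma decreasing_down_coef_eq0 l k : decreasing l -> l k = 0%N ->
  position l k * down_coef l k = 0.
Proof.
move=> dl lk0; have [kN|kN] := ltnP k.+1 N.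
  rewrite (@down_coef_eq0 _ k (Ordinal kN))// ?mulr0// lk0.
  apply/eqP; rewrite -leqn0 -lk0; move/decreasingP : dl; apply => /=.
  exact: leqnSn.
rewrite /position lk0 (_ : (N - k.+1 = 0)%N); last by apply/eqP; rewrite subn_eq0.
by rewrite mul0r addr0 mul0r.
Qed.

Lemma up_coef_ge0 l k : decreasing l -> 0 <= up_coef l k.
Proof.
move=> dl; rewrite /up_coef /residue_coef prodr_ge0// => j jk.
have [lt_jk|lt_kj|/val_inj e] := ltngtP j k; last by rewrite e eqxx in jk.
- have := position_gap dl lt_jk; have th := theta_gt0 => h.
  by rewrite -mulrNN -invrN divr_ge0//; lra.
- have := position_gap dl lt_kj; have th := theta_gt0 => h.
  by rewrite divr_ge0//; lra.
Qed.

Lemma down_coef_ge0 l k : decreasing l -> 0 <= down_coef l k.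
Proof.
move=> dl; rewrite /down_coef /residue_coef prodr_ge0// => j jk.
have [lt_jk|lt_kj|/val_inj e] := ltngtP j k; last by rewrite e eqxx in jk.
- have := position_gap dl lt_jk; have th := theta_gt0 => h.
  by rewrite -mulrNN -invrN divr_ge0//; lra.
- have := position_gap dl lt_kj; have th := theta_gt0 => h.
  by rewrite divr_ge0//; lra.
Qed.

Lemma pair_weight_up l j k : decreasing l -> decreasing (up k l) -> j != k ->
  (if (k < j)%N then pair_weight (position (up k l) k - position (up k l) j)
   else pair_weight (position (up k l) j - position (up k l) k)) *
  ((position (up k l) k - position (up k l) j - theta) /
     (position (up k l) k - position (up k l) j)) =
  (if (k < j)%N then pair_weight (position l k - position l j)
   else pair_weight (position l j - position l k)) *
  ((position l k - position l j - - theta) / (position l k - position l j)).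
Proof.
move=> dl du jk; rewrite !position_up eqxx (negbTE jk) addr0.
have [lt_kj|lt_jk|/val_inj e] := ltngtP k j; last by rewrite e eqxx in jk.
- have h := position_gap dl lt_kj.
  have -> : position l k + 1 - position l j = (position l k - position l j) + 1 by ring.
  by rewrite opprK; exact: pair_weightS.
- have h := position_gap du lt_jk.
  rewrite !position_up eqxx (negbTE jk) addr0 in h.
  set u := position l j - (position l k + 1) in h *.
  have -> : position l j - position l k = u + 1 by rewrite /u; ring.
  have -> : position l k + 1 - position l j = - u by rewrite /u; ring.
  have -> : position l k - position l j = - (u + 1) by rewrite /u; ring.
  have -> : (- u - theta) / - u = (u + theta) / u.
    by rewrite -opprD -mulrNN -invrN !opprK.
  have -> : (- (u + 1) - - theta) / - (u + 1) = (u + 1 - theta) / (u + 1).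
    by rewrite -opprD -mulrNN -invrN !opprK.
  exact/esym/pair_weightS.
Qed.

Lemma pair_product_isolate (p : 'I_N -> R) k : pair_product p =
  (\prod_(i < N | i != k) \prod_(j < N | (i < j)%N && (j != k)) pair_weight (p i - p j)) *
  \prod_(j < N | j != k) (if (k < j)%N then pair_weight (p k - p j) else pair_weight (p j - p k)).
Proof. exact: (prod_pairs_isolate k (fun i j => pair_weight (p i - p j))). Qed.

#[local] Opaque pair_weight pair_product.

Lemma pair_product_up l k : decreasing l -> decreasing (up k l) ->
  pair_product (position (up k l)) * down_coef (up k l) k =
  pair_product (position l) * up_coef l k.
Proof.
move=> dl du; have E j : j != k -> _ := pair_weight_up dl du.
have Eq j : j != k -> position (up k l) j = position l j.
  by move=> jk; rewrite position_up (negbTE jk) addr0.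
rewrite /down_coef /up_coef; move: (position (up k l)) (position l) E Eq => q p E Eq.
rewrite (pair_product_isolate q k) (pair_product_isolate p k).
apply: (etrans (esym (mulrA _ _ _))); apply: (etrans _ (mulrA _ _ _)).
apply: (congr2 *%R).
  apply: eq_bigr => i ik; apply: eq_bigr => j /andP[_ jk].
  by rewrite !Eq.
rewrite -[LHS]big_split -[RHS]big_split/=.
by apply: eq_bigr => j jk; exact: E.
Qed.

Lemma site_product_shift s (p q : 'I_N -> R) k : 0 < s -> 0 <= p k ->
  q k = p k + 1 -> (forall i, i != k -> q i = p i) ->
  site_product s q * q k = s * theta * site_product s p.
Proof.
move=> s0 p0 qk qi; have sth : 0 < s * theta by rewrite mulr_gt0.
rewrite /site_product (bigD1 k)//= [in RHS](bigD1 k)//= qk.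
rewrite (eq_bigr (fun i => (s * theta) `^ p i / Gamma (p i + 1))); last first.
  by move=> i ik; rewrite qi.
rewrite (GammaD1 (z := p k + 1)); last by lra.
rewrite powRD; last by rewrite (gt_eqF sth) implybT.
rewrite powRr1 ?(ltW sth)//.
have : 0 < Gamma (p k + 1) by apply: Gamma_gt0; lra.
move: (Gamma _) ((s * theta) `^ _) (\prod_(i < N | i != k) _) => g a b g0.
by field; rewrite !gt_eqF//; lra.
Qed.

Lemma site_product_up s l k : 0 < s ->
  site_product s (position (up k l)) * position (up k l) k =
  s * theta * site_product s (position l).
Proof.
move=> s0; apply: site_product_shift => //.
- exact: position_ge0.
- by rewrite position_up eqxx.
- by move=> i ik; rewrite position_up (negbTE ik) addr0.
Qed.

#[local] Opaque site_product.

(** The interaction factors account for the coefficients ([pair_product_up]) and the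
    factor [(s theta)^l / Gamma (l + 1)] for the position and for [s * theta]
    ([site_product_up]). *)
Lemma detailed_balance s l k : 0 < s ->
  state_weight s (up k l) *
    (position (up k l) k * down_coef (up k l) k) =
  s * theta * (state_weight s l * up_coef l k).
Proof.
move=> s0; rewrite /state_weight.
have [dl|ndl] := boolP (decreasing l); have [du|ndu] := boolP (decreasing (up k l)).
- rewrite !charlier_weight_state.
  have mix (a b c d : R) : a * b * (c * d) = (a * d) * (b * c) by ring.
  apply: (etrans (mix _ _ _ _)).
  apply: (etrans (congr2 *%R (pair_product_up dl du) (site_product_up l k s0))).
  by move: (pair_product _) (site_product _ _) (up_coef _ _) => a b c; ring.
- by rewrite up_coef_eq0// !mulr0 mul0r.
- by rewrite down_coef_up_eq0// !mulr0 mul0r mulr0.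
- by rewrite !mul0r mulr0.
Qed.

End states.

(** * Sums over partitions and integration by parts *)

Lemma ge0_esumZl (R : realType) (T : choiceType) (c : R) (a : T -> R) :
  0 <= c -> (forall i, 0 <= a i) ->
  (\esum_(i in [set: T]) (c * a i)%:E = c%:E * \esum_(i in [set: T]) (a i)%:E)%E.
Proof.
move=> c0 a0; rewrite /esum -ereal_supZl//; last first.
  by apply/set0P; exists 0%E; exists set0; [exact: fsets_set0|rewrite fsbig_set0].
congr ereal_sup; rewrite image_comp; apply: eq_imagel => X _ /=.
by rewrite ge0_mule_fsumr.
Qed.

#[local] Opaque Gamma state_weight.

Section weighted_sums.
Context {R : realType} (theta s : R) (N : nat).
Hypotheses (theta_gt0 : 0 < theta) (s_gt0 : 0 < s).
Local Notation state := {ffun 'I_N -> nat}.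
Implicit Types (l : state) (i j k : 'I_N) (H K : state -> R).
Local Notation weight := (@state_weight R theta N s).
Local Notation position := (@position R theta N).
Local Notation up_coef := (@up_coef R theta N).
Local Notation down_coef := (@down_coef R theta N).

(** Unnormalized expectations over the partitions, where the weight is carried. *)
Definition wsum H : \bar R := \esum_(l in [set: state]) (weight l * H l)%:E.

Lemma weighted_ge0 l (x : R) : (decreasing l -> 0 <= x) -> 0 <= weight l * x.
Proof.
have [dl /(_ isT) x0|ndl _] := boolP (decreasing l).
  by rewrite mulr_ge0// state_weight_ge0.
by rewrite state_weight_eq0// mul0r.
Qed.

Lemma wsum_ge0 H : (forall l, decreasing l -> 0 <= H l) -> (0 <= wsum H)%E.
Proof. by move=> H0; apply: esum_ge0 => l _; rewrite lee_fin weighted_ge0//; exact: H0. Qed.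

Lemma le_wsum H K : (forall l, decreasing l -> H l <= K l) -> (wsum H <= wsum K)%E.
Proof.
move=> HK; apply: le_esum => l _; rewrite lee_fin -subr_ge0 -mulrBr weighted_ge0//.
by move=> /HK; rewrite subr_ge0.
Qed.

Lemma eq_wsum H K : (forall l, decreasing l -> H l = K l) -> wsum H = wsum K.
Proof. by move=> HK; apply/le_anti/andP; split; apply: le_wsum => l dl; rewrite HK. Qed.

Lemma wsumD H K : (forall l, decreasing l -> 0 <= H l) ->
  (forall l, decreasing l -> 0 <= K l) ->
  wsum (fun l => H l + K l) = (wsum H + wsum K)%E.
Proof.
move=> H0 K0; rewrite /wsum -esumD.
- by apply: eq_esum => l _; rewrite mulrDr EFinD.
- by move=> l _; rewrite lee_fin weighted_ge0//; exact: H0.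
- by move=> l _; rewrite lee_fin weighted_ge0//; exact: K0.
Qed.

Lemma wsumZ c H : 0 <= c -> (forall l, decreasing l -> 0 <= H l) ->
  wsum (fun l => c * H l) = (c%:E * wsum H)%E.
Proof.
move=> c0 H0; rewrite /wsum -ge0_esumZl//.
- by apply: eq_esum => l _; rewrite mulrCA.
- by move=> l; rewrite weighted_ge0//; exact: H0.
Qed.

Lemma wsum_sum (H : 'I_N -> state -> R) :
  (forall k l, decreasing l -> 0 <= H k l) ->
  wsum (fun l => \sum_(k < N) H k l) = (\sum_(k < N) wsum (H k))%E.
Proof.
move=> H0; rewrite /wsum -esum_sum.
  by apply: eq_esum => l _; rewrite mulr_sumr sumEFin.
by move=> l k _ _; rewrite lee_fin weighted_ge0//; exact: H0.
Qed.

Lemma up_inj k : injective (@up N k).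
Proof.
move=> l l' /ffunP e; apply/ffunP => i; have := e i; rewrite !ffunE.
exact: addIn.
Qed.

(** Integration by parts: [detailed_balance] summed over the reindexing [up k], whose
    image misses only states with [l k = 0], where the left hand side vanishes. *)
Lemma wsum_down k H : (forall l, 0 <= H l) ->
  wsum (fun l => position l k * down_coef l k * H l) =
  wsum (fun l => s * theta * up_coef l k * H (up k l)).
Proof.
move=> H0; have pos0 l : decreasing l -> 0 <= position l k * down_coef l k * H l.
  move=> dl; rewrite mulr_ge0// mulr_ge0//; first exact: position_ge0.
  exact: down_coef_ge0.
rewrite {1}/wsum (esumID [set l : state | (0 < l k)%N]); last first.
  by move=> l _; rewrite lee_fin weighted_ge0//; exact: pos0.
rewrite !setTI [X in (_ + X)%E]esum1 ?adde0; last first.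
  move=> l /= /negP; rewrite -eqn0Ngt => /eqP lk0.
  have [dl|ndl] := boolP (decreasing l); last by rewrite state_weight_eq0// mul0r.
  by rewrite decreasing_down_coef_eq0// mul0r mulr0.
have -> : [set l : state | (0 < l k)%N] = (@up N k) @` [set: state].
  apply/seteqP; split => [l /= lk|_ [l _ <-]/=]; last by rewrite ffunE eqxx addn1.
  exists [ffun i => (l i - (i == k))%N] => //.
  apply/ffunP => i; rewrite !ffunE; case: eqVneq => [->|_]; last by rewrite subn0 addn0.
  by rewrite subnK.
rewrite esum_image; last by move=> l l' _ _; exact: up_inj.
apply: eq_esum => l _; congr EFin.
have e := detailed_balance theta_gt0 l k s_gt0.
have mix (a b c d : R) : a * (b * c * d) = a * (b * c) * d by ring.
apply: (etrans (mix _ _ _ _)); apply: (etrans (congr1 (fun z => z * _) e)).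
by move: (state_weight _ _) (up_coef _ _) (H _) => a b c; ring.
Qed.

Definition total l : nat := (\sum_(i < N) l i)%N.

Lemma total_up k l : total (up k l) = (total l).+1.
Proof.
rewrite /total; under eq_bigr do rewrite ffunE.
rewrite big_split/= [X in (_ + X)%N](bigD1 k)//= eqxx.
rewrite [X in (_ + (_ + X))%N]big1; last by move=> i /negbTE ->.
by rewrite addn0 addn1.
Qed.

Lemma sum_position l : \sum_(k < N) position l k = (total l)%:R + theta * 'C(N, 2)%:R.
Proof.
rewrite /position big_split/= natr_sum; congr (_ + _).
rewrite -mulr_suml mulrC; congr (_ * _).
rewrite -natr_sum; congr (_%:R).
rewrite -bin2_sum big_mkord (reindex_inj rev_ord_inj)/=.
by apply: eq_bigr => i _; have := ltn_ord i; lia.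
Qed.

Lemma sum_up_coef l : decreasing l -> \sum_(k < N) up_coef l k = N%:R.
Proof.
by move=> dl; have [_ -> _] := partial_fraction_expansion (- theta) (position_inj theta_gt0 dl).
Qed.

Lemma sum_position_down_coef l : decreasing l ->
  \sum_(k < N) position l k * down_coef l k = (total l)%:R.
Proof.
move=> dl; have [_ _ ->] := partial_fraction_expansion theta (position_inj theta_gt0 dl).
by rewrite sum_position; ring.
Qed.

(** Equal, by [deficitE], to the left hand side of the integration by parts with
    [theta / (q + position l k)] summed over [k]. *)
Definition deficit (q : R) l :=
  theta * N%:R - q * (\prod_(i < N) (1 + theta / (q + position l i)) - 1).

(** The right hand counterpart of [deficit]; the shift to [q + 1] comes from evaluating
    [theta / (q + position l k)] after the part [k] has grown. *)
Definition surplus (q : R) l :=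
  s * theta * (1 - \prod_(i < N) (1 - theta / (q + 1 + position l i))).

Lemma deficitE q l : 0 < q -> decreasing l ->
  deficit q l = \sum_(k < N) position l k * down_coef l k * (theta / (q + position l k)).
Proof.
move=> q0 dl.
have pos k := position_ge0 theta_gt0 l k.
have [/(_ (- q)) E S _] := partial_fraction_expansion theta (position_inj theta_gt0 dl).
rewrite /deficit.
have -> : \prod_(i < N) (1 + theta / (q + position l i)) =
    1 + theta * \sum_(k < N) down_coef l k / (q + position l k).
  transitivity (\prod_(i < N) (1 - theta / (- q - position l i))).
    by apply: eq_bigr => i _; rewrite -opprD invrN mulrN opprK.
  rewrite E; last by move=> i; have h := pos i; rewrite lt_eqF//; lra.
  congr (_ + _); rewrite -mulrN -sumrN; congr (_ * _).
  by apply: eq_bigr => i _; rewrite -opprD invrN mulrN opprK.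
rewrite -S addrAC subrr add0r mulr_sumr mulrCA !mulr_sumr -sumrB.
apply: eq_bigr => k _; rewrite /down_coef.
have := pos k; move: (position _ _) (residue_coef _ _ _) => x c x0.
by field; rewrite gt_eqF//; lra.
Qed.

Lemma surplusE q l : 0 < q -> decreasing l ->
  surplus q l = \sum_(k < N) s * theta * up_coef l k * (theta / (q + position (up k l) k)).
Proof.
move=> q0 dl.
have pos k := position_ge0 theta_gt0 l k.
have [/(_ (- (q + 1))) E _ _] := partial_fraction_expansion (- theta) (position_inj theta_gt0 dl).
rewrite /surplus.
have -> : \prod_(i < N) (1 - theta / (q + 1 + position l i)) =
    1 - theta * \sum_(k < N) up_coef l k / (q + 1 + position l k).
  transitivity (\prod_(i < N) (1 - - theta / (- (q + 1) - position l i))).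
    by apply: eq_bigr => i _; rewrite -opprD invrN mulrN mulNr !opprK.
  rewrite E; last by move=> i; have h := pos i; rewrite lt_eqF//; lra.
  congr (_ + _); rewrite mulNr opprK -mulrN -sumrN; congr (_ * _).
  by apply: eq_bigr => i _; rewrite -opprD invrN mulrN.
rewrite opprB addrC subrK !mulr_sumr.
apply: eq_bigr => k _; rewrite position_up eqxx/=.
rewrite (_ : q + 1 + position l k = q + (position l k + 1)); last by ring.
by move: (_^-1) => v; ring.
Qed.

Lemma wsum_deficit_surplus q H : 0 < q -> (forall l, 0 <= H l) ->
  wsum (fun l => H l * deficit q l) =
  wsum (fun l => \sum_(k < N) s * theta * up_coef l k *
                   (theta / (q + position (up k l) k)) * H (up k l)).
Proof.
move=> q0 H0.
have pos k l := position_ge0 theta_gt0 l k.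
have v0 k l : 0 <= theta / (q + position l k).
  by rewrite divr_ge0 ?(ltW theta_gt0)// addr_ge0// ltW.
rewrite (eq_wsum (K := fun l => \sum_(k < N) position l k * down_coef l k *
    (H l * (theta / (q + position l k))))); last first.
  move=> l dl; rewrite deficitE// mulr_sumr; apply: eq_bigr => k _; ring.
rewrite wsum_sum; last first.
  move=> k l dl; rewrite mulr_ge0//; first by rewrite mulr_ge0// down_coef_ge0.
  by rewrite mulr_ge0.
rewrite wsum_sum; last first.
  move=> k l dl; rewrite mulr_ge0// mulr_ge0// mulr_ge0 ?up_coef_ge0//.
  by rewrite mulr_ge0// ltW.
apply: eq_bigr => k _; rewrite
  (wsum_down k (H := fun l => H l * (theta / (q + position l k)))); last first.
  by move=> l; rewrite mulr_ge0.
by apply: eq_wsum => l dl; rewrite -!mulrA; do 3 congr (_ * _); rewrite mulrC mulrA.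
Qed.

(** Integration by parts for an indicator function of [total], with the two sums of
    residues computed by [partial_fraction_expansion]. *)
Lemma wsum_total n : wsum (fun l => (total l)%:R * (total l <= n.+1)%:R) =
  wsum (fun l => s * theta * N%:R * (total l <= n)%:R).
Proof.
rewrite (eq_wsum (K := fun l => \sum_(k < N) position l k * down_coef l k *
    (total l <= n.+1)%:R)); last first.
  by move=> l dl; rewrite -mulr_suml sum_position_down_coef.
rewrite wsum_sum; last first.
  move=> k l dl; rewrite mulr_ge0//  mulr_ge0// ?down_coef_ge0//.
  exact: position_ge0.
under eq_bigr => k _ do rewrite (wsum_down k (H := fun l => (total l <= n.+1)%:R))//.
rewrite -wsum_sum; last first.
  move=> k l dl; rewrite mulr_ge0// mulr_ge0// ?up_coef_ge0//.
  by rewrite mulr_ge0// ltW.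
apply: eq_wsum => l dl.
under eq_bigr => k _ do rewrite total_up ltnS.
by rewrite -mulr_suml -mulr_sumr sum_up_coef.
Qed.

Lemma finite_total_le n : finite_set [set l | (total l <= n)%N].
Proof.
apply: (@sub_finite_set _ _ ((fun f : {ffun 'I_N -> 'I_n.+1} =>
    [ffun i => f i : nat] : state) @` [set: {ffun 'I_N -> 'I_n.+1}])).
  move=> l /= ln; exists [ffun i => inord (l i)] => //.
  apply/ffunP => i; rewrite !ffunE inordK// ltnS (leq_trans _ ln)//.
  by rewrite /total (bigD1 i)//= leq_addr.
by apply: finite_image; exact: finite_finset.
Qed.

Lemma wsum_total_le_lty n : (wsum (fun l => (total l <= n)%:R) < +oo)%E.
Proof.
rewrite /wsum (_ : esum _ _ = \esum_(l in [set l | (total l <= n)%N]) (weight l)%:E)%E.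
  rewrite esum_fset; first by rewrite fsumEFin ?ltry//; exact: finite_total_le.
    exact: finite_total_le.
  by move=> l _; rewrite lee_fin state_weight_ge0.
rewrite [RHS]esum_mkcond; apply: eq_esum => l _; case: ifPn.
  by rewrite inE/= => ->; rewrite mulr1.
by rewrite notin_setE/= => /negP/negbTE ->; rewrite mulr0.
Qed.

(** Let [Z n] be the mass of the partitions of size at most [n].  By [wsum_total],
    [m (Z n.+1 - Z m) <= c Z n] with [c = s theta N]; as soon as [m >= 2 c] this
    bounds [Z n.+1] by [2 Z m], uniformly in [n]. *)
Lemma wsum1_lty : (wsum (fun=> 1%R) < +oo)%E.
Proof.
pose Z n := wsum (fun l => (total l <= n)%:R).
pose c : R := s * theta * N%:R.
have c0 : 0 <= c by rewrite !mulr_ge0// ltW.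
pose m := (Num.truncn (2 * c)).+1.
have mc : 2 * c <= m%:R by apply/ltW/truncnS_gt.
have m0 : 0 < m%:R :> R by rewrite ltr0n.
have Zm n : (Z n.+1 <= 2%:E * Z m)%E.
  have fZ p : Z p \is a fin_num.
    by rewrite ge0_fin_numE ?wsum_total_le_lty// wsum_ge0// => l _; rewrite ler0n.
  have ZS : (Z n <= Z n.+1)%E.
    apply: le_wsum => l _; rewrite ler_nat.
    by have [h|//] := leqP (total l) n; rewrite (leqW h).
  have : (m%:R%:E * Z n.+1 <= m%:R%:E * Z m + c%:E * Z n)%E.
    rewrite -!wsumZ; try by [|move=> l _; rewrite ler0n].
    rewrite -wsum_total -wsumD; last 2 first.
    - by move=> l _; rewrite mulr_ge0.
    - by move=> l _; rewrite mulr_ge0.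
    apply: le_wsum => l _.
    have [lm|ml] := leqP (total l) m.
      rewrite -[leLHS]addr0 lerD ?mulr_ge0//.
      by rewrite ler_wpM2l ?(ltW m0)// ler_nat; case: (_ <= n.+1)%N.
    rewrite mulr0 add0r ler_wpM2r// ler_nat.
    exact: ltnW.
  move: ZS; rewrite -(fineK (fZ n)) -(fineK (fZ n.+1)) -(fineK (fZ m)).
  rewrite -!EFinM -EFinD !lee_fin => ZS h.
  have z0 : 0 <= fine (Z n) by rewrite fine_ge0// wsum_ge0.
  have : m%:R * fine (Z n.+1) <= m%:R * (2 * fine (Z m)).
    have : c * fine (Z n) <= c * fine (Z n.+1) by rewrite ler_wpM2l.
    have : 2 * c * fine (Z n.+1) <= m%:R * fine (Z n.+1).
      by rewrite ler_wpM2r//; lra.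
    by lra.
  by rewrite ler_pM2l.
apply: (@le_lt_trans _ _ (2%:E * Z m)%E); last first.
  by rewrite lte_mul_pinfty// wsum_total_le_lty.
apply: ge_ereal_sup => _ [X [finX _] <-].
have [n Xn] : exists n, forall l, X l -> (total l <= n)%N.
  exists (\max_(l <- fset_set X) total l)%N => l Xl.
  by rewrite leq_bigmax_seq// in_fset_set// inE.
apply: le_trans (Zm n).
apply: (@le_trans _ _ (\sum_(l \in X) (weight l * (total l <= n.+1)%:R)%:E)%E).
  apply: lee_fsum => // l Xl; rewrite (leq_trans (Xn _ Xl))//.
by apply: ereal_sup_ubound; exists X.
Qed.

End weighted_sums.

(** * Second moment of the imbalance *)

Section concentration.
Context {R : realType} (theta s : R) (N : nat).
Hypotheses (theta_gt0 : 0 < theta) (s_gt0 : 0 < s).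
Local Notation state := {ffun 'I_N -> nat}.
Implicit Types (l : state) (i j k : 'I_N) (H K : state -> R).
Local Notation weight := (@state_weight R theta N s).
Local Notation position := (@position R theta N).
Local Notation up_coef := (@up_coef R theta N).
Local Notation deficit := (@deficit R theta N).
Local Notation surplus := (@surplus R theta s N).
Local Notation wsum H := (@wsum R theta s N H%R).

Let pos l i : 0 <= position l i. Proof. exact: position_ge0. Qed.

Lemma deficit_ge0 q l : 0 < q -> decreasing l -> 0 <= deficit q l.
Proof.
move=> q0 dl; rewrite (deficitE theta_gt0)// sumr_ge0// => k _.
rewrite mulr_ge0//; first by rewrite mulr_ge0// down_coef_ge0.
by rewrite divr_ge0 ?(ltW theta_gt0)// addr_ge0// ltW.
Qed.

Lemma deficit_le q l : 0 < q -> deficit q l <= theta * N%:R.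
Proof.
move=> q0; rewrite /deficit gerBl mulr_ge0 ?(ltW q0)// subr_ge0.
apply: (big_ind (fun x : R => 1 <= x)) => //; first by move=> x y x1 y1; rewrite mulr_ege1.
by move=> i _; rewrite lerDl divr_ge0 ?(ltW theta_gt0)// addr_ge0// ltW.
Qed.

Lemma surplus_ge0 q l : 0 < q -> decreasing l -> 0 <= surplus q l.
Proof.
move=> q0 dl; rewrite (surplusE s theta_gt0)// sumr_ge0// => k _.
rewrite mulr_ge0//.
  by rewrite mulr_ge0 ?up_coef_ge0// mulr_ge0// ltW.
by rewrite divr_ge0 ?(ltW theta_gt0)// addr_ge0// ltW.
Qed.

Lemma surplus_factor q l i : 0 < q -> theta <= q ->
  0 <= 1 - theta / (q + 1 + position l i) <= 1.
Proof.
move=> q0 tq; have h := pos l i; have th := theta_gt0.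
have d0 : 0 < q + 1 + position l i by lra.
rewrite gerBl divr_ge0 ?(ltW d0) ?(ltW th)// andbT.
by rewrite subr_ge0 ler_pdivrMr//; lra.
Qed.

Lemma surplus_le q l : 0 < q -> theta <= q -> surplus q l <= s * theta.
Proof.
move=> q0 tq; rewrite /surplus mulrBr mulr1 gerBl mulr_ge0//.
  by rewrite mulr_ge0// ltW.
by apply: prodr_ge0 => i _; have /andP[] := surplus_factor l i q0 tq.
Qed.

(** With [q = N y] and [s = t N] this is of order [1 / N]. *)
Definition jump_bound (q : R) : R :=
  theta * expR (theta * N%:R / q) / q + s * theta ^+ 2 / q ^+ 2.

Lemma jump_bound_ge0 q : 0 < q -> 0 <= jump_bound q.
Proof.
move=> q0; rewrite addr_ge0//.
  by rewrite mulr_ge0 ?invr_ge0 ?(ltW q0)// mulr_ge0 ?expR_ge0 ?(ltW theta_gt0).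
by rewrite mulr_ge0 ?invr_ge0 ?exprn_ge0 ?(ltW q0)// mulr_ge0 ?exprn_ge0 ?ltW.
Qed.

Lemma inv_gap (q x : R) : 0 < q -> 0 <= x ->
  theta / (q + x) - theta / (q + (x + 1)) <= theta / q ^+ 2.
Proof.
move=> q0 x0.
have -> : theta / (q + x) - theta / (q + (x + 1)) = theta / ((q + x) * (q + x + 1)).
  by field; rewrite !gt_eqF//=; lra.
rewrite ler_pM2l// lef_pV2 ?posrE ?exprn_gt0// ?mulr_gt0//; try lra.
by rewrite expr2 ler_pM//; lra.
Qed.

(** A single factor of each product changes, by at most [theta / q ^+ 2]. *)
Lemma imbalance_up q l k : 0 < q -> theta <= q ->
  deficit q (up k l) - surplus q (up k l) <=
  deficit q l - surplus q l + jump_bound q.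
Proof.
move=> q0 tq; rewrite /deficit /surplus.
have off (f : R -> R) : \prod_(i < N | i != k) f (position (up k l) i) =
   \prod_(i < N | i != k) f (position l i).
  by apply: eq_bigr => i ik; rewrite position_up (negbTE ik) addr0.
have h := pos l k; have th := theta_gt0.
have split_k l' (f : R -> R) : \prod_(i < N) f (position l' i) =
    f (position l' k) * \prod_(i < N | i != k) f (position l' i).
  by rewrite (bigD1 k).
pose f1 x := 1 + theta / (q + x); pose f2 x := 1 - theta / (q + 1 + x).
rewrite (split_k (up k l) f1) (split_k (up k l) f2) (split_k l f1) (split_k l f2).
rewrite !off /f1 /f2.
have : \prod_(i < N | i != k) (1 + theta / (q + position l i)) <= expR (theta * N%:R / q).
  apply: (@le_trans _ _ (\prod_(i < N) expR (theta / q))).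
    rewrite [leRHS](bigD1 k)//= -[leLHS]mul1r ler_pM//.
    - by apply: prodr_ge0 => i _; rewrite addr_ge0// divr_ge0 ?(ltW th)// addr_ge0// ltW.
    - by rewrite -expR0 ler_expR divr_ge0// ltW.
    apply: ler_prod => i _; apply/andP; split.
      by rewrite addr_ge0// divr_ge0 ?(ltW th)// addr_ge0// ltW.
    apply: le_trans (expR_ge1Dx _); rewrite lerD2l ler_pM2l// lef_pV2 ?posrE//.
      by rewrite lerDl.
    by rewrite ltr_wpDr.
  by rewrite prodr_const card_ord -expRM_natr mulrAC.
have : 0 <= \prod_(i < N | i != k) (1 - theta / (q + 1 + position l i)) <= 1.
  apply/andP; split.
    by apply: prodr_ge0 => i _; have /andP[] := surplus_factor l i q0 tq.
  by apply: prodr_ile1 => i _; exact: surplus_factor.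
have : 0 <= \prod_(i < N | i != k) (1 + theta / (q + position l i)).
  by apply: prodr_ge0 => i _; rewrite addr_ge0// divr_ge0 ?(ltW th)// addr_ge0// ltW.
move: (\prod_(i < N | _) (1 + _)) (\prod_(i < N | _) (1 - _)) => b a b0 /andP[a0 a1] be.
have tr : true%:R = 1 :> R by [].
rewrite position_up eqxx tr /jump_bound.
have g1 := inv_gap q0 h.
have g2 : theta / (q + 1 + position l k) - theta / (q + 1 + (position l k + 1)) <= theta / q ^+ 2.
  have q1 : 0 < q + 1 by lra.
  apply: (le_trans (inv_gap q1 h)).
  rewrite ler_pM2l// lef_pV2 ?posrE ?exprn_gt0//.
  by rewrite lerXn2r ?nnegrE; lra.
set u := theta / (q + position l k) in g1 *.
set u' := theta / (q + (position l k + 1)) in g1 *.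
set v := theta / (q + 1 + position l k) in g2 *.
set v' := theta / (q + 1 + (position l k + 1)) in g2 *.
have e1 : b * (u - u') <= expR (theta * N%:R / q) * (theta / q ^+ 2).
  apply: (@le_trans _ _ (b * (theta / q ^+ 2))); first by rewrite ler_wpM2l.
  by rewrite ler_wpM2r// divr_ge0 ?exprn_ge0// ltW.
have e2 : s * theta * (a * (v - v')) <= s * theta * (theta / q ^+ 2).
  rewrite ler_pM2l ?mulr_gt0//.
  apply: (@le_trans _ _ (a * (theta / q ^+ 2))); first by rewrite ler_wpM2l.
  by rewrite ler_piMl// divr_ge0 ?exprn_ge0// ltW.
have e3 : q * (b * (u - u')) <= theta * expR (theta * N%:R / q) / q.
  apply: (@le_trans _ _ (q * (expR (theta * N%:R / q) * (theta / q ^+ 2)))).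
    by rewrite ler_pM2l.
  rewrite le_eqVlt; apply/orP; left; apply/eqP.
  by move: (expR _) => e; field; rewrite gt_eqF.
have e4 : s * theta * (theta / q ^+ 2) = s * theta ^+ 2 / q ^+ 2 by rewrite expr2; ring.
rewrite -e4.
lra.
Qed.

Definition imbalance q l := deficit q l - surplus q l.

Lemma wsum_bounded_fin H (c : R) : (forall l, decreasing l -> 0 <= H l <= c) ->
  wsum H \is a fin_num.
Proof.
move=> Hc; have H0 l : decreasing l -> 0 <= H l by move=> /Hc/andP[].
rewrite ge0_fin_numE; last exact: wsum_ge0.
have [l0 dl0] : exists l, decreasing l.
  by exists [ffun=> 0%N]; apply/decreasingP => i j _; rewrite !ffunE.
have c0 : 0 <= c by have /andP[] := Hc _ dl0; exact: le_trans.
apply: (@le_lt_trans _ _ (c%:E * wsum (fun=> 1%R))%E).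
  rewrite -wsumZ//; apply: le_wsum => l /Hc/andP[_].
  by rewrite mulr1.
by rewrite lte_mul_pinfty// wsum1_lty.
Qed.

Lemma wsum_deficit_eq_surplus q : 0 < q ->
  wsum (deficit q) = wsum (surplus q).
Proof.
move=> q0.
have := wsum_deficit_surplus theta_gt0 s_gt0 q0 (fun=> ler01) => /= e.
transitivity (wsum (fun l => 1 * deficit q l)).
  by apply: eq_wsum => // l _; rewrite mul1r.
rewrite e; apply: eq_wsum => // l dl; rewrite (surplusE s theta_gt0 q0 dl).
by under eq_bigr do rewrite mulr1.
Qed.

(** Write [K], [V], [U] for imbalance, deficit and surplus.  Testing the integration
    by parts with [K] gives [E (K V) <= E (K U) + delta E U], where [delta] bounds the
    jumps of [K]; since [V - U = K], this is [E (K^2) <= delta E U]. *)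
Lemma wsum_imbalance_sq q : 0 < q -> theta <= q ->
  (wsum (fun l => imbalance q l ^+ 2) <=
   (jump_bound q * (s * theta))%:E * wsum (fun=> 1%R))%E.
Proof.
move=> q0 tq; have th := theta_gt0.
have sth : 0 <= s * theta by rewrite mulr_ge0// ltW.
have J0 := jump_bound_ge0 q0.
(* Test functions must be nonnegative, on all finite functions; adding [C >= surplus]
achieves this for the imbalance on partitions. *)
pose C := s * theta; pose H l := Num.max 0 (imbalance q l + C).
have H0 l : 0 <= H l by rewrite /H le_max lexx.
have HE l : decreasing l -> H l = imbalance q l + C.
  move=> dl; rewrite /H max_r// /imbalance.
  have := deficit_ge0 q0 dl; have := surplus_le l q0 tq; rewrite /C; lra.
have Hup l k : decreasing l -> H (up k l) <= H l + jump_bound q.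
  move=> dl; rewrite ge_max addr_ge0//= HE// /imbalance.
  by have := imbalance_up l k q0 tq; lra.
have step : (wsum (fun l => (H l * deficit q l)%R) <=
     wsum (fun l => (H l * surplus q l)%R) + (jump_bound q)%:E * wsum (surplus q))%E.
  rewrite (wsum_deficit_surplus theta_gt0 s_gt0 q0 H0) -wsumZ//; last first.
    by move=> l dl; exact: surplus_ge0.
  rewrite -wsumD//; last 2 first.
  - by move=> l dl; rewrite mulr_ge0// surplus_ge0.
  - by move=> l dl; rewrite mulr_ge0// surplus_ge0.
  apply: le_wsum => // l dl.
  rewrite -mulrDl (surplusE s theta_gt0 q0 dl) mulr_sumr; apply: ler_sum => k _.
  rewrite mulrC ler_wpM2r ?Hup// mulr_ge0//; first by rewrite mulr_ge0// up_coef_ge0.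
  by rewrite divr_ge0 ?(ltW th)// addr_ge0 ?(ltW q0).
have bU l : decreasing l -> 0 <= surplus q l <= s * theta.
  by move=> dl; rewrite surplus_ge0// surplus_le.
have bV l : decreasing l -> 0 <= deficit q l <= theta * N%:R.
  by move=> dl; rewrite deficit_ge0// deficit_le.
have fU := wsum_bounded_fin bU.
have fHU : wsum (fun l => H l * surplus q l) \is a fin_num.
  apply: (@wsum_bounded_fin _ ((theta * N%:R + C) * C)) => l dl.
  rewrite mulr_ge0 ?surplus_ge0//= ler_pM ?surplus_ge0 ?surplus_le// HE// /imbalance.
  by rewrite lerD2r; have := bV _ dl; have := bU _ dl; lra.
have pointwise : (wsum (fun l => (imbalance q l ^+ 2)%R) +
    wsum (fun l => (H l * surplus q l)%R) + C%:E * wsum (deficit q) =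
    wsum (fun l => (H l * deficit q l)%R) + C%:E * wsum (surplus q))%E.
  rewrite -!wsumZ//; try by move=> l dl; rewrite ?surplus_ge0 ?deficit_ge0.
  have g1 l : decreasing l -> 0 <= H l * surplus q l.
    by move=> dl; rewrite mulr_ge0 ?surplus_ge0.
  have g2 l : decreasing l -> 0 <= H l * deficit q l.
    by move=> dl; rewrite mulr_ge0 ?deficit_ge0.
  have g3 l : decreasing l -> 0 <= C * surplus q l.
    by move=> dl; rewrite mulr_ge0 ?surplus_ge0.
  have g4 l : decreasing l -> 0 <= C * deficit q l.
    by move=> dl; rewrite mulr_ge0 ?deficit_ge0.
  have g5 l : decreasing l -> 0 <= imbalance q l ^+ 2 by rewrite sqr_ge0.
  have g6 l : decreasing l -> 0 <= imbalance q l ^+ 2 + H l * surplus q l.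
    by move=> dl; rewrite addr_ge0 ?g5 ?g1.
  rewrite -!wsumD//.
  apply: eq_wsum => // l dl; rewrite (HE _ dl) /imbalance.
  by move: (deficit _ _) (surplus _ _) => a b; ring.
have upperU : (wsum (surplus q) <= (s * theta)%:E * wsum (fun=> 1%R))%E.
  rewrite -wsumZ//; apply: le_wsum => // l dl; rewrite mulr1.
  by have /andP[] := bU _ dl.
rewrite (wsum_deficit_eq_surplus q0) in pointwise.
apply: (@le_trans _ _ ((jump_bound q)%:E * wsum (surplus q))%E); last first.
  by rewrite EFinM -muleA lee_wpmul2l// lee_fin.
move: step; rewrite -(@leeD2rE _ (C%:E * wsum (surplus q))); last first.
  by rewrite fin_numM.
rewrite -pointwise leeD2rE; last by rewrite fin_numM.
by rewrite [leRHS]addeC leeD2rE.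
Qed.

Lemma chebyshev_imbalance q eta : 0 < q -> theta <= q -> 0 < eta ->
  (wsum (fun l => (eta <= `|imbalance q l|)%R%:R%R) <=
   (jump_bound q * (s * theta) / eta ^+ 2)%:E * wsum (fun=> 1%R))%E.
Proof.
move=> q0 tq eta0; have e2 : 0 < eta ^+ 2 by rewrite exprn_gt0.
rewrite EFinM muleAC lee_pdivlMr// muleC -wsumZ// ?(ltW e2)//.
apply: le_trans (wsum_imbalance_sq q0 tq); apply: le_wsum => // l dl.
have [h|h] := leP eta; last by rewrite mulr0 sqr_ge0.
by rewrite mulr1 -[leRHS]real_normK ?num_real// lerXn2r ?nnegrE// ltW.
Qed.

End concentration.

(** * From weighted sums to the probability law *)

Section law.
Context {R : realType} (theta s : R) (N : nat).
Hypotheses (theta_gt0 : 0 < theta) (s_gt0 : 0 < s).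
Local Notation state := {ffun 'I_N -> nat}.
Implicit Types (l : state) (i j k : 'I_N) (A B C : set (N.-tuple R)).
Local Notation state_tuple := (@state_tuple R theta N).
Local Notation wsum H := (@wsum R theta s N H%R).

Lemma state_tuple_inj : injective state_tuple.
Proof.
move=> l l' e; apply/ffunP => i.
have := congr1 (fun u => tnth u i) e; rewrite /= !tnth_mktuple /position.
by move/addIr/eqP; rewrite eqr_nat => /eqP.
Qed.

(** The shift by [(N - i.+1) * theta] being fixed, a point of the chamber is the same
    as its partition. *)
Lemma weyl_chamberE :
  weyl_chamber theta N = state_tuple @` [set l | decreasing l].
Proof.
apply/seteqP; split => [u [la sla ula]|_ [l dl <-]] /=.
- exists [ffun i => tnth la i].
    apply/decreasingP => i j ij; rewrite !ffunE !(tnth_nth 0%N).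
    apply: (sorted_leq_nth _ _ _ sla) => //; rewrite ?inE ?size_tuple//.
      by move=> a b c /= h1 h2; exact: leq_trans h2 h1.
    exact: leqnn.
  by apply: eq_from_tnth => i; rewrite tnth_mktuple /position ffunE ula.
- exists [tuple l i | i < N]; last first.
    by move=> i; rewrite !tnth_mktuple.
  apply/(sortedP 0%N) => i; rewrite size_tuple => iN.
  have iN' := ltnW iN.
  rewrite -(tnth_nth _ _ (Ordinal iN)) -(tnth_nth _ _ (Ordinal iN')).
  by rewrite !tnth_mktuple; move/decreasingP : dl; apply => /=.
Qed.

Lemma charlier_mass_wsum A :
  charlier_mass theta s A = wsum (fun l => (state_tuple l \in A)%:R).
Proof.
rewrite /charlier_mass weyl_chamberE.
have -> : A `&` (state_tuple @` [set l | decreasing l]) =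
    state_tuple @` [set l | decreasing l /\ A (state_tuple l)].
  apply/seteqP; split => [u [Au [l dl lu]]|_ [l [dl Al] <-]].
    by exists l => //; split => //; rewrite lu.
  by split => //; exists l.
rewrite esum_image; last by move=> l l' _ _; exact: state_tuple_inj.
rewrite esum_mkcond; apply: eq_esum => l _.
have [dl|ndl] := boolP (decreasing l); last first.
  by rewrite state_weight_eq0// mul0r memNset//= => -[]; rewrite (negbTE ndl).
rewrite (state_weightE _ _ dl).
have [Al|nAl] := boolP (state_tuple l \in A).
  by rewrite mem_set ?mulr1//=; split => //; exact: set_mem.
by rewrite memNset ?mulr0//= => -[_ /mem_set]; rewrite (negbTE nAl).
Qed.

Lemma state_weight_gt0 l : decreasing l -> 0 < state_weight theta s l.
Proof.
move=> dl.
rewrite (state_weightE _ _ dl).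
rewrite charlier_weight_state; have th := theta_gt0.
apply: mulr_gt0.
  apply: prodr_gt0 => i _; apply: prodr_gt0 => j ij.
  have h := position_gap theta_gt0 dl ij.
  by apply: divr_gt0; apply: mulr_gt0; apply: Gamma_gt0; lra.
apply: prodr_gt0 => i _; have h := position_ge0 theta_gt0 l i.
apply: divr_gt0; first by rewrite powR_gt0// mulr_gt0.
by apply: Gamma_gt0; lra.
Qed.

Lemma wsum1_gt0 : (0 < wsum (fun=> 1%R))%E.
Proof.
pose l0 : state := [ffun=> 0%N].
have dl0 : decreasing l0 by apply/decreasingP => i j _; rewrite !ffunE.
apply: (@lt_le_trans _ _ (state_weight theta s l0)%:E).
  by rewrite lte_fin state_weight_gt0.
rewrite /(wsum _) (esumID [set l0]).
  rewrite setTI esum_set1; last by rewrite lee_fin mulr1 state_weight_ge0.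
  rewrite [X in (X%:E + _)%E]mulr1 leeDl//.
  by apply: esum_ge0 => l _; rewrite lee_fin mulr1 state_weight_ge0.
by move=> l _; rewrite lee_fin mulr1 state_weight_ge0.
Qed.

Lemma charlier_lawE A : charlier_law theta s N A =
  (wsum (fun l => (state_tuple l \in A)%:R) * (fine (wsum (fun=> 1%R)))^-1%:E)%E.
Proof.
have ZE : charlier_mass theta s [set: N.-tuple R] = wsum (fun=> 1%R).
  by rewrite charlier_mass_wsum; apply: eq_wsum => // l _; rewrite in_setT.
rewrite /charlier_law/= /mnormalize/= ZE gt_eqF ?wsum1_gt0//= lt_eqF ?wsum1_lty//=.
by rewrite charlier_mass_wsum.
Qed.

Lemma charlier_law_le A (c : R) :
  (wsum (fun l => (state_tuple l \in A)%:R) <= c%:E * wsum (fun=> 1%R))%E ->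
  (charlier_law theta s N A <= c%:E)%E.
Proof.
have Zfin : wsum (fun=> 1%R) \is a fin_num.
  by rewrite ge0_fin_numE ?wsum1_lty// ltW// wsum1_gt0.
by rewrite charlier_lawE lee_pdivrMr ?fineK// fine_gt0// wsum1_gt0 wsum1_lty.
Qed.

(** The law is a sum over the states of partitions, and depends on a set only through
    the states that it contains. *)
Lemma charlier_law_leU A B C :
  (forall l, A (state_tuple l) -> B (state_tuple l) \/ C (state_tuple l)) ->
  (charlier_law theta s N A <=
    charlier_law theta s N B + charlier_law theta s N C)%E.
Proof.
move=> ABC; rewrite !charlier_lawE -muleDl//; last first.
  by apply: ge0_adde_def; rewrite inE; apply: wsum_ge0.
apply: lee_wpmul2r.
  by rewrite lee_fin invr_ge0 fine_ge0// ltW// wsum1_gt0.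
rewrite -wsumD//; apply: le_wsum => l _.
have [/set_mem/ABC h|] := boolP (_ \in A); last by rewrite addr_ge0.
by case: h => /mem_set ->; rewrite ?lerDl ?lerDr.
Qed.

End law.

(** * The quadratic equation for the limit, and estimates of products *)

(** The union bound, for independent events of probabilities [a i]. *)
Lemma prod_onem_ge (R : realDomainType) (I : Type) (r : seq I) (a : I -> R) :
  (forall i, 0 <= a i <= 1) ->
  1 - \sum_(i <- r) a i <= \prod_(i <- r) (1 - a i).
Proof.
move=> a01; elim: r => [|i r IH]; first by rewrite !big_nil subr0.
rewrite !big_cons; have /andP[ai0 ai1] := a01 i.
have S0 : 0 <= \sum_(j <- r) a j by apply: sumr_ge0 => j _; have /andP[] := a01 j.
have : (1 - a i) * (1 - \sum_(j <- r) a j) <= (1 - a i) * \prod_(j <- r) (1 - a j).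
  by rewrite ler_wpM2l// subr_ge0.
by nra.
Qed.

Section stieltjes_root.
Context {R : realType} (theta t : R).
Hypotheses (theta_gt0 : 0 < theta) (t_gt0 : 0 < t).
Implicit Types y : R.

Definition discriminant_root y : R :=
  Num.sqrt ((y - theta * (t - 1)) ^+ 2 + 4 * t * theta * y).

(** The positive root of [y e^2 = (y - theta (t - 1)) e + t theta]. *)
Definition exp_stieltjes y : R :=
  (y - theta * (t - 1) + discriminant_root y) / (2 * y).

Definition limit_stieltjes y : R := theta^-1 * ln (exp_stieltjes y).

Lemma discriminant_root_sq y : 0 < y ->
  discriminant_root y ^+ 2 = (y - theta * (t - 1)) ^+ 2 + 4 * t * theta * y.
Proof.
by move=> y0; rewrite sqr_sqrtr// addr_ge0 ?sqr_ge0// !mulr_ge0// ltW.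
Qed.

Lemma exp_stieltjes_root y : 0 < y ->
  y * exp_stieltjes y ^+ 2 = (y - theta * (t - 1)) * exp_stieltjes y + t * theta.
Proof.
move=> y0; have := discriminant_root_sq y0; rewrite /exp_stieltjes.
move: (discriminant_root y) => S SE.
have -> : ((y - theta * (t - 1) + S) / (2 * y)) ^+ 2 =
   ((y - theta * (t - 1)) ^+ 2 + 2 * (y - theta * (t - 1)) * S + S ^+ 2) / (4 * y ^+ 2).
  by field; rewrite gt_eqF.
by rewrite SE; field; rewrite gt_eqF.
Qed.

Lemma discriminant_root_gt y : 0 < y ->
  `|y - theta * (t - 1)| < discriminant_root y.
Proof.
move=> y0; rewrite -(@ltr_pXn2r _ 2) ?nnegrE ?sqrtr_ge0//.
by rewrite discriminant_root_sq// real_normK ?num_real// ltrDl !mulr_gt0.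
Qed.

Lemma exp_stieltjes_gt1 y : 0 < y -> 1 < exp_stieltjes y.
Proof.
move=> y0; rewrite /exp_stieltjes ltr_pdivlMr ?mulr_gt0// mul1r.
suff : y + theta * (t - 1) < discriminant_root y by lra.
have [h|h] := leP (y + theta * (t - 1)) 0.
  apply: le_lt_trans h _; apply: le_lt_trans (discriminant_root_gt y0).
  exact: normr_ge0.
rewrite -(@ltr_pXn2r _ 2) ?nnegrE ?sqrtr_ge0 ?(ltW h)// discriminant_root_sq//.
rewrite -subr_gt0.
rewrite (_ : _ - _ = 4 * theta * y); last by ring.
by rewrite !mulr_gt0.
Qed.

Lemma exp_limit_stieltjes y : 0 < y -> expR (theta * limit_stieltjes y) = exp_stieltjes y.
Proof.
move=> y0; rewrite /limit_stieltjes mulrA divff ?gt_eqF// mul1r lnK// posrE.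
by have := exp_stieltjes_gt1 y0; lra.
Qed.

(** Divided by [e], the equation says that the increasing function
    [b |-> y b - t theta / b], whose slope is at least [y], takes the value
    [y - theta (t - 1)]; so an approximate solution is close to the root. *)
Lemma exp_stieltjes_lipschitz y b : 0 < y -> 0 < b ->
  y * `|b - exp_stieltjes y| <=
  `|y * b - t * theta / b - (y - theta * (t - 1))|.
Proof.
move=> y0 b0; have := exp_stieltjes_root y0; have := exp_stieltjes_gt1 y0.
move: (exp_stieltjes y) => e e1 eE.
have e0 : 0 < e by lra.
have -> : y - theta * (t - 1) = y * e - t * theta / e.
  by apply: (@mulIf _ e); rewrite ?gt_eqF// [RHS]mulrBl divfK ?gt_eqF//; lra.
have -> : y * b - t * theta / b - (y * e - t * theta / e) =
    (y + t * theta / (b * e)) * (b - e).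
  by field; rewrite !gt_eqF.
rewrite normrM ler_wpM2r// ger0_norm; first by rewrite lerDl divr_ge0 ?mulr_ge0 ?ltW// mulr_gt0.
by rewrite addr_ge0 ?divr_ge0 ?mulr_ge0 ?(ltW y0) ?(ltW b0) ?(ltW e0) ?(ltW t_gt0) ?(ltW theta_gt0).
Qed.

Lemma limit_stieltjes_bounds y : 0 < y -> 0 <= limit_stieltjes y <= y^-1.
Proof.
move=> y0; have e1 := exp_stieltjes_gt1 y0; have eE := exp_stieltjes_root y0.
have th := theta_gt0; have t0 := t_gt0.
apply/andP; split.
  by rewrite mulr_ge0 ?invr_ge0 ?(ltW th)// ln_ge0// ltW.
rewrite /limit_stieltjes mulrC ler_pdivrMr//.
have := le_ln1Dx (x := exp_stieltjes y - 1).
rewrite (_ : 1 + (_ - 1) = exp_stieltjes y); last by ring.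
move=> h; apply: (le_trans (h _)); first by lra.
rewrite mulrC ler_pdivlMr//; move: (exp_stieltjes y) e1 eE => e e1 eE.
have te : 0 < t * theta * (e - 1) by rewrite !mulr_gt0// subr_gt0.
have : y * (e - 1) * e <= theta * e by lra.
by rewrite ler_pM2r; [rewrite mulrC|lra].
Qed.

End stieltjes_root.

Section product_estimates.
Context {R : realType} (theta q : R) (N : nat) (x : 'I_N -> R).
Hypotheses (theta_gt0 : 0 < theta) (q_gt0 : 0 < q) (theta_le : theta <= q).
Hypothesis x_ge0 : forall i, 0 <= x i.

Definition growth_product : R := \prod_(i < N) (1 + theta / (q + x i)).
Definition decay_product : R := \prod_(i < N) (1 - theta / (q + 1 + x i)).
Definition stieltjes_sum : R := \sum_(i < N) (q + x i)^-1.

Let inv_le i : (q + x i)^-1 <= q^-1.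
Proof. by rewrite lef_pV2 ?posrE// ?lerDl// ltr_wpDr. Qed.

Let inv_ge0 i : 0 <= (q + x i)^-1.
Proof. by rewrite invr_ge0 addr_ge0// ltW. Qed.

Lemma growth_product_ge1 : 1 <= growth_product.
Proof.
rewrite /growth_product; apply: (big_ind (fun x : R => 1 <= x)) => //.
  by move=> a b a1 b1; rewrite mulr_ege1.
by move=> i _; rewrite lerDl mulr_ge0// ltW.
Qed.

Lemma growth_product_le : growth_product <= expR (theta * stieltjes_sum).
Proof.
rewrite mulr_sumr expR_sum; apply: ler_prod => i _.
by rewrite expR_ge1Dx addr_ge0// mulr_ge0// ltW.
Qed.

Lemma stieltjes_sum_bounds : 0 <= stieltjes_sum <= N%:R / q.
Proof.
rewrite sumr_ge0//= (le_trans (ler_sum _ (fun i _ => inv_le i)))//.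
by rewrite sumr_const card_ord mulr_natl.
Qed.

(** From [exp u (1 - u^2) <= 1 + u], a consequence of [1 - u <= exp (- u)], and
    [prod_onem_ge]. *)
Lemma growth_product_ge :
  expR (theta * stieltjes_sum) * (1 - N%:R * (theta / q) ^+ 2) <= growth_product.
Proof.
have th := theta_gt0.
pose u i := theta / (q + x i).
have u0 i : 0 <= u i by rewrite mulr_ge0// ltW.
have uq i : u i <= theta / q by rewrite ler_pM2l.
have q1 : theta / q <= 1 by rewrite ler_pdivrMr// mul1r.
have h i : expR (u i) * (1 - u i ^+ 2) <= 1 + u i.
  have -> : 1 - u i ^+ 2 = (1 - u i) * (1 + u i) by ring.
  rewrite mulrA ler_piMl ?addr_ge0//.
  have := expR_ge1Dx (- u i); rewrite expRN => h.
  by rewrite mulrC -ler_pdivlMr ?expR_gt0// mul1r.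
apply: (@le_trans _ _ (\prod_(i < N) (expR (u i) * (1 - u i ^+ 2)))); last first.
  apply: ler_prod => i _; rewrite h andbT mulr_ge0 ?expR_ge0// subr_ge0.
  by rewrite expr_le1// (le_trans (uq i)).
rewrite big_split/= mulr_sumr expR_sum ler_wpM2l//.
  by apply: prodr_ge0 => i _; exact: expR_ge0.
apply: le_trans (prod_onem_ge _ _); last first.
  by move=> i; rewrite sqr_ge0/= expr_le1// (le_trans (uq i)).
rewrite lerD2l lerN2 (@le_trans _ _ (\sum_(i < N) (theta / q) ^+ 2))//.
  by apply: ler_sum => i _; rewrite lerXn2r ?nnegrE// divr_ge0 ?ltW.
by rewrite sumr_const card_ord mulr_natl.
Qed.

(** Each factor of the product is [1 + theta (1 - theta) v] with
    [v = O (q^-2)], which is bounded above and below for either sign of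
    [1 - theta]. *)
Lemma decay_growth_product :
  1 - N%:R * (theta / q) ^+ 2 <= decay_product * growth_product <=
  expR (N%:R * (theta / q ^+ 2)).
Proof.
have th := theta_gt0.
rewrite /decay_product /growth_product -big_split/=.
have w i : 0 < q + x i by rewrite ltr_wpDr.
have w1 i : 0 < q + x i + 1 by rewrite addr_gt0.
pose v i := ((q + x i) * (q + x i + 1))^-1.
have v0 i : 0 <= v i by rewrite invr_ge0 mulr_ge0// ltW.
have vq i : v i <= (q ^+ 2)^-1.
  rewrite lef_pV2 ?posrE ?exprn_gt0 ?mulr_gt0// expr2 ler_pM ?(ltW q_gt0)//.
    by rewrite lerDl.
  by rewrite -addrA lerDl addr_ge0.
have E i : (1 - theta / (q + 1 + x i)) * (1 + theta / (q + x i)) =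
    1 + theta * (1 - theta) * v i.
  have -> : q + 1 + x i = q + x i + 1 by ring.
  have := w i; have := w1 i; rewrite /v; move: (q + x i) => z z1 z0.
  by field; rewrite !gt_eqF.
have q1 : theta / q <= 1 by rewrite ler_pdivrMr// mul1r.
have tq0 : 0 <= theta / q by rewrite divr_ge0 ?ltW.
have tv i : 0 <= theta ^+ 2 * v i <= (theta / q) ^+ 2.
  rewrite mulr_ge0 ?sqr_ge0//= expr_div_n ler_wpM2l ?sqr_ge0//.
have tv1 i : 0 <= theta ^+ 2 * v i <= 1.
  have /andP[-> h] := tv i; rewrite /= (le_trans h)//.
  by rewrite expr_le1.
have tvl i : 1 - theta ^+ 2 * v i <= 1 + theta * (1 - theta) * v i.
  have h : 0 <= theta * v i by rewrite mulr_ge0 ?(ltW th).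
  rewrite lerD2l mulrBr mulr1 mulrBl -expr2 -[leLHS]add0r.
  by rewrite lerD2r.
under eq_bigr => i _ do rewrite E.
apply/andP; split.
  apply: (@le_trans _ _ (\prod_(i < N) (1 - theta ^+ 2 * v i))); last first.
    apply: ler_prod => i _; rewrite tvl andbT subr_ge0.
    by have /andP[] := tv1 i.
  apply: le_trans (prod_onem_ge _ tv1).
  rewrite lerD2l lerN2 (@le_trans _ _ (\sum_(i < N) (theta / q) ^+ 2))//.
    by apply: ler_sum => i _; have /andP[] := tv i.
  by rewrite sumr_const card_ord mulr_natl.
apply: (@le_trans _ _ (\prod_(i < N) expR (theta / q ^+ 2))).
  apply: ler_prod => i _; apply/andP; split.
    by apply: le_trans (tvl i); rewrite subr_ge0; have /andP[] := tv1 i.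
  apply: le_trans (expR_ge1Dx _); rewrite lerD2l.
  apply: (@le_trans _ _ (theta * v i)); last by rewrite ler_pM2l.
  by rewrite ler_wpM2r// mulrBr mulr1 gerBl mulr_ge0 ?(ltW th).
by rewrite prodr_const card_ord -expRM_natr mulrC.
Qed.

End product_estimates.

(** * Concentration of the Stieltjes transform *)

Section stieltjes_concentration.
Context {R : realType} (theta t y : R).
Hypotheses (theta_gt0 : 0 < theta) (t_gt0 : 0 < t) (y_gt0 : 0 < y).

Definition mean_stieltjes N (u : N.-tuple R) : R :=
  N%:R^-1 * \sum_(i < N) (y + tnth u i / N%:R)^-1.

Lemma mean_stieltjesE N (l : {ffun 'I_N -> nat}) : (0 < N)%N ->
  mean_stieltjes (state_tuple theta l) = stieltjes_sum (N%:R * y) (position theta l).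
Proof.
move=> N0; have NR : N%:R != 0 :> R by rewrite pnatr_eq0 -lt0n.
rewrite /mean_stieltjes /stieltjes_sum mulr_sumr; apply: eq_bigr => i _.
by rewrite tnth_mktuple -invfM mulrDr mulrCA divff// mulr1.
Qed.

(** What remains of the lower bound [y * theta * eps] on the imbalance divided by
    [N], after the errors made in replacing the products by exponentials. *)
Definition separation (eps : R) (N : nat) : R :=
  let q := N%:R * y in
  let d := N%:R * (theta / q) ^+ 2 in
  y * (theta * eps - expR (theta / y) * d) -
  t * theta * (d + (expR (N%:R * (theta / q ^+ 2)) - 1)).

(** If [g] is [eps] away from its limit, [expR (theta g)] is [theta * eps] away from the
    root; up to the errors of the products the quadratic equation then fails by
    [y * theta * eps], and its defect is the imbalance divided by [N]. *)
Lemma separation_le eps N (l : {ffun 'I_N -> nat}) : (0 < N)%N ->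
  theta <= N%:R * y -> 0 < eps ->
  eps <= `|mean_stieltjes (state_tuple theta l) - limit_stieltjes theta t y| ->
  N%:R * separation eps N <= `|imbalance theta (t * N%:R) (N%:R * y) l|.
Proof.
move=> N0 tq e0.
have NR : 0 < N%:R :> R by rewrite ltr0n.
have th := theta_gt0; have t0 := t_gt0; have y0 := y_gt0.
rewrite mean_stieltjesE// /separation.
set q := N%:R * y; have q0 : 0 < q by rewrite mulr_gt0.
have x0 := @position_ge0 _ theta N theta_gt0 l.
rewrite /imbalance /deficit /surplus.
rewrite -/(growth_product theta q (position theta l)).
rewrite -/(decay_product theta q (position theta l)).
have B1 := growth_product_ge1 theta_gt0 q0 x0.
have B2 := growth_product_le theta_gt0 q0 x0.
have B3 := growth_product_ge theta_gt0 q0 tq x0.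
have AB := decay_growth_product theta_gt0 q0 tq x0.
have G := stieltjes_sum_bounds q0 x0.
move: (growth_product _ _ _) (decay_product _ _ _) (stieltjes_sum _ _) B1 B2 B3 AB G.
set d1 := N%:R * (theta / q) ^+ 2; set d2 := N%:R * (theta / q ^+ 2).
have d10 : 0 <= d1 by rewrite mulr_ge0 ?sqr_ge0.
move=> B A g B1 B2 B3 /andP[AB1 AB2] /andP[g0 gy] hg.
have Nq : N%:R / q = y^-1 by rewrite /q invfM mulrA divff ?gt_eqF// mul1r.
rewrite Nq in gy.
have b1 : 1 <= expR (theta * g) by rewrite -expR0 ler_expR mulr_ge0// ltW.
have b2 : expR (theta * g) <= expR (theta / y) by rewrite ler_expR ler_pM2l.
have bs1 := exp_stieltjes_gt1 theta_gt0 t_gt0 y_gt0.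
have bsE := exp_limit_stieltjes theta_gt0 t_gt0 y_gt0.
have eth : 0 < theta * eps by rewrite mulr_gt0.
have BB : theta * eps - expR (theta / y) * d1 <= `|B - exp_stieltjes theta t y|.
  have [h|h] := leP (limit_stieltjes theta t y) g.
    move: hg; rewrite ger0_norm ?subr_ge0// => hg.
    have k1 : exp_stieltjes theta t y + theta * eps <= expR (theta * g).
      have := expR_ge1Dx (theta * (g - limit_stieltjes theta t y)).
      rewrite mulrBr expRD expRN bsE ler_pdivlMr; last by lra.
      have : theta * eps <= theta * (g - limit_stieltjes theta t y) by rewrite ler_pM2l.
      rewrite mulrBr => k2 k3; nra.
    have k4 : expR (theta * g) * d1 <= expR (theta / y) * d1 by rewrite ler_wpM2r.
    by apply: le_trans (ler_norm _); lra.
  move: hg; rewrite ltr0_norm ?subr_lt0// opprB => hg.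
  have k1 : expR (theta * g) + theta * eps <= exp_stieltjes theta t y.
    have := expR_ge1Dx (theta * (limit_stieltjes theta t y - g)).
    rewrite mulrBr expRD expRN bsE ler_pdivlMr; last by lra.
    have : theta * eps <= theta * (limit_stieltjes theta t y - g) by rewrite ler_pM2l.
    rewrite mulrBr => k2 k3; nra.
  have k4 : 0 <= expR (theta / y) * d1 by rewrite mulr_ge0 ?expR_ge0.
  by rewrite distrC; apply: le_trans (ler_norm _); lra.
have B0 : 0 < B by lra.
have lip := exp_stieltjes_lipschitz theta_gt0 t_gt0 y_gt0 B0.
have AinvB : `|A - B^-1| <= d1 + (expR d2 - 1).
  have -> : A - B^-1 = (A * B - 1) / B by field; rewrite gt_eqF.
  rewrite normrM normfV (gtr0_norm B0) ler_pdivrMr//.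
  have m1 : `|A * B - 1| <= d1 + (expR d2 - 1).
    have d20 : 0 <= d2 by rewrite mulr_ge0// divr_ge0 ?sqr_ge0 ?(ltW th).
    have : 1 <= expR d2 by rewrite -expR0 ler_expR.
    by rewrite ler_norml; lra.
  apply: (le_trans m1); rewrite ler_peMr// (le_trans _ m1)//.
have -> : theta * N%:R - q * (B - 1) - t * N%:R * theta * (1 - A) =
   N%:R * (t * theta * (A - B^-1) - (y * B - t * theta / B - (y - theta * (t - 1)))).
  by rewrite /q; ring.
rewrite normrM (gtr0_norm NR) ler_pM2l//.
rewrite distrC; apply: le_trans (lerB_dist _ _).
rewrite normrM (gtr0_norm (mulr_gt0 t0 th)).
apply: lerB.
  by apply: le_trans lip; rewrite ler_pM2l.
by rewrite ler_pM2l// mulr_gt0.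
Qed.

Lemma cvg_inv_nat : (N%:R^-1 : R) @[N --> \oo] --> (0 : R).
Proof. by rewrite -cvg_shiftS; exact: cvg_harmonic. Qed.

Lemma separation_cvg (eps : R) : separation eps N @[N --> \oo] --> y * (theta * eps).
Proof.
have y0 := y_gt0.
have E N : separation eps N =
    y * (theta * eps - expR (theta / y) * ((theta / y) ^+ 2 * N%:R^-1)) -
    t * theta * ((theta / y) ^+ 2 * N%:R^-1 + (expR (theta / y ^+ 2 * N%:R^-1) - 1)).
  rewrite /separation; case: N => [|N].
    by rewrite !mul0r invr0 !mulr0.
  have NR : N.+1%:R != 0 :> R by rewrite pnatr_eq0.
  move: (N.+1%:R : R) NR => n n0.
  rewrite (_ : n * (theta / (n * y)) ^+ 2 = (theta / y) ^+ 2 * n^-1); last first.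
    by field; rewrite n0 gt_eqF.
  rewrite (_ : n * (theta / (n * y) ^+ 2) = theta / y ^+ 2 * n^-1)//.
  by field; rewrite n0 gt_eqF.
have L : y * (theta * eps - expR (theta / y) * ((theta / y) ^+ 2 * 0)) -
    t * theta * ((theta / y) ^+ 2 * 0 + (expR (theta / y ^+ 2 * 0) - 1)) = y * (theta * eps).
  by rewrite !mulr0 expR0 subrr addr0 mulr0 !subr0.
rewrite -L; under eq_cvg do rewrite E.
have c1 : ((theta / y) ^+ 2 * N%:R^-1) @[N --> \oo] --> (theta / y) ^+ 2 * 0.
  by apply: cvgMl_tmp; exact: cvg_inv_nat.
apply: cvgB; apply: cvgMl_tmp.
  by apply: cvgB; [exact: cvg_cst|apply: cvgMl_tmp].
apply: cvgD => //; apply: cvgB; last exact: cvg_cst.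
apply: continuous_cvg; first exact: continuous_expR.
by apply: cvgMl_tmp; exact: cvg_inv_nat.
Qed.

(** Chebyshev's inequality: the imbalance is at least of order [N] on the event,
    while its second moment is bounded. *)
Lemma mean_stieltjes_concentration (eps : R) : 0 < eps ->
  charlier_law theta (t * N%:R) N
    [set u | eps <= `|mean_stieltjes u - limit_stieltjes theta t y|]
    @[N --> \oo] --> 0%E.
Proof.
move=> e0; have y0 := y_gt0; have th := theta_gt0; have t0 := t_gt0.
pose eta := y * (theta * eps) / 2.
have eta0 : 0 < eta by rewrite divr_gt0// !mulr_gt0.
pose c := (theta * expR (theta / y) / y + t * theta ^+ 2 / y ^+ 2) * (t * theta) / eta ^+ 2.
have sepN : \forall N \near \oo, eta <= separation eps N.
  have /cvgrPdist_le H := @separation_cvg eps.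
  have := H _ eta0.
  apply: filterS => N /=.
  rewrite ler_norml => /andP[_]; rewrite /eta; lra.
apply: (@squeeze_cvge _ _ _ _ (cst 0%E) _ (fun N : nat => (c * N%:R^-1)%:E)).
- near=> N.
  rewrite measure_ge0/=.
  have N0 : (0 < N)%N by near: N; exact: nbhs_infty_gt.
  have NR : 0 < N%:R :> R by rewrite ltr0n.
  have s0 : 0 < t * N%:R by rewrite mulr_gt0.
  have tq : theta <= N%:R * y.
    rewrite -ler_pdivrMr//; near: N; exact: nbhs_infty_ger.
  have eN : eta <= separation eps N by near: N.
  apply: charlier_law_le => //.
  have q0 : 0 < N%:R * y by rewrite mulr_gt0.
  have e1 : 0 < N%:R * eta by rewrite mulr_gt0.
  apply: (@le_trans _ _ (wsum theta (t * N%:R)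
      (fun l : {ffun 'I_N -> nat} =>
        (N%:R * eta <= `|imbalance theta (t * N%:R) (N%:R * y) l|)%R%:R))).
    apply: le_wsum => // l dl; rewrite ler_nat.
    have [|//] := boolP (state_tuple theta l \in _).
    rewrite inE/= => h.
    have := separation_le N0 tq e0 h => /(le_trans _) -> //.
    by rewrite ler_pM2l.
  apply: (le_trans (chebyshev_imbalance N theta_gt0 s0 q0 tq e1)).
  rewrite lee_wpmul2r ?wsum_ge0// lee_fin /jump_bound /c.
  have N1 : 1 <= N%:R :> R by rewrite ler1n.
  rewrite (_ : theta * N%:R / (N%:R * y) = theta / y); last first.
    by field; rewrite !gt_eqF.
  rewrite -subr_ge0; move: (expR _) (expR_ge0 (theta / y)) => E E0.
  rewrite (_ : _ - _ = (theta * E / y + t * theta ^+ 2 / y ^+ 2) *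
    (t * theta) / eta ^+ 2 / N%:R * (1 - N%:R^-1)); last first.
    by field; rewrite !gt_eqF.
  rewrite mulr_ge0 ?subr_ge0 ?invf_le1// divr_ge0 ?(ltW NR)// divr_ge0 ?sqr_ge0//.
  rewrite mulr_ge0 ?(ltW (mulr_gt0 t0 th))// addr_ge0// divr_ge0 ?sqr_ge0 ?(ltW y0)//.
    by rewrite mulr_ge0// ltW.
  by rewrite mulr_ge0 ?sqr_ge0// ltW.
- exact: cvg_cst.
- rewrite -[X in _ --> X](_ : (c * 0)%:E = 0%E); last by rewrite mulr0.
  apply: cvg_EFin; first exact: nearW.
  by apply: cvgMl_tmp; exact: cvg_inv_nat.
Unshelve. all: by end_near.
Qed.

End stieltjes_concentration.

(** * The angle of [sigma + e^{i psi}] *)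

Lemma is_derive_eq_oo (R : realType) (f g df : R -> R) (a b c : R) :
  (forall x, x \in `]a, b[ -> is_derive x 1 f (df x)) ->
  (forall x, x \in `]a, b[ -> is_derive x 1 g (df x)) ->
  c \in `]a, b[ -> f c = g c -> forall x, x \in `]a, b[ -> f x = g x.
Proof.
move=> hf hg cab fgc x xab.
pose h z := f z - g z.
have hd z : z \in `]a, b[ -> is_derive z 1 h (cst 0 z).
  move=> zab; have h1 := hf _ zab; have h2 := hg _ zab.
  by rewrite -(subrr (df z)); exact: is_deriveB.
have cont z : z \in `]a, b[ -> {for z, continuous h}.
  move=> zab; apply: differentiable_continuous; apply/derivable1_diffP.
  by have [] := hd _ zab.
have H u v : u \in `]a, b[ -> v \in `]a, b[ -> u < v -> h v = h u.
  move=> uab vab uv.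
  have sub z : z \in `[u, v] -> z \in `]a, b[.
    move: uab vab; rewrite !in_itv/= => /andP[au _] /andP[_ vb] /andP[uz zv].
    by rewrite (lt_le_trans au uz) (le_lt_trans zv vb).
  have hd' z : z \in `]u, v[ -> is_derive z 1 h (cst 0 z).
    by move=> zuv; apply: hd; apply: sub; exact: subset_itv_oo_cc.
  have hc : {within `[u, v], continuous h}.
    by apply: continuous_in_subspaceT => z /set_mem zuv; apply: cont; exact: sub.
  have [e _] := MVT uv hd' hc.
  by rewrite mul0r => /eqP; rewrite subr_eq0 => /eqP.
have e : h x = h c.
  by have [xc|cx|->//] := ltgtP x c; [rewrite (H x c)|rewrite (H c x)].
by apply/eqP; rewrite -subr_eq0 -/(h x) e /h fgc subrr.
Qed.

Section angle.
Context {R : realType} (sigma : R).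
Hypothesis sigma_gt0 : 0 < sigma.
Implicit Types psi : R.

Lemma pi2_in : (pi / 2 : R) \in `]0, pi[.
Proof. by have := pi_gt0 R; rewrite in_itv/= => h; apply/andP; split; lra. Qed.

(** The derivative in [psi] of the argument of [sigma + e^{i psi}]. *)
Definition angle_speed psi : R :=
  (1 + sigma * cos psi) / (1 + sigma ^+ 2 + 2 * sigma * cos psi).

Lemma modulus_gt0 psi : psi \in `]0, pi[ ->
  0 < 1 + sigma ^+ 2 + 2 * sigma * cos psi.
Proof.
move=> hp; have hs : 0 < sin psi by apply: sin_gt0_pi; rewrite in_itv/= in hp.
have e := cos2Dsin2 psi.
have : 0 < (sigma + cos psi) ^+ 2 + sin psi ^+ 2.
  by rewrite ltr_wpDl ?sqr_ge0// exprn_gt0.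
by move: e; rewrite sqrrD; lra.
Qed.

Lemma is_derive_arccot psi : psi \in `]0, pi[ ->
  is_derive psi 1 (fun p => arccot ((sigma + cos p) / sin p)) (angle_speed psi).
Proof.
move=> hp; have hs : 0 < sin psi by apply: sin_gt0_pi; rewrite in_itv/= in hp.
have hm := modulus_gt0 hp.
rewrite /arccot /angle_speed.
have s0 : sin psi != 0 by rewrite gt_eqF.
have := is_deriveV s0 => dv.
apply: is_derive_eq; rewrite /GRing.scale/=.
have e := cos2Dsin2 psi.
have e2 : cos psi ^+ 2 = 1 - sin psi ^+ 2 by rewrite -e addrK.
move: (cos psi) (sin psi) hs s0 hm e e2 => c s hs s0 hm e e2.
have m2 : s ^+ 2 + (sigma + c) ^+ 2 = 1 + sigma ^+ 2 + 2 * sigma * c by lra.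
have n2 : (sigma + c) * c + s ^+ 2 = 1 + sigma * c by lra.
rewrite -m2 -n2 in hm *.
by field; rewrite s0 gt_eqF.
Qed.

(** The same argument, written as [psi] minus the argument of [1 + sigma e^{- i psi}];
    this form stays smooth at 0 and [pi] when [sigma < 1]. *)
Lemma is_derive_phase psi : 0 < 1 + sigma * cos psi ->
  is_derive psi 1 (fun p => p - atan (sigma * sin p / (1 + sigma * cos p)))
    (angle_speed psi).
Proof.
move=> hp; have h0 : 1 + sigma * cos psi != 0 by rewrite gt_eqF.
have := @is_deriveV R (fun p => 1 + sigma * cos p) psi 1 _ h0 => dv.
rewrite /angle_speed.
apply: is_derive_eq; rewrite /GRing.scale/=.
have e := cos2Dsin2 psi.
move: (cos psi) (sin psi) hp h0 e => c s hp h0 e.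
have m2 : (1 + sigma * c) ^+ 2 + (sigma * s) ^+ 2 = 1 + sigma ^+ 2 + 2 * sigma * c.
  have : sigma ^+ 2 * (c ^+ 2 + s ^+ 2) = sigma ^+ 2 by rewrite e mulr1.
  lra.
rewrite -m2.
have hm : 0 < (1 + sigma * c) ^+ 2 + (sigma * s) ^+ 2.
  by rewrite ltr_pwDl ?exprn_gt0// sqr_ge0.
by field; rewrite h0 gt_eqF.
Qed.

Lemma continuous_phase psi : 0 < 1 + sigma * cos psi ->
  {for psi, continuous (fun p => p - atan (sigma * sin p / (1 + sigma * cos p)))}.
Proof.
move=> hp; apply: differentiable_continuous; apply/derivable1_diffP.
by have [] := is_derive_phase hp.
Qed.

Lemma phase_at_pi2 :
  pi / 2 - atan (sigma * sin (pi / 2) / (1 + sigma * cos (pi / 2))) =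
  arccot ((sigma + cos (pi / 2)) / sin (pi / 2)) :> R.
Proof. by rewrite sin_pihalf cos_pihalf mulr0 !addr0 !divr1 mulr1. Qed.

End angle.

Lemma atanV (R : realType) (x : R) : 0 < x -> atan x^-1 = pi / 2 - atan x.
Proof.
move=> x0.
have a0 : 0 < atan x by rewrite -atan0; exact: lt_atan.
have a1 := atan_ltpi2 x.
have -> : x^-1 = tan (pi / 2 - atan x).
  rewrite /tan sinB cosB sin_pihalf cos_pihalf !mul0r !mul1r subr0 add0r.
  by rewrite -[x in LHS]atanK /tan invf_div.
by rewrite tanK// in_itv/=; apply/andP; split; lra.
Qed.

Section angle_function.
Context {R : realType} (sigma : R).
Hypothesis sigma_gt0 : 0 < sigma.

(** The argument of [sigma + e^{i psi}] at [psi = pi]: the circle encloses the origin,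
    passes through it, or leaves it outside. *)
Definition angle_end : R :=
  if sigma < 1 then pi else if sigma == 1 then pi / 2 else 0.

Lemma angle_unique (f : R -> R) :
  (forall psi, psi \in `]0, pi[ -> is_derive psi 1 f (angle_speed sigma psi)) ->
  f (pi / 2) = arccot ((sigma + cos (pi / 2)) / sin (pi / 2)) ->
  forall psi, psi \in `]0, pi[ -> f psi = arccot ((sigma + cos psi) / sin psi).
Proof.
move=> df f2 psi hp.
exact: (@is_derive_eq_oo R f (fun p => arccot ((sigma + cos p) / sin p)) _ _ _ _ df
  (@is_derive_arccot R sigma) pi2_in f2 psi hp).
Qed.

(** The formula with arccot is singular at 0 and [pi], where integrals need boundary
    values.  In each of the three cases a function that is continuous everywhere has
    the same derivative between 0 and [pi] and the same value at [pi / 2]. *)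
Lemma angle_exists : exists alpha : R -> R,
  [/\ continuous alpha,
      forall psi, psi \in `]0, pi[ ->
        alpha psi = arccot ((sigma + cos psi) / sin psi),
      forall psi, psi \in `]0, pi[ -> is_derive psi 1 alpha (angle_speed sigma psi),
      alpha 0 = 0 & alpha pi = angle_end].
Proof.
have pi0 := pi_gt0 R.
have cos1 psi : (-1 : R) <= cos psi <= 1 by rewrite cos_geN1 cos_le1.
have pos1 (r : R) psi : 0 < r -> r < 1 -> 0 < 1 + r * cos psi.
  move=> r0 r1; have /andP[h _] := cos1 psi.
  have h2 : r * -1 <= r * cos psi by rewrite ler_pM2l.
  lra.
rewrite /angle_end; have [s1|s1|s1] := ltgtP sigma 1.
- have pos psi : 0 < 1 + sigma * cos psi.
    exact: pos1.
  exists (fun p => p - atan (sigma * sin p / (1 + sigma * cos p))); split.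
  + by move=> psi; apply: continuous_phase.
  + apply: angle_unique.
      by move=> psi _; exact: is_derive_phase.
    exact: phase_at_pi2.
  + by move=> psi _; exact: is_derive_phase.
  + by rewrite sin0 mulr0 mul0r atan0 subr0.
  + by rewrite sinpi mulr0 mul0r atan0 subr0.
(* The argument of [sigma + e^{i psi}] is that of [1 + r e^{i psi}], or [psi] minus
the angle of [r + e^{i psi}], where [r < 1]. *)
- pose r := sigma^-1; have r0 : 0 < r by rewrite invr_gt0.
  have r1 : r < 1 by rewrite invf_lt1.
  have pos psi : 0 < 1 + r * cos psi.
    exact: pos1.
  pose alpha (p : R) : R := p - (p - atan (r * sin p / (1 + r * cos p))).
  have d (psi : R) : is_derive psi 1 alpha (angle_speed sigma psi).
    have dp := is_derive_phase (pos psi).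
    apply: is_derive_eq; rewrite /angle_speed.
    have hm : 0 < 1 + r ^+ 2 + 2 * r * cos psi.
      have <- : (1 + r * cos psi) ^+ 2 + (r * sin psi) ^+ 2 = 1 + r ^+ 2 + 2 * r * cos psi.
        have : r ^+ 2 * (cos psi ^+ 2 + sin psi ^+ 2) = r ^+ 2 by rewrite cos2Dsin2 mulr1.
        lra.
      by rewrite ltr_pwDl ?exprn_gt0 ?sqr_ge0.
    have -> : sigma = r^-1 by rewrite invrK.
    move: (cos psi) hm => c hm; field.
    rewrite !gt_eqF//= (_ : _ + _ = 1 + r ^+ 2 + 2 * r * c)//; ring.
  exists alpha; split.
  + move=> psi; apply: differentiable_continuous; apply/derivable1_diffP.
    by have [] := d psi.
  + apply: angle_unique; rewrite /alpha (phase_at_pi2 r) /arccot.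
    rewrite sin_pihalf cos_pihalf !addr0 !divr1.
    by rewrite atanV//; ring.
  + by move=> psi _; exact: d.
  + by rewrite /alpha sin0 mulr0 mul0r atan0 !subr0.
  + by rewrite /alpha sinpi mulr0 mul0r atan0 subr0 subrr.
- have d psi : psi \in `]0, pi[ -> is_derive psi 1 (fun p : R => p / 2) (angle_speed sigma psi).
    move=> hp; have hm := modulus_gt0 sigma hp.
    apply: is_derive_eq; rewrite /GRing.scale/= /angle_speed s1 mulr1.
    by rewrite s1 in hm; field; rewrite gt_eqF//; move: hm; rewrite expr1n mulr1; lra.
  exists (fun p => p / 2); split.
  + by move=> psi; exact: cvgMr_tmp.
  + apply: (angle_unique d).
    rewrite s1 sin_pihalf cos_pihalf addr0 divr1 /arccot atan1; lra.
  + exact: d.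
  + by rewrite mul0r.
  + by [].
Qed.

End angle_function.

(** * Parametrization of the support by an angle *)

Section bulk.
Context {R : realType} (theta t : R).
Hypotheses (theta_gt0 : 0 < theta) (t_gt0 : 0 < t).
Notation mu := (@lebesgue_measure R).
Local Notation sigma := (Num.sqrt t).

Let sigma_gt0 : 0 < sigma. Proof. by rewrite sqrtr_gt0. Qed.
Let sigma_sq : sigma ^+ 2 = t. Proof. by rewrite sqr_sqrtr// ltW. Qed.

(** This is [theta |1 + sigma e^{i psi}|^2], which decreases from [right_edge] to
    [left_edge] as [psi] runs from 0 to [pi]. *)
Definition bulk_point (psi : R) : R := theta * (1 + t + 2 * sigma * cos psi).
Definition left_edge : R := theta * (sigma - 1) ^+ 2.
Definition right_edge : R := theta * (sigma + 1) ^+ 2.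

Lemma bulk_point0 : bulk_point 0 = right_edge.
Proof. by rewrite /bulk_point /right_edge cos0; move: sigma_sq; move: sigma => s <-; ring. Qed.

Lemma bulk_point_pi : bulk_point pi = left_edge.
Proof. by rewrite /bulk_point /left_edge cospi; move: sigma_sq; move: sigma => s <-; ring. Qed.

Lemma left_edge_ge0 : 0 <= left_edge.
Proof. by rewrite mulr_ge0 ?sqr_ge0// ltW. Qed.

Lemma left_edge_lt : left_edge < right_edge.
Proof.
rewrite /left_edge /right_edge ltr_pM2l//.
by have := sigma_gt0; rewrite !sqrrD; lra.
Qed.

Lemma bulk_point_ge psi : left_edge <= bulk_point psi.
Proof.
rewrite -bulk_point_pi /bulk_point cospi ler_pM2l// lerD2l ler_pM2l ?mulr_gt0//.
exact: cos_geN1.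
Qed.

#[global] Instance is_derive_bulk_point (psi : R) :
  is_derive psi 1 bulk_point (- (2 * theta * sigma * sin psi)).
Proof. by apply: is_derive_eq; rewrite /GRing.scale/=; ring. Qed.

Lemma continuous_bulk_point : continuous bulk_point.
Proof.
move=> psi; apply: differentiable_continuous; apply/derivable1_diffP.
exact: ex_derive.
Qed.

Definition bulk_angle (x : R) : R := acos ((x / theta - (1 + t)) / (2 * sigma)).

Lemma bulk_pointK : {in `[0, pi], cancel bulk_point bulk_angle}.
Proof.
move=> psi hp; rewrite /bulk_angle /bulk_point.
rewrite (_ : (_ - _) / _ = cos psi); first exact: cosK.
by field; rewrite !gt_eqF.
Qed.

Lemma continuous_bulk_angle : {within `[left_edge, right_edge], continuous bulk_angle}.
Proof.
rewrite -bulk_point0 -bulk_point_pi.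
apply: segment_can_ge_continuous; first exact: pi_ge0.
  by apply: continuous_subspaceT; exact: continuous_bulk_point.
exact: bulk_pointK.
Qed.

Lemma bulk_angleK x : left_edge < x < right_edge ->
  (bulk_angle x \in `]0, pi[) /\ bulk_point (bulk_angle x) = x.
Proof.
move=> /andP[ax xb].
have h : -1 < (x / theta - (1 + t)) / (2 * sigma) < 1.
  rewrite ltr_pdivlMr ?mulr_gt0// ltr_pdivrMr ?mulr_gt0//.
  have e1 : left_edge = theta * (-1 * (2 * sigma) + (1 + t)).
    by rewrite /left_edge; move: sigma_sq; move: sigma => s <-; ring.
  have e2 : right_edge = theta * (1 * (2 * sigma) + (1 + t)).
    by rewrite /right_edge; move: sigma_sq; move: sigma => s <-; ring.
  by rewrite ltrBrDr ltrBlDr ltr_pdivlMr// ltr_pdivrMr//; apply/andP; split; lra.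
have /andP[h1 h2] := h.
split; first by rewrite in_itv/= acos_gt0 ?acos_ltpi// ?h1 ?h2 ?(ltW h1) ?(ltW h2).
rewrite /bulk_point /bulk_angle acosK ?in_itv/= ?(ltW h1) ?(ltW h2)//.
by field; rewrite !gt_eqF.
Qed.

(** On the curve, both quantities in the definition of the density factor through
    [2 theta sigma], as multiples of [sigma + cos psi] and [sin psi]. *)
Lemma limit_density_bulk (psi : R) : psi \in `]0, pi[ ->
  left_edge < bulk_point psi < right_edge ->
  limit_density theta t (bulk_point psi) =
  (theta * pi)^-1 * arccot ((sigma + cos psi) / sin psi).
Proof.
move=> hp hx; have hs : 0 < sin psi by apply: sin_gt0_pi; rewrite in_itv/= in hp.
rewrite /limit_density -/left_edge -/right_edge hx; congr (_ * arccot _).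
have -> : bulk_point psi + theta * (t - 1) = 2 * theta * sigma * (sigma + cos psi).
  by rewrite /bulk_point; move: sigma_sq; move: sigma => s <-; ring.
have -> : 4 * theta * t * bulk_point psi - (2 * theta * sigma * (sigma + cos psi)) ^+ 2 =
    (2 * theta * sigma * sin psi) ^+ 2.
  rewrite /bulk_point [in RHS]exprMn.
  rewrite (_ : sin psi ^+ 2 = 1 - cos psi ^+ 2); last by rewrite -(cos2Dsin2 psi); ring.
  by move: sigma_sq; move: sigma => s <-; ring.
rewrite sqrtr_sqr gtr0_norm; last by rewrite !mulr_gt0.
by field; rewrite !gt_eqF.
Qed.

(** Change of variable [x = bulk_point psi]; [alpha] is the continuous version of the
    angle, so that the fundamental theorem of calculus applies up to 0 and [pi]. *)
Lemma bulk_integral (alpha kappa F : R -> R) :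
  continuous alpha ->
  (forall psi, psi \in `]0, pi[ -> alpha psi = arccot ((sigma + cos psi) / sin psi)) ->
  (forall x, left_edge <= x -> {for x, continuous kappa}) ->
  continuous F ->
  (forall psi, psi \in `]0, pi[ ->
    is_derive psi 1 F (alpha psi * kappa (bulk_point psi) * (2 * theta * sigma * sin psi))) ->
  (\int[mu]_(x in `[left_edge, right_edge]) (kappa x * limit_density theta t x)%:E =
   ((F pi - F 0) / (theta * pi))%:E)%E.
Proof.
move=> calpha alphaE ckappa cF dF.
pose G x := kappa x * ((theta * pi)^-1 * alpha (bulk_angle x)).
have cG : {within `[left_edge, right_edge], continuous G}.
  have ck : {within `[left_edge, right_edge], continuous kappa}.
    apply: continuous_in_subspaceT => x /set_mem; rewrite /= in_itv/= => /andP[ax _].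
    exact: ckappa.
  move=> x; apply: cvgM; first exact: ck.
  apply: cvgMl_tmp; apply: continuous_comp; first exact: continuous_bulk_angle.
  exact: calpha.
have GE x : x \in `]left_edge, right_edge[ -> kappa x * limit_density theta t x = G x.
  rewrite in_itv/= => hx; have [ha e] := bulk_angleK hx.
  by rewrite /G alphaE//; have := limit_density_bulk ha; rewrite e => ->.
have iG : mu.-integrable `[left_edge, right_edge] (EFin \o G).
  by apply: continuous_compact_integrable; [exact: segment_compact|exact: cG].
have mG : measurable_fun `]left_edge, right_edge[ (EFin \o G).
  apply: measurable_funS (measurable_int _ iG) => //.
  exact: subset_itv_oo_cc.
transitivity (\int[mu]_(x in `[left_edge, right_edge]) (G x)%:E)%E.
  rewrite [RHS]integral_itv_bndoo// [LHS]integral_itv_bndoo; last first.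
    by apply: eq_measurable_fun mG => x /set_mem hx /=; rewrite GE.
  by apply: eq_integral => x /set_mem hx; rewrite GE.
rewrite -bulk_point0 -bulk_point_pi in cG *.
have dX : derive1 bulk_point = fun psi => - (2 * theta * sigma * sin psi).
  by apply/funext => psi; rewrite derive1E; exact: derive_val.
have cX' : continuous (fun psi : R => - (2 * theta * sigma * sin psi)).
  move=> psi; apply: cvgN; apply: cvgMl_tmp; exact: continuous_sin.
rewrite integration_by_substitution_decreasing//; first last.
- split.
  + by move=> psi _; exact: ex_derive.
  + by apply: cvg_at_right_filter; exact: continuous_bulk_point.
  + by apply: cvg_at_left_filter; exact: continuous_bulk_point.
- by rewrite dX; apply/cvg_ex; eexists; apply: cvg_at_left_filter; exact: cX'.
- by rewrite dX; apply/cvg_ex; eexists; apply: cvg_at_right_filter; exact: cX'.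
- by rewrite dX => psi _; exact: cX'.
- move=> u v hu hv vu; rewrite /bulk_point ltr_pM2l// ltrD2l ltr_pM2l ?mulr_gt0//.
  by rewrite ltr_cos.
- exact: pi_ge0.
under eq_integral => psi hp.
  rewrite [X in X%:E](_ : _ = alpha psi * kappa (bulk_point psi) *
    (2 * theta * sigma * sin psi) / (theta * pi)); last first.
    rewrite dX -[LHS]/(G (bulk_point psi) * - - (2 * theta * sigma * sin psi)).
    rewrite opprK /G bulk_pointK; last by move/set_mem : hp.
    by move: (theta * pi)^-1 => v; ring.
  over.
rewrite (@continuous_FTC2 _ _ (fun psi => F psi / (theta * pi)))//.
- by rewrite -EFinB mulrBl.
- exact: pi_gt0.
- apply: continuous_subspaceT => psi; apply: cvgMr_tmp; apply: cvgM.
    apply: cvgM; first exact: calpha.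
    apply: continuous_comp; first exact: continuous_bulk_point.
    by apply: ckappa; exact: bulk_point_ge.
  by apply: cvgMl_tmp; exact: continuous_sin.
- split.
  + by move=> psi hp; have := dF _ hp => d; exact: ex_derive.
  + by apply: cvg_at_right_filter; apply: cvgMr_tmp; exact: cF.
  + by apply: cvg_at_left_filter; apply: cvgMr_tmp; exact: cF.
- move=> psi hp; have d := dF _ hp.
  rewrite derive1E; apply: derive_val.
  by apply: is_derive_eq; rewrite /GRing.scale/=; move: (theta * pi)^-1 => v; ring.
Qed.

End bulk.

(** * Integrals against the density *)

Section density.
Context {R : realType} (theta t : R).
Hypotheses (theta_gt0 : 0 < theta) (t_gt0 : 0 < t).
Notation mu := (@lebesgue_measure R).
Local Notation sigma := (Num.sqrt t).
Local Notation phi := (limit_density theta t).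
Local Notation left_edge := (left_edge theta t).
Local Notation right_edge := (right_edge theta t).
Local Notation bulk_point := (bulk_point theta t).
Local Notation bulk_angle := (bulk_angle theta t).

Let sigma_gt0 : 0 < sigma. Proof. by rewrite sqrtr_gt0. Qed.
Let sigma_sq : sigma ^+ 2 = t. Proof. by rewrite sqr_sqrtr// ltW. Qed.

Lemma arccot_bounds (x : R) : 0 <= arccot x <= pi.
Proof.
by have := atan_gtNpi2 x; have := atan_ltpi2 x; rewrite /arccot => h1 h2; apply/andP; split; lra.
Qed.

Lemma limit_density_bounds x : 0 <= phi x <= theta^-1.
Proof.
have th : 0 <= theta^-1 by rewrite invr_ge0 ltW.
rewrite /limit_density; case: ifP => _; last by case: ifP => _; rewrite ?lexx ?th.
move: (arccot _) (arccot_bounds ((x + theta * (t - 1)) /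
  Num.sqrt (4 * theta * t * x - (x + theta * (t - 1)) ^+ 2))) => A /andP[h1 h2].
apply/andP; split; first by rewrite mulr_ge0// invr_ge0 mulr_ge0 ?pi_ge0// ltW.
have -> : (theta * pi)^-1 * A = theta^-1 * (A / pi) by rewrite invfM; ring.
by rewrite ler_piMr// ler_pdivrMr ?pi_gt0// mul1r.
Qed.

Lemma limit_density_right x : right_edge < x -> phi x = 0.
Proof.
move=> bx; have ab := left_edge_lt theta_gt0 t_gt0; have ax := lt_trans ab bx.
rewrite /limit_density -/left_edge -/right_edge ax/= ltNge (ltW bx)/=.
by rewrite [x < left_edge]ltNge (ltW ax) !andbF.
Qed.

Lemma limit_density_left x : 0 <= x < left_edge ->
  phi x = if t < 1 then theta^-1 else 0.
Proof.
move=> /andP[x0 xa]; rewrite /limit_density -/left_edge -/right_edge.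
by rewrite ltNge (ltW xa)/= x0 xa !andbT.
Qed.

Lemma measurable_limit_density : measurable_fun [set: R] phi.
Proof.
have [alpha [calpha alphaE _ _ _]] := angle_exists sigma_gt0.
pose h x := (theta * pi)^-1 * alpha (bulk_angle x).
have mh : measurable_fun `[left_edge, right_edge] h.
  apply: subspace_continuous_measurable_fun => // x.
  apply: cvgMl_tmp; apply: continuous_comp; last exact: calpha.
  exact: continuous_bulk_angle.
rewrite /limit_density -/left_edge -/right_edge.
apply: measurable_fun_if => //.
- by apply: measurable_and; exact: measurable_fun_ltr.
- rewrite setTI.
  apply: (@eq_measurable_fun _ _ _ _ _ h).
    move=> x /set_mem/= hx; have [ha e] := bulk_angleK theta_gt0 t_gt0 hx.
    have := limit_density_bulk theta_gt0 t_gt0 ha; rewrite e => /(_ hx).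
    by rewrite /limit_density -/left_edge -/right_edge hx => ->; rewrite /h alphaE.
  apply: measurable_funS mh => // x /= /andP[ax xb].
  by rewrite /= in_itv/= (ltW ax) (ltW xb).
- apply: measurable_funTS; apply: measurable_fun_ifT => //.
  apply: measurable_and => //; apply: measurable_and.
    exact: measurable_fun_ler.
  exact: measurable_fun_ltr.
Qed.

Local Notation halfline := ([set` `[0%R, +oo[] : set R).

(** Chasles' relation for nonnegative functions, at an end point of either kind. *)
Lemma ge0_integral_adjacent (f : R -> \bar R) (c : R) (b0 : bool) (u v : itv_bound R) :
  (u <= BSide b0 c)%O -> (BSide b0 c <= v)%O ->
  measurable_fun [set` Interval u v] f ->
  (forall x, x \in Interval u v -> 0 <= f x)%E ->
  (\int[mu]_(x in [set` Interval u v]) f x =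
   \int[mu]_(x in [set` Interval u (BSide b0 c)]) f x +
   \int[mu]_(x in [set` Interval (BSide b0 c) v]) f x)%E.
Proof.
move=> uc cv mf f0.
rewrite (@itv_bndbnd_setU _ _ u (BSide b0 c) v)// in mf *.
rewrite ge0_integral_setU//.
- move=> x [] /= hx; apply: f0.
    by apply: subset_itvl hx.
  by apply: subset_itvr hx.
- apply/eqP; rewrite -subset0 => x [] /=.
  rewrite !itv_boundlr => /andP[_ h1] /andP[h2 _].
  by have := le_trans h1 h2; rewrite bnd_simp ltxx.
Qed.

(** Integration by parts on the bulk moves the derivative from [kappa] to the angle,
    which replaces arccot by a rational function of [cos psi]; [L] is an
    antiderivative of the result.  The boundary term at [left_edge] is [angle_end]
    times [K left_edge], and the piece where the density is [theta^-1], present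
    exactly when [angle_end = pi], turns it into [angle_end] times [K 0]. *)
Lemma density_integral (kappa K L : R -> R) :
  (forall x : R, 0 <= x -> 0 <= kappa x) ->
  (forall x : R, 0 <= x -> {for x, continuous kappa}) ->
  (forall x : R, 0 <= x -> is_derive x 1 K (kappa x)) ->
  continuous L ->
  (forall psi : R, psi \in `]0, pi[ ->
     is_derive psi 1 L (angle_speed sigma psi * K (bulk_point psi))) ->
  (\int[mu]_(x in halfline) (kappa x * phi x)%:E =
   ((L pi - L 0 - angle_end sigma * K 0) / (theta * pi))%:E)%E.
Proof.
move=> k0 ck dK cL dL.
have a0 := left_edge_ge0 t theta_gt0; have ab := left_edge_lt theta_gt0 t_gt0.
have th := theta_gt0.
have [alpha [calpha alphaE dalpha alpha0 alphapi]] := angle_exists sigma_gt0.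
pose F psi := L psi - alpha psi * K (bulk_point psi).
have X0 psi : 0 <= bulk_point psi by apply: le_trans (bulk_point_ge theta_gt0 t_gt0 _).
have cK (x : R) : 0 <= x -> {for x, continuous K}.
  move=> x0; apply: differentiable_continuous; apply/derivable1_diffP.
  by have [] := dK _ x0.
have cF : continuous F.
  move=> psi; apply: cvgB; first exact: cL.
  apply: cvgM; first exact: calpha.
  apply: continuous_comp; first exact: continuous_bulk_point.
  exact: cK.
have dF (psi : R) : psi \in `]0, pi[ -> is_derive psi 1 F
    (alpha psi * kappa (bulk_point psi) * (2 * theta * sigma * sin psi)).
  move=> hp; have h1 := dL _ hp; have h2 := dalpha _ hp; have h3 := dK _ (X0 psi).
  have h4 := is_derive_bulk_point theta t psi.
  have h5 := is_derive1_comp h3 h4.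
  apply: is_derive_eq; rewrite /GRing.scale/=; ring.
have bulk := bulk_integral theta_gt0 t_gt0 calpha alphaE
  (fun x ax => ck _ (le_trans a0 ax)) cF dF.
have mk : measurable_fun halfline kappa.
  apply: subspace_continuous_measurable_fun => //.
  apply: continuous_in_subspaceT => x /set_mem; rewrite /= in_itv/= andbT => x0.
  exact: ck.
have mf : measurable_fun halfline (fun x => (kappa x * phi x)%:E).
  apply/measurable_EFinP; apply: measurable_funM => //.
  exact: measurable_funTS measurable_limit_density.
have f0 (x : R) : 0 <= x -> (0 <= (kappa x * phi x)%:E)%E.
  by move=> x0; rewrite lee_fin mulr_ge0 ?k0//; have /andP[] := limit_density_bounds x.
rewrite (ge0_integral_adjacent (c := left_edge) (b0 := true))//; last 1 first.
- by move=> x; rewrite in_itv/= andbT => x0; exact: f0.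
rewrite [X in (_ + X)%E](ge0_integral_adjacent (c := right_edge) (b0 := false))//; last 3 first.
- by rewrite bnd_simp ltW.
- apply: measurable_funS mf => // x /=; rewrite !in_itv/= !andbT; exact: le_trans.
- by move=> x; rewrite in_itv/= andbT => ax; apply: f0; exact: le_trans ax.
rewrite [X in (_ + X)%E](_ : _ = ((F pi - F 0) / (theta * pi))%:E); last first.
  rewrite -bulk [X in (_ + X)%E]integral0_eq ?adde0// => x /=.
  by rewrite in_itv/= andbT => bx; rewrite limit_density_right// mulr0.
have -> : (\int[mu]_(x in `[0%R, left_edge[) (kappa x * phi x)%:E =
   ((if t < 1 then theta^-1 else 0) * (K left_edge - K 0))%:E)%E.
  transitivity (\int[mu]_(x in `[0%R, left_edge[)
      ((if t < 1 then theta^-1 else 0)%:E * (kappa x)%:E))%E.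
    apply: eq_integral => x /set_mem; rewrite /= in_itv/= => hx.
    by rewrite limit_density_left// mulrC EFinM.
  have mk' : measurable_fun `[0, left_edge[ (EFin \o kappa).
    apply/measurable_EFinP; apply: measurable_funS mk => // x /=.
    by rewrite !in_itv/= andbT => /andP[].
  rewrite ge0_integralZl//; last 2 first.
  - by move=> x /=; rewrite in_itv/= => /andP[x0 _]; rewrite lee_fin k0.
  - by case: ifP => _; rewrite lee_fin// invr_ge0 ltW.
  rewrite EFinM; congr (_ * _)%E.
  move: a0; rewrite le_eqVlt => /predU1P[<-|a0].
    by rewrite set_itvco0 integral_set0 subrr.
  rewrite integral_itv_bndo_bndc// EFinB; apply: continuous_FTC2 => //.
  - apply: continuous_in_subspaceT => x /set_mem; rewrite /= in_itv/= => /andP[x0 _].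
    exact: ck.
  - split.
    + by move=> x; rewrite in_itv/= => /andP[x0 _]; have [] := dK _ (ltW x0).
    + by apply: cvg_at_right_filter; exact: cK.
    + by apply: cvg_at_left_filter; apply: cK; exact: ltW.
  - move=> x; rewrite in_itv/= => /andP[x0 _]; rewrite derive1E.
    by have [_ ->] := dK _ (ltW x0).
rewrite -EFinD /F alpha0 alphapi mul0r subr0 bulk_point_pi//; apply: (congr1 EFin).
have pin : pi != 0 :> R by rewrite gt_eqF ?pi_gt0.
have tn : theta != 0 by rewrite gt_eqF.
rewrite /angle_end.
have st : (sigma < 1) = (t < 1).
  by rewrite -{2}sigma_sq expr_lt1 ?ltW.
rewrite st; case: ifP => t1.
  move: (pi : R) (K left_edge) (K 0) (L _) (L _) pin => p A B C D pin.
  by field; rewrite pin tn.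
rewrite mul0r add0r; case: eqP => [s1|_]; last by rewrite !mul0r !subr0.
have -> : left_edge = 0 by rewrite /left_edge s1 subrr expr0n mulr0.
by congr (_ / _); ring.
Qed.

(** Here [angle_speed] cancels against [bulk_point], leaving
    [theta (1 + sigma cos psi)], of integral [theta pi]. *)
Lemma integral_limit_density : (\int[mu]_(x in halfline) (phi x)%:E = 1)%E.
Proof.
pose L (p : R) : R := theta * (p + sigma * sin p).
have cL : continuous L.
  move=> p; apply: cvgMl_tmp; apply: cvgD; first exact: cvg_id.
  by apply: cvgMl_tmp; exact: continuous_sin.
have dL (p : R) : p \in `]0, pi[ -> is_derive p 1 L (angle_speed sigma p * bulk_point p).
  move=> hp; have := modulus_gt0 sigma hp => hm.
  apply: is_derive_eq; rewrite /GRing.scale/= /angle_speed /bulk_point.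
  by move: hm; rewrite sigma_sq => hm; field; rewrite gt_eqF.
have dK (x : R) : 0 <= x -> is_derive x 1 id (cst 1 x) by move=> _; exact: is_derive_id.
transitivity (\int[mu]_(x in halfline) (cst 1 x * phi x)%:E)%E.
  by apply: eq_integral => x _; rewrite mul1r.
rewrite (density_integral _ _ dK cL dL)//; last by move=> x _; exact: cst_continuous.
rewrite /L sinpi sin0 !mulr0 !addr0 mulr0 !subr0 divff// mulf_neq0 ?gt_eqF//.
exact: pi_gt0.
Qed.

End density.

(** * The Stieltjes transform of the density *)

Section stieltjes.
Context {R : realType} (theta t : R).
Hypotheses (theta_gt0 : 0 < theta) (t_gt0 : 0 < t).
Notation mu := (@lebesgue_measure R).
Local Notation sigma := (Num.sqrt t).
Local Notation phi := (limit_density theta t).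
Local Notation bulk_point := (bulk_point theta t).
Local Notation halfline := ([set` `[0%R, +oo[] : set R).
Local Notation root := (discriminant_root theta t).

Let sigma_gt0 : 0 < sigma. Proof. by rewrite sqrtr_gt0. Qed.
Let sigma_sq : sigma ^+ 2 = t. Proof. by rewrite sqr_sqrtr// ltW. Qed.

Lemma discriminant_root_gt0 y : 0 < y -> 0 < root y.
Proof.
move=> y0; apply: le_lt_trans (discriminant_root_gt theta_gt0 t_gt0 y0).
exact: normr_ge0.
Qed.

(** The function [(2 angle_speed rho - 1)] is the Poisson kernel of the disc.  For the
    root [rho] in the disc of
    [theta sigma (rho + rho^-1) = y + theta (1 + t)] it is proportional
    to the inverse of [y + bulk_point], and so gives it an explicit antiderivative. *)
Lemma poisson_speed (y p : R) : 0 < y ->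
  let rho := 2 * theta * sigma / (y + theta * (1 + t) + root y) in
  [/\ 0 < rho, rho < 1 &
    (2 * angle_speed rho p - 1) / root y = (y + bulk_point p)^-1].
Proof.
move=> y0 rho.
have S0 := discriminant_root_gt0 y0.
have S2 := discriminant_root_sq theta_gt0 t_gt0 y0.
have th := theta_gt0; have t0 := t_gt0; have s0 := sigma_gt0.
rewrite {}/rho /angle_speed /bulk_point.
have := sqr_ge0 (sigma - 1); rewrite sqrrB1 sigma_sq => s1.
have A0 : 0 < y + theta * (1 + t) by rewrite addr_gt0 ?mulr_gt0//; lra.
have B0 : 0 < 2 * theta * sigma by rewrite !mulr_gt0.
have AB : 2 * theta * sigma < y + theta * (1 + t).
  have : 0 <= theta * (t - sigma *+ 2 + 1) by rewrite mulr_ge0 ?(ltW th).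
  rewrite -mulr_natl; lra.
have S2' : root y ^+ 2 = (y + theta * (1 + t)) ^+ 2 - (2 * theta * sigma) ^+ 2.
  by rewrite S2; move: sigma_sq; move: sigma => s <-; ring.
have -> : y + theta * (1 + t + 2 * sigma * cos p) =
  (y + theta * (1 + t)) + (2 * theta * sigma) * cos p.
  by ring.
move: (y + theta * (1 + t)) (2 * theta * sigma) (root y) A0 B0 AB S0 S2' => A B S A0 B0 AB S0 S2'.
have D0 : 0 < A + S by rewrite addr_gt0.
have r1 : B / (A + S) < 1 by rewrite ltr_pdivrMr// mul1r; lra.
have r0 : 0 < B / (A + S) by rewrite divr_gt0.
split => //.
have c1 : -1 <= cos p := cos_geN1 p; move: (cos p) c1 => c c1.
have ABc : 0 < A + B * c.
  have : B * -1 <= B * c by rewrite ler_pM2l.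
  by lra.
have e1 : 1 + (B / (A + S)) ^+ 2 + 2 * (B / (A + S)) * c = 2 * (A + B * c) / (A + S).
  apply: (@mulIf _ ((A + S) ^+ 2)); first by rewrite sqrf_eq0 gt_eqF.
  transitivity ((A + S) ^+ 2 + B ^+ 2 + 2 * B * (A + S) * c).
    by field; rewrite gt_eqF.
  transitivity (2 * (A + B * c) * (A + S)); last by field; rewrite gt_eqF.
  by move: S2'; rewrite !sqrrD; lra.
rewrite e1.
have e2 : 2 * (1 + B / (A + S) * c) - 2 * (A + B * c) / (A + S) = 2 * S / (A + S).
  by field; rewrite gt_eqF.
transitivity ((2 * (1 + B / (A + S) * c) - 2 * (A + B * c) / (A + S)) *
  (A + S) / (2 * (A + B * c)) / S).
  by field; rewrite !gt_eqF.
by rewrite e2; field; rewrite !gt_eqF.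
Qed.

Lemma is_derive_invD (y x : R) : 0 < x + y ->
  is_derive x 1 (fun x => - (x + y)^-1) ((x + y)^-1 ^+ 2).
Proof.
move=> xy; have n0 : x + y != 0 by rewrite gt_eqF.
have := @is_deriveV R (fun x => x + y) x 1 _ n0 => d.
apply: is_derive_eq; rewrite /GRing.scale/=.
by field.
Qed.

(** The exponent 2 makes [K = - (x + y)^-1] rational, so that [angle_speed * K]
    splits into a multiple of [angle_speed], a constant and a Poisson kernel. *)
Lemma integral_stieltjes_sq y : 0 < y ->
  (\int[mu]_(x in halfline) ((x + y)^-1 ^+ 2 * phi x)%:E =
   ((1 - (y + theta * (t - 1)) / root y) / (2 * theta * y))%:E)%E.
Proof.
move=> y0; have S0 := discriminant_root_gt0 y0; have pi0 := pi_gt0 R.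
have [alpha [calpha alphaE dalpha alpha0 alphapi]] := angle_exists sigma_gt0.
pose rho := 2 * theta * sigma / (y + theta * (1 + t) + root y).
have PS p := poisson_speed p y0.
have rho0 : 0 < rho by have [] := PS 0.
have rho1 : rho < 1 by have [] := PS 0.
pose phase p := p - atan (rho * sin p / (1 + rho * cos p)).
have pos p : 0 < 1 + rho * cos p.
  have h : rho * -1 <= rho * cos p by rewrite ler_pM2l// cos_geN1.
  lra.
have dphase (p : R) : is_derive p 1 phase (angle_speed rho p) by exact: is_derive_phase.
(* With [X] the point of angle [p], [theta * (1 + sigma * cos p)] is
[(X + theta * (1 - t)) / 2], and by partial fractions [angle_speed sigma p / (X + y)]
is the sum of [(angle_speed sigma p - 1 / 2) / y], a multiple of [1 / X], and of
[m / (X + y)]. *)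
pose m := (1 - theta * (1 - t) / y) / 2.
pose L (p : R) : R := - ((alpha p - p / 2) / y + m * ((2 * phase p - p) / root y)).
have cphase : continuous phase by move=> p; apply: continuous_phase.
have cL : continuous L.
  move=> p; apply: cvgN; apply: cvgD.
    apply: cvgMr_tmp; apply: cvgB; first exact: calpha.
    by apply: cvgMr_tmp; exact: cvg_id.
  apply: cvgMl_tmp; apply: cvgMr_tmp; apply: cvgB; last exact: cvg_id.
  by apply: cvgMl_tmp; exact: cphase.
have dL (p : R) : p \in `]0, pi[ -> is_derive p 1 L (angle_speed sigma p * - (bulk_point p + y)^-1).
  move=> hp; have hm := modulus_gt0 sigma hp; have d1 := dalpha _ hp; have d2 := dphase p.
  have [_ _ e] := PS p; rewrite -/rho in e.
  apply: is_derive_eq; rewrite /GRing.scale/=.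
  transitivity (- ((angle_speed sigma p - 2^-1) / y + m * ((2 * angle_speed rho p - 1) / root y))).
    by ring.
  rewrite e /angle_speed (addrC (bulk_point p)) /m /bulk_point sigma_sq in hm *.
  rewrite -[2 * sigma * cos p]mulrA in hm *; move: (sigma * cos p) hm => w hm.
  have hy : 0 < y + theta * (1 + t + 2 * w) by rewrite addr_gt0 ?mulr_gt0.
  by field; rewrite !gt_eqF.
have dK (x : R) : 0 <= x -> is_derive x 1 (fun x => - (x + y)^-1) ((x + y)^-1 ^+ 2).
  by move=> x0; apply: is_derive_invD; rewrite ltr_wpDl.
rewrite (density_integral theta_gt0 t_gt0 _ _ dK cL dL); first last.
- move=> x x0; have n0 : x + y != 0 by rewrite gt_eqF// ltr_wpDl.
  apply: (@continuous_comp _ _ _ (fun x : R => (x + y)^-1) (fun z : R => z ^+ 2)).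
    apply: cvgV => //; apply: cvgD; [exact: cvg_id|exact: cvg_cst].
  exact: exprn_continuous.
- by move=> x x0; rewrite sqr_ge0.
apply: (congr1 EFin).
have ph0 : phase 0 = 0 by rewrite /phase sin0 mulr0 mul0r atan0 subr0.
have php : phase pi = pi by rewrite /phase sinpi mulr0 mul0r atan0 subr0.
rewrite /L ph0 php alpha0 alphapi /m add0r.
move: (angle_end sigma) (pi : R) pi0 => e p p0.
by field; rewrite !gt_eqF.
Qed.

Definition stieltjes_density (y : R) : R :=
  (\int[mu]_(x in halfline) ((x + y)^-1 * phi x))%R.

Lemma integrable_density_bounded (kappa : R -> R) (M : R) :
  measurable_fun halfline kappa -> (forall x, 0 <= x -> `|kappa x| <= M) ->
  mu.-integrable halfline (fun x => (kappa x * phi x)%:E).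
Proof.
move=> mk bk.
have iphi : mu.-integrable halfline (EFin \o phi).
  apply/integrableP; split.
    by apply/measurable_EFinP; apply: measurable_funTS; exact: measurable_limit_density.
  under eq_integral => x _.
    rewrite gee0_abs/=; last first.
      by rewrite lee_fin; have /andP[] := limit_density_bounds t theta_gt0 x.
    over.
  by rewrite integral_limit_density// ltry.
have M0 : 0 <= M by apply: le_trans (bk 0 (lexx 0)); exact: normr_ge0.
apply: (@le_integrable _ _ _ mu halfline _ _ (fun x => M%:E * (phi x)%:E)%E) => //.
- apply/measurable_EFinP; apply: measurable_funM => //.
  by apply: measurable_funTS; exact: measurable_limit_density.
- move=> x hx; have x0 : 0 <= x by move: hx; rewrite /= in_itv/= andbT.
  rewrite -EFinM !abse_EFin lee_fin !normrM.
  by rewrite ler_wpM2r// (ger0_norm M0) bk.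
- exact: integrableZl.
Qed.

Lemma stieltjes_kernel_bound (y x : R) : 0 < y -> 0 <= x -> 0 <= (x + y)^-1 <= y^-1.
Proof.
move=> y0 x0; have xy : 0 < x + y by rewrite ltr_wpDl.
by rewrite invr_ge0 (ltW xy) lef_pV2// lerDr.
Qed.

Lemma measurable_stieltjes_kernel (y : R) : 0 < y ->
  measurable_fun halfline (fun x => (x + y)^-1).
Proof.
move=> y0; apply: subspace_continuous_measurable_fun => //.
apply: continuous_in_subspaceT => x /set_mem; rewrite /= in_itv/= andbT => x0.
have n0 : x + y != 0 by rewrite gt_eqF// ltr_wpDl.
by apply: cvgV => //; apply: cvgD; [exact: cvg_id|exact: cvg_cst].
Qed.

Lemma stieltjes_density_bounds y : 0 < y -> 0 <= stieltjes_density y <= y^-1.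
Proof.
move=> y0; have ik : mu.-integrable halfline (fun x => ((x + y)^-1 * phi x)%:E).
  apply: (integrable_density_bounded (M := y^-1)); first exact: measurable_stieltjes_kernel.
  by move=> x x0; have /andP[h1 h2] := stieltjes_kernel_bound y0 x0; rewrite ger0_norm.
have phi0 x : 0 <= phi x by have /andP[] := limit_density_bounds t theta_gt0 x.
apply/andP; split.
  apply: Rintegral_ge0 => x /=; rewrite in_itv/= andbT => x0.
  by rewrite mulr_ge0//; have /andP[] := stieltjes_kernel_bound y0 x0.
rewrite -lee_fin fineK; last exact: integrable_fin_num.
apply: (@le_trans _ _ (\int[mu]_(x in halfline) (y^-1%:E * (phi x)%:E))%E).
  apply: ge0_le_integral => //.
  - move=> x /=; rewrite in_itv/= andbT => x0; rewrite lee_fin mulr_ge0//.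
    by have /andP[] := stieltjes_kernel_bound y0 x0.
  - by have /integrableP[] := ik.
  - apply: measurable_funeM; apply/measurable_EFinP; apply: measurable_funTS.
    exact: measurable_limit_density.
  - move=> x /=; rewrite in_itv/= andbT => x0; rewrite -EFinM lee_fin ler_wpM2r//.
    by have /andP[] := stieltjes_kernel_bound y0 x0.
rewrite ge0_integralZl//.
- by rewrite integral_limit_density// mule1.
- apply/measurable_EFinP; apply: measurable_funTS; exact: measurable_limit_density.
- by move=> x _; rewrite lee_fin.
- by rewrite lee_fin invr_ge0 ltW.
Qed.

(** Differentiation under the integral, dominated on [y / 2, 2 y]. *)
Lemma is_derive_stieltjes_density (y : R) : 0 < y ->
  is_derive y 1 stieltjes_density
    (- ((1 - (y + theta * (t - 1)) / root y) / (2 * theta * y))).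
Proof.
move=> y0.
have phi0 x : 0 <= phi x by have /andP[] := limit_density_bounds t theta_gt0 x.
pose f (z x : R) : R := (x + z)^-1 * phi x.
have df (z x : R) : 0 < z -> 0 <= x -> is_derive z 1 (f ^~ x) (- (x + z)^-1 ^+ 2 * phi x).
  move=> z0 x0; have n0 : x + z != 0 by rewrite gt_eqF// ltr_wpDl.
  have := @is_deriveV R (fun z => x + z) z 1 _ n0 => d.
  apply: is_derive_eq; rewrite /GRing.scale/=.
  by move: (phi x) => p; field.
pose G (x : R) : R := (y / 2)^-1 ^+ 2 * phi x.
have G0 x : 0 <= G x by rewrite mulr_ge0 ?sqr_ge0.
have intG : mu.-integrable halfline (EFin \o G).
  apply: (integrable_density_bounded (M := (y / 2)^-1 ^+ 2)) => // x _.
  by rewrite ger0_norm ?sqr_ge0.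
have Iy : `]y / 2, y * 2[%classic y.
  by rewrite /= in_itv/=; apply/andP; split; lra.
have intf z : `]y / 2, y * 2[%classic z -> mu.-integrable halfline (EFin \o f z).
  rewrite /= in_itv/= => /andP[yz _]; have z0 : 0 < z by lra.
  apply: (integrable_density_bounded (M := z^-1)); first exact: measurable_stieltjes_kernel.
  by move=> x x0; have /andP[h1 h2] := stieltjes_kernel_bound z0 x0; rewrite ger0_norm.
have derf z x : `]y / 2, y * 2[%classic z -> halfline x -> derivable (f ^~ x) z 1.
  rewrite /= !in_itv/= andbT => /andP[yz _] x0; have z0 : 0 < z by lra.
  by have [] := df _ _ z0 x0.
have dE z x : 0 < z -> 0 <= x -> partial1of2 f z x = - (x + z)^-1 ^+ 2 * phi x.
  by move=> z0 x0; rewrite partial1of2E; have [_ ->] := df _ _ z0 x0.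
have Gub z x : `]y / 2, y * 2[%classic z -> halfline x -> `|partial1of2 f z x| <= G x.
  rewrite /= !in_itv/= andbT => /andP[yz _] x0; have z0 : 0 < z by lra.
  rewrite dE// mulNr normrN (ger0_norm (mulr_ge0 (sqr_ge0 _) (phi0 x))).
  have xz : 0 < x + z by lra.
  have y2 : 0 < y / 2 by lra.
  rewrite ler_wpM2r// lerXn2r ?nnegrE ?invr_ge0 ?(ltW xz) ?(ltW y2)//.
  by rewrite lef_pV2 ?posrE//; lra.
have mH : @measurable _ (measurableTypeR R) halfline by exact: measurable_itv.
split.
  exact: (@derivable_under_integral R _ (measurableTypeR R) mu f halfline
    mH y _ _ Iy intf derf G G0 intG Gub).
rewrite -derive1E.
apply: (etrans (@differentiation_under_integral R _ (measurableTypeR R) mu f halfline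
    mH y _ _ Iy intf derf G G0 intG Gub)).
transitivity (- \int[mu]_(x in halfline) ((x + y)^-1 ^+ 2 * phi x))%R.
  rewrite /Rintegral -fineN; congr fine.
  rewrite -integral_ge0N//; last first.
    by move=> x _; rewrite lee_fin mulr_ge0 ?sqr_ge0.
  apply: eq_integral => x /set_mem; rewrite /= in_itv/= andbT => x0.
  by rewrite dE// mulNr.
by rewrite /Rintegral integral_stieltjes_sq.
Qed.

Lemma is_derive_limit_stieltjes (y : R) : 0 < y ->
  is_derive y 1 (limit_stieltjes theta t)
    (- ((1 - (y + theta * (t - 1)) / root y) / (2 * theta * y))).
Proof.
move=> y0; have S0 := discriminant_root_gt0 y0.
have E0 : 0 < exp_stieltjes theta t y.
  by have := exp_stieltjes_gt1 theta_gt0 t_gt0 y0; lra.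
have P0 : 0 < (y - theta * (t - 1)) ^+ 2 + 4 * t * theta * y.
  by rewrite -discriminant_root_sq// exprn_gt0.
have dS : is_derive y 1 root ((y - theta * (t - 1) + 2 * t * theta) / root y).
  pose pol (z : R) : R := (z - theta * (t - 1)) ^+ 2 + 4 * t * theta * z.
  have d1 : is_derive y 1 pol
      (2 * (y - theta * (t - 1)) + 4 * t * theta).
    by apply: is_derive_eq; rewrite /GRing.scale/=; ring.
  have d2 := is_derive1_sqrt P0.
  have d3 := @is_derive1_comp R Num.sqrt pol y _ _ d2 d1.
  apply: (@is_derive_eq _ _ _ root y 1 _ _ d3).
  rewrite -[Num.sqrt (pol y)]/(root y).
  by move: (root y) S0 => S S0; field; rewrite gt_eqF.
have dE : is_derive y 1 (exp_stieltjes theta t)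
    ((1 + (y - theta * (t - 1) + 2 * t * theta) / root y) / (2 * y) - exp_stieltjes theta t y / y).
  have n0 : 2 * y != 0 by rewrite mulf_neq0 ?gt_eqF.
  have := @is_deriveV R (fun z => 2 * z) y 1 _ n0 => dV.
  rewrite /exp_stieltjes.
  apply: is_derive_eq; rewrite /GRing.scale/=.
  by field; rewrite !gt_eqF.
have dL := is_derive1_ln E0.
have := is_derive1_comp dL dE => d4.
rewrite /limit_stieltjes.
apply: is_derive_eq; rewrite /GRing.scale/=.
have S2 := discriminant_root_sq theta_gt0 t_gt0 y0.
have W0 : 0 < y - theta * (t - 1) + root y.
  have := discriminant_root_gt theta_gt0 t_gt0 y0.
  by rewrite ltr_norml => /andP[h _]; lra.
rewrite /exp_stieltjes; move: (root y) S0 S2 W0 => S S0 S2 W0.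
apply/eqP; rewrite -subr_eq0.
rewrite (_ : _ - _ = ((y - theta * (t - 1)) ^+ 2 + 4 * t * theta * y - S ^+ 2) /
   (2 * theta * y * S * (y - theta * (t - 1) + S))); last first.
  by field; rewrite !gt_eqF.
by rewrite S2 subrr mul0r.
Qed.

(** Both sides have the same derivative and lie between 0 and [y^-1], so that their
    constant difference is at most [y^-1] for all [y]. *)
Lemma stieltjes_densityE y : 0 < y -> stieltjes_density y = limit_stieltjes theta t y.
Proof.
pose k := stieltjes_density 1 - limit_stieltjes theta t 1.
have E z : 0 < z -> stieltjes_density z = limit_stieltjes theta t z + k.
  move=> z0.
  have mem1 : (1 : R) \in `]0, z + 2[ by rewrite in_itv/=; apply/andP; split; lra.
  have memz : z \in `]0, z + 2[ by rewrite in_itv/=; apply/andP; split; lra.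
  pose df (w : R) := - ((1 - (w + theta * (t - 1)) / root w) / (2 * theta * w)).
  have h1 (w : R) : w \in `]0, z + 2[ -> is_derive w 1 stieltjes_density (df w).
    by rewrite in_itv/= => /andP[w0 _]; exact: is_derive_stieltjes_density.
  have h2 (w : R) : w \in `]0, z + 2[ ->
      is_derive w 1 (fun w => limit_stieltjes theta t w + k) (df w).
    rewrite in_itv/= => /andP[w0 _]; have d := is_derive_limit_stieltjes w0.
    by apply: is_derive_eq; rewrite addr0.
  have e1 : stieltjes_density 1 = limit_stieltjes theta t 1 + k by rewrite /k addrC subrK.
  exact: (@is_derive_eq_oo R stieltjes_density _ _ _ _ _ h1 h2 mem1 e1 z memz).
have kz z : 0 < z -> `|k| <= z^-1.
  move=> z0; have := E z z0; have /andP[a1 a2] := stieltjes_density_bounds z0.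
  have /andP[b1 b2] := limit_stieltjes_bounds theta_gt0 t_gt0 z0 => e.
  by rewrite ler_norml; apply/andP; split; lra.
suff k0 : k = 0 by move=> y0; rewrite E// k0 addr0.
apply/eqP; apply/contraT => kn0.
have k1 : 0 < `|k| by rewrite normr_gt0.
have := kz (2 / `|k|) (divr_gt0 (ltr0Sn _ _) k1).
by rewrite invf_div; lra.
Qed.

End stieltjes.

(** * Weierstrass approximation *)

Section bernstein.
Context {R : realType}.
Implicit Types (h : nat -> R) (u c M : R).

(** The expectation of [h] at a binomial variable of parameters [n] and [u], by
    conditioning on the first trial. *)
Fixpoint bernstein n h u : R :=
  if n is n'.+1 then u * bernstein n' (h \o S) u + (1 - u) * bernstein n' h u
  else h 0%N.

Lemma bernsteinD n h1 h2 u :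
  bernstein n (fun k => h1 k + h2 k) u = bernstein n h1 u + bernstein n h2 u.
Proof.
elim: n h1 h2 => [//|n IH] h1 h2 /=.
by rewrite [bernstein n (_ \o S) u]IH IH; ring.
Qed.

Lemma bernsteinZ n c h u : bernstein n (fun k => c * h k) u = c * bernstein n h u.
Proof.
elim: n h => [//|n IH] h /=.
by rewrite [bernstein n (_ \o S) u]IH IH; ring.
Qed.

Lemma bernstein_cst n c u : bernstein n (fun=> c) u = c.
Proof.
elim: n => [//|n IH] /=.
by rewrite -[(fun=> c) \o S]/(fun=> c) IH; ring.
Qed.

Lemma le_bernstein n h1 h2 u : 0 <= u <= 1 ->
  (forall k, (k <= n)%N -> h1 k <= h2 k) -> bernstein n h1 u <= bernstein n h2 u.
Proof.
move=> /andP[u0 u1]; elim: n h1 h2 => [|n IH] h1 h2 le_h /=; first exact: le_h.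
apply: lerD; apply: ler_wpM2l; rewrite ?subr_ge0//; apply: IH => k kn.
  exact: le_h.
by apply: le_h; exact: leqW.
Qed.

Lemma bernstein_sqr n c u :
  bernstein n (fun k => (k%:R - c) ^+ 2) u = n%:R * u * (1 - u) + (n%:R * u - c) ^+ 2.
Proof.
elim: n c => [|n IH] c /=; first by ring.
have -> : ((fun k : nat => (k%:R - c) ^+ 2) \o S) = (fun k : nat => (k%:R - (c - 1)) ^+ 2).
  by apply/funext => k /=; rewrite -natr1; congr (_ ^+ 2); ring.
by rewrite !IH -natr1; ring.
Qed.

Lemma bernstein_poly n h : exists p : {poly R}, forall u, bernstein n h u = p.[u].
Proof.
elim: n h => [|n IH] h; first by exists (h 0%N)%:P => u; rewrite hornerC.
have [p1 E1] := IH (h \o S); have [p2 E2] := IH h.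
exists ('X * p1 + (1 - 'X) * p2) => u /=.
by rewrite E1 E2 !hornerE.
Qed.

(** Bernstein's proof: by uniform continuity,
    [|F (k / n) - F u| <= eps / 2 + C (k - n u)^2], and the binomial variance makes the
    expectation of the last term at most [eps / 2] for large [n]. *)
Lemma weierstrass_approximation (F : R -> R) M (eps : R) : 0 < eps ->
  (forall x, 0 <= x <= 1 -> `|F x| <= M) ->
  (forall x, 0 <= x <= 1 -> forall e : R, 0 < e -> exists2 d : R, 0 < d &
     forall z, 0 <= z <= 1 -> `|z - x| < d -> `|F z - F x| <= e) ->
  exists p : {poly R}, forall u, 0 <= u <= 1 -> `|F u - p.[u]| <= eps.
Proof.
move=> eps0 FM Fc.
have [d d0 unif] : exists2 d : R, 0 < d & forall x, 0 <= x <= 1 ->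
    forall z, 0 <= z <= 1 -> `|z - x| < d -> `|F z - F x| <= eps / 2.
  have /compact_near_coveringP cov := @segment_compact R 0 1.
  have := cov R (0^'+) (fun d x => 0 <= x <= 1 ->
    forall z, 0 <= z <= 1 -> `|z - x| < d -> `|F z - F x| <= eps / 2).
  move=> /(_ _ _)/wrap[].
    move=> x /=; rewrite in_itv/= => x01.
    have [d d0 Fd] := Fc x x01 (eps / 4) (divr_gt0 eps0 (ltr0Sn _ _)).
    exists ([set y | `|y - x| < d / 2], [set e : R | e < d / 2]) => /=.
      split; last by apply: nbhs_right_lt; rewrite divr_gt0.
      apply/nbhs_ballP; exists (d / 2); rewrite /= ?divr_gt0// => z.
      by rewrite /ball/= distrC.
    move=> [y e] /= [yx ed] y01 z z01 zy.
    have h1 : `|F y - F x| <= eps / 4 by apply: Fd => //; lra.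
    have h2 : `|F z - F x| <= eps / 4.
      apply: Fd => //; rewrite (_ : z - x = (z - y) + (y - x)); last by ring.
      by apply: (le_lt_trans (ler_normD _ _)); lra.
    rewrite (_ : F z - F y = (F z - F x) - (F y - F x)); last by ring.
    by apply: (le_trans (ler_normB _ _)); lra.
  move=> H.
  have [d [dH d0]] : exists d : R, `[0, 1] `<=` (fun x => 0 <= x <= 1 ->
      forall z, 0 <= z <= 1 -> `|z - x| < d -> `|F z - F x| <= eps / 2) /\ 0 < d.
    have : \forall d \near (0 : R)^'+, `[0, 1] `<=` (fun x => 0 <= x <= 1 ->
      forall z, 0 <= z <= 1 -> `|z - x| < d -> `|F z - F x| <= eps / 2) /\ 0 < d.
      apply: filterI; first exact: H.
      exact: nbhs_right_gt.
    by move=> /filter_ex[d ?]; exists d.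
  by exists d => // x x01; apply: dH => //=; rewrite in_itv.
have M0 : 0 <= M by apply: le_trans (FM 0 _); rewrite ?normr_ge0// lexx ler01.
pose n := (Num.truncn (4 * M / (d ^+ 2 * eps))).+1.
have n0 : 0 < n%:R :> R by rewrite ltr0n.
have hn : 2 * M / (d ^+ 2 * n%:R) <= eps / 2.
  have : 4 * M / (d ^+ 2 * eps) < n%:R by exact: truncnS_gt.
  rewrite ltr_pdivrMr ?mulr_gt0 ?exprn_gt0// => h.
  rewrite ler_pdivrMr ?mulr_gt0 ?exprn_gt0//; lra.
have [p pE] := bernstein_poly n (fun k => F (k%:R / n%:R)).
exists p => u u01; rewrite -pE.
pose C := 2 * M / (d ^+ 2 * n%:R ^+ 2).
have C0 : 0 <= C by apply: divr_ge0; [exact: mulr_ge0|rewrite -exprMn sqr_ge0].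
have key k : (k <= n)%N ->
    `|F (k%:R / n%:R) - F u| <= eps / 2 + C * (k%:R - n%:R * u) ^+ 2.
  move=> kn; have k01 : 0 <= (k%:R / n%:R : R) <= 1.
    by rewrite divr_ge0//= ler_pdivrMr// mul1r ler_nat.
  have [lt|ge] := ltP `|k%:R / n%:R - u| d.
    by apply: (le_trans (unif _ u01 _ k01 lt)); rewrite lerDl mulr_ge0 ?sqr_ge0.
  apply: (@le_trans _ _ (2 * M)).
    apply: (le_trans (ler_normB _ _)).
    by have := FM _ k01; have := FM _ u01; lra.
  have -> : C * (k%:R - n%:R * u) ^+ 2 = 2 * M * (`|k%:R / n%:R - u| ^+ 2 / d ^+ 2).
    rewrite real_normK ?num_real// /C.
    by field; rewrite !gt_eqF.
  have : 1 <= `|k%:R / n%:R - u| ^+ 2 / d ^+ 2.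
    rewrite ler_pdivlMr ?exprn_gt0// mul1r lerXn2r ?nnegrE// ltW//.
  move=> h1; have : 2 * M * 1 <= 2 * M * (`|k%:R / n%:R - u| ^+ 2 / d ^+ 2).
    by rewrite ler_wpM2l// mulr_ge0.
  by lra.
have B : bernstein n (fun k => eps / 2 + C * (k%:R - n%:R * u) ^+ 2) u <= eps.
  rewrite bernsteinD bernstein_cst bernsteinZ bernstein_sqr subrr expr0n addr0.
  suff : C * (n%:R * u * (1 - u)) <= eps / 2 by lra.
  apply: le_trans hn.
  have -> : C * (n%:R * u * (1 - u)) = 2 * M / (d ^+ 2 * n%:R) * (u * (1 - u)).
    by rewrite /C; field; rewrite !gt_eqF.
  apply: ler_piMr; first by apply: divr_ge0; [exact: mulr_ge0|apply: mulr_ge0; rewrite ?sqr_ge0].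
  by move: u01 => /andP[u0 u1]; rewrite mulr_ile1// ?subr_ge0//; lra.
rewrite ler_norml; apply/andP; split.
  have : bernstein n (fun k => F (k%:R / n%:R)) u <=
         bernstein n (fun k => F u + (eps / 2 + C * (k%:R - n%:R * u) ^+ 2)) u.
    by apply: le_bernstein => // k /key; rewrite ler_norml => /andP[_]; lra.
  by rewrite bernsteinD bernstein_cst; lra.
have : bernstein n (fun k => F u + -1 * (eps / 2 + C * (k%:R - n%:R * u) ^+ 2)) u <=
       bernstein n (fun k => F (k%:R / n%:R)) u.
  by apply: le_bernstein => // k /key; rewrite ler_norml => /andP[+ _]; lra.
by rewrite bernsteinD bernstein_cst bernsteinZ; lra.
Qed.

End bernstein.

(** * Functions whose empirical mean concentrates *)

Section test_functions.
Context {R : realType} (theta t : R).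
Hypotheses (theta_gt0 : 0 < theta) (t_gt0 : 0 < t).
Notation mu := (@lebesgue_measure R).
Local Notation phi := (limit_density theta t).
Local Notation halfline := ([set` `[0%R, +oo[] : set R).
Implicit Types (kappa : R -> R) (A B C : forall N, set (N.-tuple R)).

Definition vanishing A :=
  charlier_law theta (t * N%:R) N (A N) @[N --> \oo] --> 0%E.

(** Only the states of partitions are compared, the law being carried by them. *)
Lemma vanishing_sub A B C : vanishing B -> vanishing C ->
  (forall N l, A N (state_tuple theta l) ->
    B N (state_tuple theta l) \/ C N (state_tuple theta l)) ->
  vanishing A.
Proof.
move=> vB vC ABC.
apply: (@squeeze_cvge _ _ _ _ (cst 0%E) _ (fun N =>
  charlier_law theta (t * N%:R) N (B N) + charlier_law theta (t * N%:R) N (C N))%E).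
- near=> N; rewrite measure_ge0/=.
  have N0 : (0 < N)%N by near: N; exact: nbhs_infty_gt.
  apply: charlier_law_leU => //; last exact: ABC.
  by rewrite mulr_gt0// ltr0n.
- exact: cvg_cst.
- rewrite -[X in _ --> X]adde0; exact: cvgeD.
Unshelve. all: by end_near.
Qed.

Lemma vanishing_set0 : vanishing (fun=> set0).
Proof.
rewrite /vanishing; under eq_fun do rewrite measure0.
exact: cvg_cst.
Qed.

Definition limit_mean kappa : R := \int[mu]_(x in halfline) (kappa x * phi x).

Definition sample_mean kappa (N : nat) (u : N.-tuple R) : R :=
  N%:R^-1 * \sum_(i < N) kappa (tnth u i / N%:R).

Definition bounded_measurable kappa := measurable_fun halfline kappa /\
  exists M, forall x, 0 <= x -> `|kappa x| <= M.

Definition concentrates kappa := forall eps, 0 < eps -> vanishing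
  (fun N => [set u | eps <= `|sample_mean kappa u - limit_mean kappa|]).

Lemma bounded_measurable_integrable kappa : bounded_measurable kappa ->
  mu.-integrable halfline (fun x => (kappa x * phi x)%:E).
Proof. by move=> [mk [M kM]]; exact: (integrable_density_bounded _ _ mk kM). Qed.

Lemma bounded_measurableD kappa kappa' :
  bounded_measurable kappa -> bounded_measurable kappa' ->
  bounded_measurable (fun x => kappa x + kappa' x).
Proof.
move=> [mk [M kM]] [mk' [M' kM']]; split; first exact: measurable_funD.
by exists (M + M') => x x0; rewrite (le_trans (ler_normD _ _))// lerD ?kM ?kM'.
Qed.

Lemma bounded_measurableZ c kappa :
  bounded_measurable kappa -> bounded_measurable (fun x => c * kappa x).
Proof.
move=> [mk [M kM]]; split; first exact: measurable_funM.
by exists (`|c| * M) => x x0; rewrite normrM ler_wpM2l// kM.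
Qed.

Lemma bounded_measurable_cst c : bounded_measurable (fun=> c).
Proof. by split => //; exists `|c|. Qed.

Lemma limit_meanD kappa kappa' :
  bounded_measurable kappa -> bounded_measurable kappa' ->
  limit_mean (fun x => kappa x + kappa' x) = limit_mean kappa + limit_mean kappa'.
Proof.
move=> bk bk'; rewrite /limit_mean -RintegralD//=.
- by under eq_Rintegral do rewrite mulrDl.
- exact: bounded_measurable_integrable.
- exact: bounded_measurable_integrable.
Qed.

Lemma limit_meanZ c kappa : bounded_measurable kappa ->
  limit_mean (fun x => c * kappa x) = c * limit_mean kappa.
Proof.
move=> bk; rewrite /limit_mean -RintegralZl//=.
- by under eq_Rintegral do rewrite -mulrA.
- exact: bounded_measurable_integrable.
Qed.

Lemma limit_mean_cst c : limit_mean (fun=> c) = c.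
Proof.
have := limit_meanZ c (bounded_measurable_cst 1).
rewrite /limit_mean; under eq_Rintegral do rewrite mulr1.
move=> ->; rewrite /Rintegral; under eq_integral do rewrite mul1r.
by rewrite integral_limit_density// mulr1.
Qed.

Lemma le_limit_mean kappa kappa' :
  bounded_measurable kappa -> bounded_measurable kappa' ->
  (forall x, 0 <= x -> kappa x * phi x <= kappa' x * phi x) ->
  limit_mean kappa <= limit_mean kappa'.
Proof.
move=> bk bk' le; apply: le_Rintegral => //=.
- exact: bounded_measurable_integrable.
- exact: bounded_measurable_integrable.
- by move=> x; rewrite /= in_itv/= andbT; exact: le.
Qed.

Lemma sample_meanD kappa kappa' N (u : N.-tuple R) :
  sample_mean (fun x => kappa x + kappa' x) u = sample_mean kappa u + sample_mean kappa' u.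
Proof. by rewrite /sample_mean big_split mulrDr. Qed.

Lemma sample_meanZ c kappa N (u : N.-tuple R) :
  sample_mean (fun x => c * kappa x) u = c * sample_mean kappa u.
Proof. by rewrite /sample_mean -mulr_sumr mulrCA. Qed.

Lemma dist_limit_mean kappa kappa1 kappa2 :
  bounded_measurable kappa -> bounded_measurable kappa1 -> bounded_measurable kappa2 ->
  (forall x, 0 <= x -> `|kappa x - kappa1 x| <= kappa2 x) ->
  `|limit_mean kappa - limit_mean kappa1| <= limit_mean kappa2.
Proof.
move=> b b1 b2 h.
have b2' := bounded_measurableZ (-1) b2.
have phi0 x : 0 <= phi x by case/andP: (limit_density_bounds t theta_gt0 x).
rewrite ler_distlC; apply/andP; split.
  have -> : limit_mean kappa - limit_mean kappa2 =
      limit_mean (fun x => kappa x + -1 * kappa2 x).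
    by rewrite limit_meanD// limit_meanZ// mulN1r.
  apply: le_limit_mean => //; first exact: bounded_measurableD.
  move=> x /h; rewrite ler_norml => hx; apply: ler_wpM2r => //; lra.
rewrite -limit_meanD//.
apply: le_limit_mean => //; first exact: bounded_measurableD.
move=> x /h; rewrite ler_norml => hx; apply: ler_wpM2r => //; lra.
Qed.

Lemma dist_sample_mean kappa kappa1 kappa2 N (u : N.-tuple R) :
  (forall i, 0 <= tnth u i) ->
  (forall x, 0 <= x -> `|kappa x - kappa1 x| <= kappa2 x) ->
  `|sample_mean kappa u - sample_mean kappa1 u| <= sample_mean kappa2 u.
Proof.
move=> u0 h; rewrite /sample_mean -mulrBr normrM ger0_norm ?invr_ge0//.
rewrite ler_wpM2l ?invr_ge0// -sumrB (le_trans (ler_norm_sum _ _ _))//.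
by apply: ler_sum => i _; apply: h; rewrite divr_ge0.
Qed.

Lemma state_tuple_ge0 N (l : {ffun 'I_N -> nat}) i : 0 <= tnth (state_tuple theta l) i.
Proof. by rewrite tnth_mktuple position_ge0. Qed.

Lemma concentratesD kappa kappa' :
  bounded_measurable kappa -> bounded_measurable kappa' ->
  concentrates kappa -> concentrates kappa' ->
  concentrates (fun x => kappa x + kappa' x).
Proof.
move=> b b' ck ck' eps e0; have e2 : 0 < eps / 2 by rewrite divr_gt0.
apply: (vanishing_sub (ck _ e2) (ck' _ e2)) => N l /=.
rewrite sample_meanD limit_meanD//.
set a := sample_mean kappa _; set b1 := sample_mean kappa' _.
rewrite opprD addrACA => h.
case: (leP (eps / 2) `|a - limit_mean kappa|) => h1; first by left.
right; have := le_trans h (ler_normD _ _); lra.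
Qed.

Lemma concentrates_cst c : concentrates (fun=> c).
Proof.
move=> eps e0; rewrite /vanishing.
apply: cvg_near_cst; near=> N.
have N0 : (0 < N)%N by near: N; exact: nbhs_infty_gt.
apply/eqP; rewrite [X in charlier_law _ _ _ X](_ : _ = set0) ?measure0//.
apply/seteqP; split => // u /=; rewrite limit_mean_cst /sample_mean.
rewrite sumr_const card_ord -[c *+ N]mulr_natl mulKf ?pnatr_eq0 -?lt0n//.
by rewrite subrr normr0 leNgt e0.
Unshelve. all: by end_near.
Qed.

Lemma concentratesZ c kappa : bounded_measurable kappa ->
  concentrates kappa -> concentrates (fun x => c * kappa x).
Proof.
move=> b ck eps e0.
have e1 : 0 < eps / (`|c| + 1) by rewrite divr_gt0// ltr_wpDl.
apply: (vanishing_sub (ck _ e1) vanishing_set0) => N l /=.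
rewrite sample_meanZ limit_meanZ// -mulrBr normrM => h; left.
rewrite ler_pdivrMr ?ltr_wpDl// mulrC (le_trans h)// ler_wpM2r//; lra.
Qed.

(** The empirical mean is monotone on partitions, whose positions are nonnegative,
    and the integral against the density is monotone too; so [kappa] inherits
    concentration from [kappa1 - kappa2] and [kappa1 + kappa2]. *)
Lemma concentrates_approx kappa : bounded_measurable kappa ->
  (forall eps, 0 < eps -> exists kappa1 kappa2,
    [/\ bounded_measurable kappa1 /\ concentrates kappa1,
        bounded_measurable kappa2 /\ concentrates kappa2,
        forall x, 0 <= x -> `|kappa x - kappa1 x| <= kappa2 x &
        limit_mean kappa2 <= eps]) ->
  concentrates kappa.
Proof.
move=> b H eps e0; have e4 : 0 < eps / 4 by rewrite divr_gt0.
have [k1 [k2 [[b1 c1] [b2 c2] h k2e]]] := H _ e4.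
apply: (vanishing_sub (c1 _ e4) (c2 _ e4)) => N l /= he.
have u0 := @state_tuple_ge0 N l.
have := dist_sample_mean u0 h; have := dist_limit_mean b b1 b2 h.
set u := state_tuple theta l in he *.
case: (leP (eps / 4) `|sample_mean k1 u - limit_mean k1|) => h1; first by left.
case: (leP (eps / 4) `|sample_mean k2 u - limit_mean k2|) => h2; first by right.
move: h1 h2; rewrite !ltr_norml !ler_norml => h1 h2 h3 h4.
move: he; rewrite ler_normr; lra.
Qed.

End test_functions.

(** The mean value inequality for [x ^+ n.+1] between [b] and [a]. *)
Lemma subrX_bounds (R : realDomainType) (a b : R) n : 0 <= b -> b <= a ->
  (a - b) * (n.+1%:R * b ^+ n) <= a ^+ n.+1 - b ^+ n.+1 <= (a - b) * (n.+1%:R * a ^+ n).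
Proof.
move=> b0 ab; have a0 := le_trans b0 ab.
elim: n => [|n /andP[lo hi]]; first by rewrite !expr0 !expr1 !mulr1 !lexx.
have -> : a ^+ n.+2 - b ^+ n.+2 = a * (a ^+ n.+1 - b ^+ n.+1) + b ^+ n.+1 * (a - b).
  by rewrite (exprS a n.+1) (exprS b n.+1); ring.
have h1 := ler_wpM2l a0 hi; have h2 := ler_wpM2l b0 lo.
have h3 : b * (a ^+ n.+1 - b ^+ n.+1) <= a * (a ^+ n.+1 - b ^+ n.+1).
  by rewrite ler_wpM2r// subr_ge0 lerXn2r.
have h4 : b ^+ n.+1 * (a - b) <= a ^+ n.+1 * (a - b).
  by rewrite ler_wpM2r ?subr_ge0// lerXn2r.
have -> : (a - b) * (n.+2%:R * b ^+ n.+1) =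
    b * ((a - b) * (n.+1%:R * b ^+ n)) + b ^+ n.+1 * (a - b).
  by rewrite exprS -(natr1 n.+1); ring.
have -> : (a - b) * (n.+2%:R * a ^+ n.+1) =
    a * ((a - b) * (n.+1%:R * a ^+ n)) + a ^+ n.+1 * (a - b).
  by rewrite exprS -(natr1 n.+1); ring.
by apply/andP; split; lra.
Qed.

Section class.
Context {R : realType} (theta t : R).
Hypotheses (theta_gt0 : 0 < theta) (t_gt0 : 0 < t).
Local Notation limit_mean := (limit_mean theta t).
Local Notation concentrates := (concentrates theta t).

Definition self_averaging (kappa : R -> R) :=
  bounded_measurable kappa /\ concentrates kappa.

Lemma self_averaging_cst c : self_averaging (fun=> c).
Proof. by split; [exact: bounded_measurable_cst|exact: concentrates_cst]. Qed.

Lemma self_averagingD kappa kappa' : self_averaging kappa ->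
  self_averaging kappa' -> self_averaging (fun x => kappa x + kappa' x).
Proof.
move=> [b c] [b' c']; split; first exact: bounded_measurableD.
exact: concentratesD.
Qed.

Lemma self_averagingZ c kappa : self_averaging kappa ->
  self_averaging (fun x => c * kappa x).
Proof.
move=> [b k]; split; first exact: bounded_measurableZ.
exact: concentratesZ.
Qed.

Lemma bounded_measurable_stieltjes_kernel_exp (y : R) n : 0 < y ->
  bounded_measurable (fun x => (x + y)^-1 ^+ n).
Proof.
move=> y0; split.
  apply: measurable_funX; exact: measurable_stieltjes_kernel.
exists (y^-1 ^+ n) => x x0; case/andP: (stieltjes_kernel_bound y0 x0) => p q.
by rewrite ger0_norm ?exprn_ge0// lerXn2r// nnegrE ltW// invr_gt0.
Qed.

Lemma self_averaging_stieltjes_kernel (y : R) : 0 < y ->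
  self_averaging (fun x => (x + y)^-1).
Proof.
move=> y0; split.
  by have := bounded_measurable_stieltjes_kernel_exp 1 y0; under eq_fun do rewrite expr1.
move=> eps e0.
have E N (u : N.-tuple R) :
    sample_mean (fun x => (x + y)^-1) u = mean_stieltjes y u.
  by congr (_ * _); apply: eq_bigr => i _; rewrite addrC.
have := mean_stieltjes_concentration theta_gt0 t_gt0 y0 e0.
rewrite -(stieltjes_densityE theta_gt0 t_gt0 y0) /vanishing.
by under eq_fun do under eq_set do rewrite -E.
Qed.

(** Since [a - b = h a b] for [a = 1 / (x + y)] and [b = 1 / (x + y + h)], the difference
    quotient of [a ^+ n.+1] divided by [n.+1] lies between [b ^+ n.+2] and [a ^+ n.+2]. *)
Lemma stieltjes_kernel_quotient (y h x : R) n : 0 < y -> 0 < h -> 0 <= x ->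
  `|(x + y)^-1 ^+ n.+2 -
    (n.+1%:R * h)^-1 * ((x + y)^-1 ^+ n.+1 - (x + (y + h))^-1 ^+ n.+1)| <=
  h * (n.+2%:R * y^-1 ^+ n.+3).
Proof.
move=> y0 h0 x0.
have yh0 : 0 < y + h by rewrite addr_gt0.
case/andP: (stieltjes_kernel_bound y0 x0) => a0 ay.
case/andP: (stieltjes_kernel_bound yh0 x0) => b0 _.
have E : (x + y)^-1 - (x + (y + h))^-1 = h * (x + y)^-1 * (x + (y + h))^-1.
  by field; rewrite !gt_eqF// ltr_wpDl.
move: ((x + y)^-1) ((x + (y + h))^-1) (y^-1) a0 ay b0 E => a b c a0 ac b0 E.
have ba : b <= a by rewrite -subr_ge0 E !mulr_ge0// ltW.
have /andP[lo hi] := subrX_bounds n b0 ba.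
have /andP[_ hi2] := subrX_bounds n.+1 b0 ba.
have n0 : 0 < n.+1%:R * h by rewrite mulr_gt0.
have q1 : b ^+ n.+2 <= (n.+1%:R * h)^-1 * (a ^+ n.+1 - b ^+ n.+1).
  rewrite mulrC ler_pdivlMr// (le_trans _ lo)// E.
  rewrite [leRHS](_ : _ = a * b ^+ n.+1 * (n.+1%:R * h)); last by rewrite exprS; ring.
  by rewrite ler_wpM2r ?(ltW n0)// exprS ler_wpM2r// exprn_ge0.
have q2 : (n.+1%:R * h)^-1 * (a ^+ n.+1 - b ^+ n.+1) <= a ^+ n.+2.
  rewrite mulrC ler_pdivrMr// (le_trans hi)// E.
  rewrite [leLHS](_ : _ = b * a ^+ n.+1 * (n.+1%:R * h)); last by rewrite exprS; ring.
  by rewrite ler_wpM2r ?(ltW n0)// [leRHS]exprS ler_wpM2r// exprn_ge0.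
have q3 : a ^+ n.+2 - b ^+ n.+2 <= h * (n.+2%:R * c ^+ n.+3).
  rewrite (le_trans hi2)// E.
  rewrite [leLHS](_ : _ = (h * n.+2%:R) * (a ^+ n.+2 * b)); last by rewrite [a ^+ n.+2]exprS; ring.
  rewrite [leRHS]mulrA ler_wpM2l ?mulr_ge0// ?(ltW h0)// [c ^+ _]exprSr.
  by rewrite ler_pM ?exprn_ge0// ?(le_trans ba)// lerXn2r ?nnegrE// (le_trans a0).
rewrite ger0_norm ?subr_ge0// (le_trans _ q3)// lerD2l lerN2.
exact: q1.
Qed.

(** The next power is a uniform limit of difference quotients in [y] of the present
    one, which is known for all [y]. *)
Lemma self_averaging_stieltjes_kernel_exp n (y : R) : 0 < y ->
  self_averaging (fun x => (x + y)^-1 ^+ n).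
Proof.
case: n y => [|n] y y0; first by under eq_fun do rewrite expr0; exact: self_averaging_cst.
elim: n y y0 => [|n IH] y y0.
  by under eq_fun do rewrite expr1; exact: self_averaging_stieltjes_kernel.
split; first exact: bounded_measurable_stieltjes_kernel_exp.
apply: concentrates_approx => //; first exact: bounded_measurable_stieltjes_kernel_exp.
move=> eps e0.
have K0 : 0 < n.+2%:R * y^-1 ^+ n.+3 by rewrite mulr_gt0// exprn_gt0// invr_gt0.
pose h := eps / (n.+2%:R * y^-1 ^+ n.+3).
have h0 : 0 < h by rewrite divr_gt0.
exists (fun x => (n.+1%:R * h)^-1 * ((x + y)^-1 ^+ n.+1 + -1 * (x + (y + h))^-1 ^+ n.+1)).
exists (fun=> eps); split.
- apply: self_averagingZ; apply: self_averagingD; first exact: IH.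
  by apply: self_averagingZ; apply: IH; rewrite addr_gt0.
- exact: self_averaging_cst.
- move=> x x0; rewrite mulN1r (le_trans (stieltjes_kernel_quotient n y0 h0 x0))//.
  by rewrite /h divfK// gt_eqF.
- by rewrite limit_mean_cst.
Qed.

Lemma self_averaging_poly (p : {poly R}) :
  self_averaging (fun x => p.[(x + 1)^-1]).
Proof.
under eq_fun do rewrite horner_coef.
elim: (size p) => [|n IH].
  by under eq_fun do rewrite big_ord0; exact: self_averaging_cst.
under eq_fun do rewrite big_ord_recr.
apply: self_averagingD => //; apply: self_averagingZ.
exact: self_averaging_stieltjes_kernel_exp.
Qed.

(** The density vanishes beyond [right_edge]. *)
Lemma limit_mean_stieltjes_kernel (y : R) : 0 < y ->
  y / (right_edge theta t + y) <= y * limit_mean (fun x => (x + y)^-1).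
Proof.
move=> y0.
have b0 : 0 <= right_edge theta t by rewrite mulr_ge0 ?sqr_ge0// ltW.
have bm := (self_averaging_stieltjes_kernel y0).1.
rewrite -limit_meanZ// -[leLHS](limit_mean_cst theta_gt0 t_gt0).
apply: le_limit_mean => //.
- exact: bounded_measurable_cst.
- exact: bounded_measurableZ.
- move=> x x0; have [xb|bx] := leP x (right_edge theta t).
    apply: ler_wpM2r; first by case/andP: (limit_density_bounds t theta_gt0 x).
    rewrite ler_wpM2l ?(ltW y0)// lef_pV2 ?posrE ?ltr_wpDl//; lra.
  by rewrite limit_density_right// !mulr0.
Qed.

End class.

(** * Bounded continuous functions *)

Section bounded_continuous.
Context {R : realType} (theta t : R).
Hypotheses (theta_gt0 : 0 < theta) (t_gt0 : 0 < t).
Local Notation halfline := ([set` `[0%R, +oo[] : set R).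
Variables (f : R -> R) (M : R).
Hypotheses (f_cont : {within halfline, continuous f})
  (f_bounded : forall x, 0 <= x -> `|f x| <= M).

Let M_ge0 : 0 <= M. Proof. exact: le_trans (normr_ge0 _) (f_bounded (lexx 0)). Qed.

Lemma continuous_extension : continuous (fun x : R => f (Num.max x 0)).
Proof.
have mc : continuous (fun x : R => Num.max x 0).
  move=> x; apply: continuous_max; [exact: cvg_id|exact: cvg_cst].
move=> x U fU.
have h0 : halfline (Num.max x 0) by rewrite /= in_itv/= le_max lexx orbT.
have /subspace_continuousP/(_ _ h0 U fU) hU := f_cont.
have {}hU : nbhs (Num.max x 0) (fun z => halfline z -> U (f z)) := hU.
have {}hU : nbhs x (fun z => halfline (Num.max z 0) -> U (f (Num.max z 0))) := mc x _ hU.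
change (nbhs x (fun z => U (f (Num.max z 0)))).
apply: filterS hU => z; apply.
by rewrite /= in_itv/= le_max lexx orbT.
Qed.

(** The function [f x * (y / (x + y))] in the variable [u = 1 / (1 + x)]; it extends by 0
    to [u = 0]. *)
Definition compactified (y u : R) :=
  f (Num.max ((1 - u) / u) 0) * (y * u / (1 - u + y * u)).

Lemma compactifiedE (y x : R) : 0 < y -> 0 <= x ->
  compactified y (x + 1)^-1 = f x * (y / (x + y)).
Proof.
move=> y0 x0; have x1 : 0 < x + 1 by rewrite ltr_wpDl.
have xy : 0 < x + y by rewrite ltr_wpDl.
rewrite /compactified.
have -> : (1 - (x + 1)^-1) / (x + 1)^-1 = x by field; rewrite gt_eqF.
rewrite max_l//; congr (_ * _); field.
by rewrite !gt_eqF//; lra.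
Qed.

Lemma compactified_le (y u : R) : 1 <= y -> 0 <= u <= 1 ->
  `|compactified y u| <= M * (y * u) /\ `|compactified y u| <= M.
Proof.
move=> y1 /andP[u0 u1]; have y0 : 0 <= y by lra.
have yu : 0 <= y * u by rewrite mulr_ge0.
have d1 : 1 <= 1 - u + y * u.
  have : u <= y * u by rewrite ler_peMl.
  by lra.
have fM : `|f (Num.max ((1 - u) / u) 0)| <= M by apply: f_bounded; rewrite le_max lexx orbT.
have d0 : 0 < 1 - u + y * u by lra.
rewrite /compactified normrM (@ger0_norm _ (_ / _)) ?divr_ge0// ?(ltW d0)//.
split; last first.
  rewrite -[leRHS]mulr1 ler_pM// ?divr_ge0// ?(ltW d0)// ler_pdivrMr//; lra.
rewrite ler_pM// ?divr_ge0// ?(ltW d0)// ler_pdivrMr// ler_peMr//.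
Qed.

Lemma compactified_continuous (y x : R) : 1 <= y -> 0 <= x <= 1 ->
  forall e, 0 < e -> exists2 d, 0 < d &
    forall z, 0 <= z <= 1 -> `|z - x| < d -> `|compactified y z - compactified y x| <= e.
Proof.
move=> y1 /andP[]; rewrite le_eqVlt => /predU1P[<-|x0] x1 e e0.
  have K0 : 0 < M * y + 1 by rewrite ltr_wpDl// mulr_ge0//; lra.
  exists (e / (M * y + 1)); first by rewrite divr_gt0.
  move=> z z01; have /andP[z0 z1] := z01; rewrite subr0 ger0_norm// => ze.
  have -> : compactified y 0 = 0 by rewrite /compactified mulr0 mul0r mulr0.
  rewrite subr0; apply: (le_trans (compactified_le y1 z01).1).
  move: ze; rewrite ltr_pdivlMr// => /ltW; apply: le_trans.
  rewrite mulrA mulrC ler_wpM2l//; lra.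
have c : {for x, continuous (compactified y)}.
  have x0' : x != 0 by rewrite gt_eqF.
  have d0 : 1 - x + y * x != 0.
    have : x <= y * x by rewrite ler_peMl// ltW.
    by move=> ?; rewrite gt_eqF//; lra.
  apply: continuousM.
    apply: (@continuous_comp _ _ _ (fun u : R => (1 - u) / u) (fun u => f (Num.max u 0))).
      apply: continuousM; last by apply: continuousV.
      by apply: continuousB; [exact: cvg_cst|exact: cvg_id].
    exact: continuous_extension.
  have cy : {for x, continuous (fun u => y * u)}.
    by apply: continuousM; [exact: cvg_cst|exact: cvg_id].
  apply: continuousM => //; apply: continuousV => //.
  apply: continuousD => //.
  by apply: continuousB; [exact: cvg_cst|exact: cvg_id].
have /cvgrPdist_le/(_ e e0) := c => -[d /= d0 h].
by exists d => // z _ zx; rewrite distrC; apply: h; rewrite /= distrC.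
Qed.

(** Replacing [f x] by [f x * (y / (x + y))] costs [M (1 - y / (x + y))], itself a
    function of the class, whose mean tends to 0 as [y] grows. *)
Lemma self_averaging_continuous : self_averaging theta t f.
Proof.
have bm : bounded_measurable f.
  split; first exact: subspace_continuous_measurable_fun.
  by exists M.
split=> //; apply: concentrates_approx => // eps e0.
set b := right_edge theta t.
have b0 : 0 <= b by rewrite mulr_ge0 ?sqr_ge0// ltW.
have e2 : 0 < eps / 2 by rewrite divr_gt0.
(* With this [y], [M (1 - y / (b + y)) = M b / (b + y) <= eps / 2]. *)
pose y := 1 + 2 * M * b / eps.
have y1 : 1 <= y by rewrite lerDl divr_ge0 ?(ltW e0)// mulr_ge0// mulr_ge0//.
have y0 : 0 < y := lt_le_trans ltr01 y1.
have [p hp] := weierstrass_approximation e2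
  (fun u hu => (compactified_le y1 hu).2) (fun x hx => compactified_continuous y1 hx).
have sy := self_averaging_stieltjes_kernel theta_gt0 t_gt0 y0.
have sMy := self_averagingZ theta_gt0 t_gt0 (- (M * y)) sy.
exists (fun x => p.[(x + 1)^-1]), (fun x => (eps / 2 + M) + - (M * y) * (x + y)^-1).
split.
- exact: self_averaging_poly.
- by apply: self_averagingD => //; exact: self_averaging_cst.
- move=> x x0; have x1 : 0 < x + 1 by rewrite ltr_wpDl.
  have xy : 0 < x + y by rewrite ltr_wpDl.
  have u01 : 0 <= (x + 1)^-1 <= 1 by rewrite invr_ge0 (ltW x1) invf_le1//; lra.
  have := hp _ u01; rewrite compactifiedE// => h.
  have := f_bounded x0.
  have q1 : y / (x + y) <= 1 by rewrite ler_pdivrMr//; lra.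
  have -> : f x - p.[(x + 1)^-1] = f x * (1 - y / (x + y)) +
      (f x * (y / (x + y)) - p.[(x + 1)^-1]) by ring.
  move=> fM.
  have h2 : `|f x| * (1 - y / (x + y)) <= M * (1 - y / (x + y)).
    by rewrite ler_wpM2r// subr_ge0.
  rewrite (le_trans (ler_normD _ _))// normrM (@ger0_norm _ (1 - _)) ?subr_ge0//.
  rewrite mulNr -mulrA.
  move: h h2; lra.
- have sc := self_averaging_cst theta_gt0 t_gt0 (eps / 2 + M).
  rewrite limit_meanD//; [|exact: sc.1|exact: sMy.1].
  rewrite limit_mean_cst// limit_meanZ//; last exact: sy.1.
  have := limit_mean_stieltjes_kernel theta_gt0 t_gt0 y0; rewrite -/b => h.
  have h2 := ler_wpM2l M_ge0 h.
  have h3 : M - M * (y / (b + y)) <= eps / 2.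
    have by0 : 0 < b + y by rewrite ltr_wpDl.
    rewrite (_ : _ - _ = M * b / (b + y)); last by field; rewrite gt_eqF.
    rewrite ler_pdivrMr//.
    have : eps / 2 * (2 * M * b / eps) = M * b by field; rewrite gt_eqF.
    have : 0 <= eps / 2 * b by rewrite mulr_ge0// ltW.
    rewrite /y; lra.
  rewrite mulNr -mulrA; lra.
Qed.

End bounded_continuous.

(** * Convergence of the empirical measures *)

Section empirical.
Context {R : realType} (N : nat).
Implicit Types (u : N.-tuple R) (f g : R -> R).
Local Notation halfline := ([set` `[0%R, +oo[] : set R).

Lemma ge0_integral_empirical u g : measurable_fun halfline g ->
  (forall x, 0 <= x -> 0 <= g x) ->
  (\int[empirical_measure u]_(x in halfline) (g x)%:E)%E =
  (sample_mean (g \_ halfline) u)%:E.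
Proof.
move=> mg g0.
have mEg : measurable_fun halfline (fun x => (g x)%:E) by apply/measurable_EFinP.
have g0' x : halfline x -> (0 <= (g x)%:E)%E.
  by rewrite /= in_itv/= andbT lee_fin; exact: g0.
rewrite /empirical_measure ge0_integral_mscale//.
rewrite ge0_integral_measure_sum//.
rewrite /sample_mean EFinM -sumEFin; congr (_ * _)%E.
apply: eq_bigr => i _; rewrite integral_dirac// diracE -tnth_nth patchE.
by case: ifP => _; rewrite ?mul1e ?mul0e.
Qed.

(** The indicator function [f \_ halfline] appears because the points of an arbitrary
    tuple may be negative. *)
Lemma integral_empirical u f : measurable_fun halfline f ->
  \int[empirical_measure u]_(x in halfline) f x = sample_mean (f \_ halfline) u.
Proof.
move=> mf; rewrite /Rintegral integralE.
have mm : measurable_fun halfline (fun x => Num.max (f x) 0) by exact: measurable_maxr.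
have mm' : measurable_fun halfline (fun x => Num.max (- f x) 0).
  by apply: measurable_maxr => //; exact: measurableT_comp.
under eq_integral do rewrite funeposE -EFin_max.
under [X in (_ - X)%E]eq_integral do rewrite funenegE -EFinN -EFin_max.
rewrite !ge0_integral_empirical// -?EFinB/=; try by move=> *; rewrite le_max lexx orbT.
rewrite /sample_mean -mulrBr -sumrB; congr (_ * _); apply: eq_bigr => i _.
rewrite !patchE; case: ifP => _; rewrite ?subrr//.
case: (leP 0 (f (tnth u i / N%:R))) => h.
  by rewrite max_r ?subr0// oppr_le0.
by rewrite max_l ?sub0r ?opprK// oppr_ge0 ltW.
Qed.

Lemma measurable_sample_mean f : measurable_fun setT f ->
  measurable_fun setT (fun u : N.-tuple R => sample_mean f u).
Proof.
move=> mf; apply: measurable_funM => //; apply: measurable_sum => i.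
apply: measurableT_comp => //; apply: measurable_funM => //.
exact: measurable_tnth.
Qed.

End empirical.

Theorem proposition6p14 (R : realType) (theta t : R)
    (d : nat -> measure_display) (T : forall N : nat, measurableType (d N))
    (P : forall N : nat, probability (T N) R)
    (ell : forall N : nat, {RV (P N) >-> N.-tuple R}) :
  0 < theta -> 0 < t ->
  (forall (N : nat) (A : set (N.-tuple R)), measurable A ->
     distribution (P N) (ell N) A = charlier_law theta (t * N%:R) N A) ->
  cvg_weakly_in_probability P (fun N w => empirical_measure (ell N w))
    (limit_density theta t).
Proof.
move=> theta_gt0 t_gt0 ell_law f f_cont f_bounded eps eps_gt0.
have [M fM] : exists M, forall x, 0 <= x -> `|f x| <= M.
  have [M [_ /(_ (M + 1)) h]] := f_bounded.
  exists (M + 1) => x x0; apply: h; rewrite ?ltrDl//=.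
  by rewrite in_itv/= x0.
have mf : measurable_fun ([set` `[0%R, +oo[] : set R) f.
  exact: subspace_continuous_measurable_fun.
have mf' : measurable_fun setT (f \_ [set` `[0%R, +oo[]).
  by apply/(measurable_restrictT _ _).1.
(* The hypothesis on the law of [ell] is about measurable sets: the event is described
by a measurable function of the whole tuple, which agrees with the empirical mean of
[f] on partitions. *)
pose B N := [set u : N.-tuple R |
  eps <= `|sample_mean (f \_ [set` `[0%R, +oo[]) u - limit_mean theta t f|].
have mB N : measurable (B N).
  have mD : measurable_fun setT (fun u : N.-tuple R =>
      `|sample_mean (f \_ [set` `[0%R, +oo[]) u - limit_mean theta t f|).
    apply: measurableT_comp => //; apply: measurable_funB => //.
    exact: measurable_sample_mean.
  rewrite -[B N]setTI.
  have -> : B N = (fun u : N.-tuple R =>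
      `|sample_mean (f \_ [set` `[0%R, +oo[]) u - limit_mean theta t f|) @^-1` [set` `[eps, +oo[].
    by apply/seteqP; split => u; rewrite /B/= in_itv/= andbT.
  exact: mD.
have E N : P N [set w | eps <= `|\int[empirical_measure (ell N w)]_(x in `[0, +oo[) f x -
    \int[lebesgue_measure]_(x in `[0, +oo[) (f x * limit_density theta t x)|] =
    charlier_law theta (t * N%:R) N (B N).
  rewrite -ell_law// /distribution /pushforward; congr (P N _).
  by apply/seteqP; split => w; rewrite /B/= integral_empirical.
under eq_fun do rewrite E.
have [_ /(_ _ eps_gt0) cf] := self_averaging_continuous theta_gt0 t_gt0 f_cont fM.
apply: (vanishing_sub theta_gt0 t_gt0 cf (vanishing_set0 theta t)) => N l /= h.
left; move: h; rewrite /B/=; congr (_ <= `|_ - _|).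
congr (_ * _); apply: eq_bigr => i _; rewrite patchE mem_set//=.
by rewrite in_itv/= andbT divr_ge0// state_tuple_ge0.
Qed.
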